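(* Let $\Gamma\in\mathcal{Z}(p,q)$ for $p+q=3$. Assume $G_\Gamma^+\ne\{\operatorname{id}\}$. We can make a linear change of coordinates on $\mathbb{R}^3$ so that one of the following 4 possibilities holds (only the possibly non-zero Christoffel symbols are listed, up to the symmetry $\Gamma_{ij}{}^k=\Gamma_{ji}{}^k$): (1) There exist $(a,b,c,d)\in\mathbb{R}^4$ so $G_\Gamma^+=\operatorname{SO}(1,1)$, $\Gamma_{12}{}^3=a$, $\Gamma_{13}{}^1=b$, $\Gamma_{23}{}^2=c$, $\Gamma_{33}{}^3=d$, and $\rho_\Gamma=ad(e^1\otimes e^2+e^2\otimes e^1)+(-b^2+bd+c(-c+d))e^3\otimes e^3$. We require $ad\ne0$ and $-b^2+bd+c(-c+d)\ne0$. (2) There exist $(a,b,c,d)\in\mathbb{R}^4$ so $G_\Gamma^+=\operatorname{SO}(2)$, $\Gamma_{11}{}^3=a$, $\Gamma_{13}{}^1=b$, $\Gamma_{13}{}^2=c$, $\Gamma_{22}{}^3=a$, $\Gamma_{23}{}^1=-c$, $\Gamma_{23}{}^2=b$, $\Gamma_{33}{}^3=d$, and $\rho_\Gamma=\operatorname{diag}(ad,ad,2(bd-b^2+c^2))$. We require $ad\ne0$ and $bd-b^2+c^2\ne0$. (3) The group $G_\Gamma^+$ is finite, there exists an element of order $3$ in $G_\Gamma^+$, and there exist $(a,b,c,d)\in\mathbb{R}^4$ so $\Gamma_{11}{}^1=1$, $\Gamma_{11}{}^3=a$, $\Gamma_{12}{}^2=-1$, $\Gamma_{13}{}^1=b$,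 $\Gamma_{13}{}^2=c$, $\Gamma_{22}{}^1=-1$, $\Gamma_{22}{}^3=a$, $\Gamma_{23}{}^1=-c$, $\Gamma_{23}{}^2=b$, $\Gamma_{33}{}^3=d$, and $\rho_\Gamma=(ad-2)(e^1\otimes e^1+e^2\otimes e^2)+2(bd-b^2+c^2)e^3\otimes e^3$. We require $ad-2\ne0$ and $-b^2+c^2+bd\ne0$. We have $G_\Gamma^+=\mathbb{Z}_3$ except for the following exceptional structures, which are given up to isomorphism by: (a) $a=0$, $b=0$, $c=1$, $d=0$, and $G_\Gamma^+=s_3$. (b) $c=0$, $a=b=\pm\frac1{\sqrt2}$, $d=\mp\sqrt2$, and $G_\Gamma^+=a_4$. (4) The group $G_\Gamma^+$ is finite and all non-identity elements of $G_\Gamma^+$ have order $2$. There are two structures up to isomorphism: (a) $G_\Gamma^+=\mathbb{Z}_2\oplus\mathbb{Z}_2$, $\Gamma_{12}{}^3=1$, $\Gamma_{13}{}^2=1$, $\Gamma_{23}{}^1=-1$, and $\rho_\Gamma=-2(e^1\otimes e^1+e^2\otimes e^2)+2e^3\otimes e^3$. (b) $G_\Gamma^+=\mathbb{Z}_2$, $\Gamma_{ij}{}^k=0$ unless the index $3$ appears an odd number of times, $\Gamma_{11}{}^3=a$, $\Gamma_{12}{}^3=\Gamma_{21}{}^3=b$, $\Gamma_{13}{}^1=\Gamma_{31}{}^1=c$, $\Gamma_{13}{}^2=\Gamma_{31}{}^2=d$, $\Gamma_{22}{}^3=e$, $\Gamma_{23}{}^1=\Gamma_{32}{}^1=f$,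 $\Gamma_{23}{}^2=\Gamma_{32}{}^2=g$, $\Gamma_{33}{}^3=h$ (with $a,\dots,h$ real), $\rho_{11}=-2bd+a(-c+g+h)$, $\rho_{12}=\rho_{21}=-de-af+bh$, $\rho_{33}=-c^2-2df+ch+g(-g+h)$. One requires $\det(\rho)\ne0$.
   Context: $\mathcal{Z}(3)$ is the vector space of arrays $\Gamma=(\Gamma_{ij}{}^k)_{1\le i,j,k\le 3}$ of real constants with $\Gamma_{ij}{}^k=\Gamma_{ji}{}^k$ (constant Christoffel symbols of a torsion free connection on $\mathbb{R}^3$). Repeated indices are summed. The Ricci tensor of $\Gamma$, which is symmetric here, is $\rho=\rho_{\Gamma}=\rho_{jk}\,e^j\otimes e^k$ with $\rho_{jk}=\Gamma_{in}{}^i\Gamma_{jk}{}^n-\Gamma_{jn}{}^i\Gamma_{ik}{}^n$. For $p+q=3$, $\mathcal{Z}(p,q)$ is the set of $\Gamma\in\mathcal{Z}(3)$ for which $\rho_\Gamma$ is non-degenerate with signature $(p,q)$: $p$ negative and $q$ positive directions. $\operatorname{GL}(3,\mathbb{R})$ acts on $\mathcal{Z}(3)$ by linear change of coordinates: $(T\Gamma)(e_i,e_j,e^k)=\Gamma(Te_i,Te_j,Te^k)$, where $\{e_i\}$ is the standard basis, $\{e^i\}$ its dual basis, $\Gamma(e_i,e_j,e^k)=\Gamma_{ij}{}^k$, and $T$ acts on covectors by the dual action (so that $\langle Te^k,Te_i\rangle=\delta^k_i$). ''Making a linear change of coordinates'' means replacing $\Gamma$ by $T\Gamma$ for some $T\in\operatorname{GL}(3,\mathbb{R})$,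 and ''up to isomorphism'' means up to such a change. $\operatorname{GL}^+(3,\mathbb{R})$ is the subgroup with positive determinant, and $G_\Gamma^+:=\{T\in\operatorname{GL}^+(3,\mathbb{R}):T\Gamma=\Gamma\}$. For finite groups, equalities such as $G_\Gamma^+=\mathbb{Z}_3$ mean isomorphism of groups. The following subgroups of $\operatorname{GL}^+(3,\mathbb{R})$ are used: $$\operatorname{SO}(2)=\left\{\begin{pmatrix}\cos\theta&\sin\theta&0\\-\sin\theta&\cos\theta&0\\0&0&1\end{pmatrix}:0\le\theta\le2\pi\right\},\qquad \operatorname{SO}(1,1)=\left\{\begin{pmatrix}\alpha&0&0\\0&\alpha^{-1}&0\\0&0&1\end{pmatrix}:\alpha\in\mathbb{R}\setminus\{0\}\right\}.$$ $s_3$ is the symmetric group on 3 elements (order 6), and $a_4$ is the alternating group on 4 elements (order 12).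
   Formalization: In (4a) the Ricci tensor is corrected: the listed symbols give ρ = −2 e¹⊗e¹ + 2(e²⊗e² + e³⊗e³), not the printed −2(e¹⊗e¹ + e²⊗e²) + 2 e³⊗e³. *)

(* Defs.v *)
From HB Require Import structures.
From mathcomp Require Export all_boot all_order all_algebra all_fingroup all_solvable.
From mathcomp Require Export all_classical all_reals all_analysis.

Set Implicit Arguments.
Unset Strict Implicit.
Unset Printing Implicit Defensive.

Import Order.TTheory GRing.Theory Num.Theory.

Local Open Scope classical_set_scope.
Local Open Scope ring_scope.

(* [i1 i2 i3] are the indices 1, 2, 3 of R^3. *)
Definition i1 : 'I_3 := @Ordinal 3 0 isT.
Definition i2 : 'I_3 := @Ordinal 3 1 isT.
Definition i3 : 'I_3 := @Ordinal 3 2 isT.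

(* [G i j k] is Gamma_{ij}^k. *)
Definition christoffel (R : realType) := 'I_3 -> 'I_3 -> 'I_3 -> R.

Definition torsion_free (R : realType) (G : christoffel R) : Prop :=
  forall i j k, G i j k = G j i k.

Definition ricci (R : realType) (G : christoffel R) : 'M[R]_3 :=
  \matrix_(j, k) (\sum_i \sum_n G i n i * G j k n
                  - \sum_i \sum_n G j n i * G i k n).

(* [p] negative, [q] positive and [m - p - q] null directions. *)
Definition has_signature (R : realType) (m p q : nat) (A : 'M[R]_m) : Prop :=
  exists2 P : 'M[R]_m, P \in unitmx &
    P^T *m A *m P
    = diag_mx (\row_j (if (j < p)%N then -1 else if (j < p + q)%N then 1 else 0)).

Definition Zpq (R : realType) (p q : nat) (G : christoffel R) : Prop :=
  [/\ torsion_free G, ricci G \in unitmx & has_signature p q (ricci G)].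

(* Gamma(u, v, w) for vectors u, v and a covector w. *)
Definition evalG (R : realType) (G : christoffel R)
    (u v : 'cV[R]_3) (w : 'rV[R]_3) : R :=
  \sum_i \sum_j \sum_k G i j k * u i 0 * v j 0 * w 0 k.

(* T e_i is the i-th column of T; the covector T e^k, determined by
   <T e^k, T e_i> = delta^k_i, is the k-th row of the inverse of T. *)
Definition act (R : realType) (T : 'M[R]_3) (G : christoffel R) : christoffel R :=
  fun i j k => evalG G (col i T) (col j T) (row k (invmx T)).

Definition isomorphic (R : realType) (G G' : christoffel R) : Prop :=
  exists2 T : 'M[R]_3, T \in unitmx & G' = act T G.

Definition Gplus (R : realType) (G : christoffel R) : set 'M[R]_3 :=
  [set T | 0 < \det T /\ act T G = G].

Definition mx3 (R : realType) (s : seq (seq R)) : 'M[R]_3 :=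
  \matrix_(i, j) (nth [::] s i)`_j.

Definition SO2 (R : realType) : set 'M[R]_3 :=
  [set mx3 [:: [:: cos t; sin t; 0]; [:: - sin t; cos t; 0]; [:: 0; 0; 1]]
  | t in [set t : R | 0 <= t <= 2 * pi]].

Definition SO11 (R : realType) : set 'M[R]_3 :=
  [set mx3 [:: [:: x; 0; 0]; [:: 0; x^-1; 0]; [:: 0; 0; 1]]
  | x in [set x : R | x != 0]].

Definition has_order (R : realType) (T : 'M[R]_3) (n : nat) : Prop :=
  [/\ (0 < n)%N, T ^+ n = 1
    & forall m : nat, (0 < m < n)%N -> T ^+ m <> 1].

(* The matrix group S, under [*m], is isomorphic to the finite group H. *)
Definition mxgroup_isog (R : realType) (S : set 'M[R]_3)
    (gT : finGroupType) (H : {group gT}) : Prop :=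
  exists2 f : gT -> 'M[R]_3, set_bij [set` H] S f &
    {in H &, forall x y, f (x * y)%g = f x *m f y}.

(* e^i (x) e^j *)
Definition tens (R : realType) (i j : 'I_3) : 'M[R]_3 := delta_mx i j.

(* The symmetric array whose only possibly non-zero entries are the listed
   ones: (i, j, k, x) stands for Gamma_{ij}^k = Gamma_{ji}^k = x.  A pair
   {i, j} and an upper index k must not be listed twice. *)
Definition symbols (R : realType) (s : seq ('I_3 * 'I_3 * 'I_3 * R)) :
    christoffel R :=
  fun i j k => \sum_(e <- s | let: (i', j', k', _) := e in
      ((i == i') && (j == j') || (i == j') && (j == i')) && (k == k')) e.2.

Definition Gamma_SO11 (R : realType) (a b c d : R) : christoffel R :=
  symbols [:: (i1, i2, i3, a); (i1, i3, i1, b); (i2, i3, i2, c);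
              (i3, i3, i3, d)].

Definition Gamma_SO2 (R : realType) (a b c d : R) : christoffel R :=
  symbols [:: (i1, i1, i3, a); (i1, i3, i1, b); (i1, i3, i2, c);
              (i2, i2, i3, a); (i2, i3, i1, - c); (i2, i3, i2, b);
              (i3, i3, i3, d)].

Definition Gamma_ord3 (R : realType) (a b c d : R) : christoffel R :=
  symbols [:: (i1, i1, i1, 1); (i1, i1, i3, a); (i1, i2, i2, -1);
              (i1, i3, i1, b); (i1, i3, i2, c); (i2, i2, i1, -1);
              (i2, i2, i3, a); (i2, i3, i1, - c); (i2, i3, i2, b);
              (i3, i3, i3, d)].

Definition Gamma_s3 (R : realType) : christoffel R := Gamma_ord3 0 0 1 0.

(* [s] is the sign + or -. *)
Definition Gamma_a4 (R : realType) (s : bool) : christoffel R :=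
  let e : R := if s then 1 else -1 in
  Gamma_ord3 (e / Num.sqrt 2) (e / Num.sqrt 2) 0 (- e * Num.sqrt 2).

(* The Ricci tensor is diag(-2, 2, 2).  With entries x, y, z instead of 1, 1, -1
   it is -2 diag(x * y, x * z, y * z), of determinant -8 (x y z)^2, so
   diag(-2, -2, 2) never occurs. *)
Definition Gamma_Z2Z2 (R : realType) : christoffel R :=
  symbols [:: (i1, i2, i3, 1); (i1, i3, i2, 1); (i2, i3, i1, -1)].

(* The entries in which the index 3 appears an odd number of times. *)
Definition Gamma_Z2 (R : realType) (a b c d e f g h : R) : christoffel R :=
  symbols [:: (i1, i1, i3, a); (i1, i2, i3, b); (i1, i3, i1, c);
              (i1, i3, i2, d); (i2, i2, i3, e); (i2, i3, i1, f);
              (i2, i3, i2, g); (i3, i3, i3, h)].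

Arguments Gamma_s3 R : clear implicits.
Arguments Gamma_a4 R s : clear implicits.
Arguments Gamma_Z2Z2 R : clear implicits.
Arguments SO2 R : clear implicits.
Arguments SO11 R : clear implicits.
Arguments tens R i j : clear implicits.

(* Main.v *)
(** Read Gamma as the commutative product e_i e_j = Gamma_{ij}^k e_k; the stabilizer of Gamma
    is then the automorphism group of this algebra.  An automorphism T of positive determinant
    is an isometry of the non-degenerate form rho, so it has determinant 1 and characteristic
    polynomial (X - 1) (X^2 - t X + 1).  If t^2 > 4, T is diag(x, 1/x, 1) in some basis and its
    invariance leaves only the SO(1,1) family.  If t^2 < 4, T is a rotation; in a complex
    coordinate z on its plane the product has plane component kappa z^* w^*, and kappa = 0
    gives the SO(2) family while kappa <> 0 can be normalised to 1, which gives the family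
    with an automorphism of order 3.  If t = 2 or t = -2, non-degeneracy of rho forces T = 1 or
    T^2 = 1.  When every automorphism is an involution, the group is Z_2 or the Klein group.

    To see that the groups are no larger, one uses three invariants: the covector
    tr L_x, the vector obtained by contracting the product with the inverse of rho, and the
    form tr (rho^-1 L_x^T rho L_y).  One of them singles out the e3-axis, except for the a_4
    structures; these are isomorphic to the algebra e1 e2 = e3, e1 e3 = e2, e2 e3 = e1, whose
    nonzero idempotents are the vertices of a tetrahedron permuted by the automorphisms. *)

Require Import Defs.
From mathcomp Require Import ring lra.

Set Implicit Arguments.
Unset Strict Implicit.
Unset Printing Implicit Defensive.

Import Order.TTheory GRing.Theory Num.Theory.

Local Open Scope classical_set_scope.
Local Open Scope ring_scope.

(** * Linear algebra in dimension three, in coordinates *)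

Section Basics.
Variable R : realType.
Implicit Types (G : christoffel R) (A B T S P : 'M[R]_3) (u v w x : 'cV[R]_3).

(** The a_4 structures escape the axis argument for a structural reason: their group acts
    irreducibly, so an invariant covector or vector must vanish and an invariant symmetric form must
    be a multiple of rho. For the families with an elliptic automorphism, the equations stating that
    all three invariants degenerate in this way are solved by elimination; up to a scaling of e3 the
    a_4 parameters are the only solution. Once the e3-axis is preserved, an automorphism is a
    rotation about it or a half-turn reversing it. For kappa = 1 the rotation has order dividing 3,
    and half-turns occur only when a = b = d = 0, which is the s_3 structure. Its group is read off
    from three lines of square-zero elements, which the automorphisms permute up to sign. Among the
    unipotent isometries the full Jordan block is the obstacle: non-degeneracy of a form does not
    exclude it, so the product itself has to be used there. *)

Lemma ord3P (P : 'I_3 -> Prop) : P i1 -> P i2 -> P i3 -> forall i, P i.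
Proof.
move=> p1 p2 p3 [[|[|[|//]]] lt_i].
- by have <- : i1 = Ordinal lt_i by apply: val_inj.
- by have <- : i2 = Ordinal lt_i by apply: val_inj.
- by have <- : i3 = Ordinal lt_i by apply: val_inj.
Qed.

Lemma sum3 (V : nmodType) (F : 'I_3 -> V) : \sum_i F i = F i1 + F i2 + F i3.
Proof.
rewrite !big_ord_recl big_ord0 addr0 addrA.
by congr (F _ + F _ + F _); apply: val_inj.
Qed.

Lemma mulmx3 m n (A : 'M[R]_(m, 3)) (B : 'M[R]_(3, n)) i j :
  (A *m B) i j = A i i1 * B i1 j + A i i2 * B i2 j + A i i3 * B i3 j.
Proof. by rewrite mxE sum3. Qed.

Lemma mx3P A B :
  A i1 i1 = B i1 i1 -> A i1 i2 = B i1 i2 -> A i1 i3 = B i1 i3 ->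
  A i2 i1 = B i2 i1 -> A i2 i2 = B i2 i2 -> A i2 i3 = B i2 i3 ->
  A i3 i1 = B i3 i1 -> A i3 i2 = B i3 i2 -> A i3 i3 = B i3 i3 -> A = B.
Proof.
move=> *; apply/matrixP => i j.
by move: i; apply: ord3P; move: j; apply: ord3P.
Qed.

Lemma det3 A : \det A =
  A i1 i1 * (A i2 i2 * A i3 i3 - A i2 i3 * A i3 i2)
  - A i1 i2 * (A i2 i1 * A i3 i3 - A i2 i3 * A i3 i1)
  + A i1 i3 * (A i2 i1 * A i3 i2 - A i2 i2 * A i3 i1).
Proof.
(* With entries indexed by [nat], the lifted ordinals of the cofactor expansion reduce to
   numerals. *)
have [f ->] : exists f : nat -> nat -> R, A = \matrix_(i, j) f i j.
  exists (fun i j => A (inord i) (inord j)).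
  by apply/matrixP => i j; rewrite mxE !inord_val.
rewrite !(expand_det_row _ ord0) !big_ord_recl !big_ord0 /cofactor.
rewrite !(expand_det_row _ ord0) !big_ord_recl !big_ord0 /cofactor.
rewrite !det_mx11 !mxE /= /bump /=.
by rewrite !expr0 ?add0n ?addn0 ?expr1 ?expr2 ?exprS ?expr0 /=; ring.
Qed.

Lemma tr3 A : \tr A = A i1 i1 + A i2 i2 + A i3 i3.
Proof. exact: sum3. Qed.

Lemma unitmx_ker0 A : (forall x, A *m x = 0 -> x = 0) -> A \in unitmx.
Proof.
move=> kerA; rewrite -unitmx_tr -row_free_unit -kermx_eq0; apply/eqP.
apply/row_matrixP => i; rewrite row0; apply: trmx_inj; rewrite trmx0; apply: kerA.
by apply: trmx_inj; rewrite trmx_mul trmxK -row_mul mulmx_ker row0 trmx0.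
Qed.

Definition cols3 u v w : 'M[R]_3 :=
  \matrix_(i, j) (if j == i1 then u i 0 else if j == i2 then v i 0 else w i 0).

Lemma mul_cols3 A u v w : A *m cols3 u v w = cols3 (A *m u) (A *m v) (A *m w).
Proof.
by apply/matrixP => i; apply: ord3P; rewrite !mxE; apply: eq_bigr => j _; rewrite !mxE.
Qed.

Lemma cols3_mul u v w x :
  cols3 u v w *m x = x i1 0 *: u + x i2 0 *: v + x i3 0 *: w.
Proof. by apply/colP => i; rewrite mulmx3 !mxE /= !(mulrC (x _ _)). Qed.

Lemma cols3_mulmx u v w A :
  cols3 u v w *m A =
  cols3 (A i1 i1 *: u + A i2 i1 *: v + A i3 i1 *: w)
        (A i1 i2 *: u + A i2 i2 *: v + A i3 i2 *: w)
        (A i1 i3 *: u + A i2 i3 *: v + A i3 i3 *: w).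
Proof.
apply/matrixP => i; apply: ord3P; rewrite mulmx3 !mxE /=;
  by rewrite !(mulrC (A _ _)).
Qed.

Lemma col3_eq0 x : x i1 0 = 0 -> x i2 0 = 0 -> x i3 0 = 0 -> x = 0.
Proof. by move=> *; apply/colP; apply: ord3P; rewrite mxE. Qed.

Lemma cols3_unit u v w :
  (forall a b c : R, a *: u + b *: v + c *: w = 0 -> [/\ a = 0, b = 0 & c = 0]) ->
  cols3 u v w \in unitmx.
Proof.
move=> indep; apply: unitmx_ker0 => x; rewrite cols3_mul => /indep[].
exact: col3_eq0.
Qed.

End Basics.

(** * Linear changes of coordinates and the Ricci tensor *)

Section Action.
Variable R : realType.
Implicit Types (G H : christoffel R) (A B T S P : 'M[R]_3).

(* The matrix of left multiplication by e_i in the algebra e_i e_j = Gamma_{ij}^k e_k,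
   whose automorphisms are the stabilizer of [G]. *)
Definition Lmx G (i : 'I_3) : 'M[R]_3 := \matrix_(k, n) G i n k.

Lemma Lmx_inj G H : (forall i, Lmx G i = Lmx H i) -> G = H.
Proof.
move=> eqL; apply/funext => i; apply/funext => j; apply/funext => k.
by have /matrixP/(_ k j) := eqL i; rewrite !mxE.
Qed.

Lemma Lmx_act T G i :
  Lmx (act T G) i = invmx T *m (\sum_a T a i *: Lmx G a) *m T.
Proof.
apply/matrixP => k n; rewrite !mxE /act /evalG.
under [RHS]eq_bigr => b _.
  rewrite !mxE big_distrl /=.
  under eq_bigr => c _ do rewrite summxE big_distrr big_distrl /=.
  over.
rewrite [RHS]exchange_big /= [RHS]exchange_big.
rewrite [RHS]exchange_big /=.
under [RHS]eq_bigr => c _ do rewrite exchange_big /=.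
rewrite [RHS]exchange_big /=.
apply: eq_bigr => a _; rewrite [RHS]exchange_big /=; apply: eq_bigr => b _.
apply: eq_bigr => c _; rewrite !mxE; ring.
Qed.

(** The equation says that T is a morphism from the algebra of [H] to that of [G]: T (e_i e_j) = (T
    e_i) (T e_j). Being free of inverses, it turns invariance into polynomial equations between
    entries. *)
Lemma actP T G H : T \in unitmx ->
  (act T G = H) <-> (forall i, T *m Lmx H i = (\sum_a T a i *: Lmx G a) *m T).
Proof.
move=> uT; split=> [<- i|E].
  by rewrite Lmx_act !mulmxA mulmxV // mul1mx.
by apply: Lmx_inj => i; rewrite Lmx_act -mulmxA -E mulKmx.
Qed.

Lemma actM T S G : T \in unitmx -> S \in unitmx ->
  act (T *m S) G = act S (act T G).
Proof.
move=> uT uS; apply: Lmx_inj => i; rewrite !Lmx_act.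
have -> : invmx (T *m S) = invmx S *m invmx T.
  apply: (can_inj (mulKmx (_ : T *m S \in unitmx))); first by rewrite unitmx_mul uT.
  by rewrite mulmxV ?unitmx_mul ?uT // !mulmxA mulmxK // mulmxV.
rewrite -!mulmxA; congr (_ *m _); rewrite !mulmxA; congr (_ *m _).
under [RHS]eq_bigr => a _ do rewrite Lmx_act scalemxAl scalemxAr.
rewrite -mulmx_suml -mulmx_sumr; congr (_ *m _ *m _).
under [RHS]eq_bigr => a _ do rewrite scaler_sumr.
rewrite exchange_big; apply: eq_bigr => b _; rewrite mxE scaler_suml.
by apply: eq_bigr => a _; rewrite scalerA mulrC.
Qed.

Lemma act1 G : act 1%:M G = G.
Proof.
apply/(actP _ _ (unitmx1 _ _)) => i; rewrite mul1mx mulmx1 (bigD1 i) //= mxE eqxx scale1r.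
by rewrite big1 ?addr0 // => a /negPf ai; rewrite mxE ai scale0r.
Qed.

Lemma act_torsion_free T G : torsion_free G -> torsion_free (act T G).
Proof.
move=> tfG i j k; rewrite /act /evalG exchange_big /=.
by do 3 (apply: eq_bigr => ? _); rewrite tfG; ring.
Qed.

Lemma isom_refl G : isomorphic G G.
Proof. by exists 1%:M; rewrite ?unitmx1 ?act1. Qed.

Lemma isom_trans G H K : isomorphic G H -> isomorphic H K -> isomorphic G K.
Proof.
by move=> [T uT ->] [S uS ->]; exists (T *m S); rewrite ?unitmx_mul ?uT ?actM.
Qed.

Lemma isom_sym G H : isomorphic G H -> isomorphic H G.
Proof.
by move=> [T uT ->]; exists (invmx T); rewrite ?unitmx_inv // -actM ?unitmx_inv ?mulmxV ?act1.
Qed.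

(** Invariantly, rho(x, y) = tr L_(xy) - tr (L_x L_y); torsion freeness identifies Gamma_(in)^i with
    tr L_n. *)
Lemma ricciE G : torsion_free G -> ricci G =
  \matrix_(j, k) (\sum_n \tr (Lmx G n) * G j k n - \tr (Lmx G j *m Lmx G k)).
Proof.
move=> tfG; apply/matrixP => j k; rewrite !mxE; congr (_ - _).
  rewrite exchange_big; apply: eq_bigr => n _; rewrite -big_distrl; congr (_ * _).
  by apply: eq_bigr => i _; rewrite !mxE tfG.
apply: eq_bigr => i _; rewrite !mxE; apply: eq_bigr => n _.
by rewrite !mxE (tfG k).
Qed.

Lemma tr_Lmx_act T G i : T \in unitmx ->
  \tr (Lmx (act T G) i) = \sum_a T a i * \tr (Lmx G a).
Proof.
move=> uT; rewrite Lmx_act mxtrace_mulC mulmxA mulmxV // mul1mx raddf_sum /=.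
by apply: eq_bigr => a _; rewrite mxtraceZ.
Qed.

Lemma ricci_sym G : torsion_free G -> (ricci G)^T = ricci G.
Proof.
move=> tfG; rewrite ricciE //; apply/matrixP => j k; rewrite !mxE; congr (_ - _).
  by apply: eq_bigr => n _; rewrite tfG.
exact: mxtrace_mulC.
Qed.

Lemma ricci_act T G : torsion_free G -> T \in unitmx ->
  ricci (act T G) = T^T *m ricci G *m T.
Proof.
move=> tfG uT; rewrite !ricciE //; last exact: act_torsion_free.
apply/matrixP => j k; rewrite !mxE.
(* The term tr L_(xy): the inverse of T in the transformed product cancels against the T in the
   transformed trace. *)
have E1 : \sum_n \tr (Lmx (act T G) n) * act T G j k n =
   \sum_b \sum_a T a j * (\sum_n \tr (Lmx G n) * G a b n) * T b k.
  under eq_bigr => n _ do rewrite tr_Lmx_act //.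
  have F n : act T G j k n = \sum_c invmx T n c * \sum_a \sum_b (G a b c * T a j * T b k).
    rewrite /act /evalG.
    under [RHS]eq_bigr => c _ do rewrite big_distrr /=.
    rewrite [RHS]exchange_big; apply: eq_bigr => a _.
    under [RHS]eq_bigr => c _ do rewrite big_distrr /=.
    rewrite [RHS]exchange_big; apply: eq_bigr => b _; apply: eq_bigr => c _.
    rewrite !mxE; ring.
  have [Q defQ] : exists Q : 'I_3 -> R, forall c, Q c = \sum_a \sum_b (G a b c * T a j * T b k).
    by exists (fun c => \sum_a \sum_b (G a b c * T a j * T b k)).
  transitivity (\sum_c \tr (Lmx G c) * Q c).
    have g n : (\sum_a T a n * \tr (Lmx G a)) * act T G j k n =
      \sum_a \sum_c T a n * invmx T n c * (\tr (Lmx G a) * Q c).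
      rewrite F big_distrl; apply: eq_bigr => a _; rewrite big_distrr; apply: eq_bigr => c _ /=.
      rewrite defQ; ring.
    under eq_bigr => n _ do rewrite g.
    rewrite exchange_big; apply: eq_bigr => a _; rewrite exchange_big /= (bigD1 a) //=.
    have TV c : \sum_n T a n * invmx T n c = (a == c)%:R.
      by have /matrixP/(_ a c) := mulmxV uT; rewrite !mxE.
    rewrite -big_distrl /= TV eqxx mul1r big1 ?addr0 // => c /negPf ca.
    by rewrite -big_distrl /= TV eq_sym ca mul0r.
  under eq_bigr => c _ do rewrite defQ.
  under eq_bigr => c _ do rewrite exchange_big big_distrr /=.
  rewrite exchange_big; apply: eq_bigr => b _.
  under eq_bigr => c _ do rewrite big_distrr /=.
  rewrite exchange_big; apply: eq_bigr => a _.
  rewrite big_distrr big_distrl; apply: eq_bigr => c _ /=; ring.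
rewrite E1; have -> : \tr (Lmx (act T G) j *m Lmx (act T G) k) =
   \sum_b \sum_a T a j * \tr (Lmx G a *m Lmx G b) * T b k.
  rewrite !Lmx_act !mulmxA mulmxK // mxtrace_mulC !mulmxA mulmxV // mul1mx.
  rewrite [RHS]exchange_big mulmx_suml raddf_sum /=; apply: eq_bigr => a _.
  rewrite mulmx_sumr raddf_sum /=; apply: eq_bigr => b _.
  by rewrite -scalemxAl -scalemxAr !mxtraceZ; ring.
rewrite -sumrB; apply: eq_bigr => b _; rewrite mxE big_distrl -sumrB.
by apply: eq_bigr => a _; rewrite !mxE /=; ring.
Qed.

End Action.

(** * Stabilizers and their invariants *)

Section Automorphisms.
Variable R : realType.
Implicit Types (G H : christoffel R) (A B T S P D : 'M[R]_3).

Lemma Gplus_unit G T : Gplus G T -> T \in unitmx.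
Proof. by move=> [dT _]; rewrite unitmxE unitfE gt_eqF. Qed.

Lemma Gplus1 G : Gplus G 1%:M.
Proof. by split; rewrite ?det1 ?ltr01 ?act1. Qed.

Lemma GplusM G T S : Gplus G T -> Gplus G S -> Gplus G (T *m S).
Proof.
move=> GT GS; have [uT uS] := (Gplus_unit GT, Gplus_unit GS).
case: GT GS => [dT fT] [dS fS]; split; first by rewrite det_mulmx mulr_gt0.
by rewrite actM // fT.
Qed.

(** Here D = P^-1 T P. In the form T P = P D, a basis adapted to T can be used directly through its
    columns. *)
Lemma Gplus_conj G P T D : P \in unitmx -> T *m P = P *m D ->
  Gplus G T <-> Gplus (act P G) D.
Proof.
move=> uP TP.
have dTD : \det T = \det D.
  have := congr1 determinant TP; rewrite !det_mulmx mulrC => /mulfI; apply.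
  by rewrite -unitfE -unitmxE.
have uTD : (T \in unitmx) = (D \in unitmx) by rewrite !unitmxE dTD.
split=> GT; have u := Gplus_unit GT; case: GT => d fix_.
  by split; rewrite -?dTD //; rewrite -actM // -?TP ?actM // ?fix_ // -uTD.
have uT : T \in unitmx by rewrite uTD.
split; rewrite ?dTD //.
have E : act P (act T G) = act P G by rewrite -actM // TP actM.
have := congr1 (act (invmx P)) E.
by rewrite -!(actM _ uP) ?unitmx_inv // !mulmxV // !act1.
Qed.

Lemma isog_isom G H (gT : finGroupType) (K : {group gT}) :
  isomorphic G H -> mxgroup_isog (Gplus G) K -> mxgroup_isog (Gplus H) K.
Proof.
move=> [P uP ->] [f [ffun finj fsurj] fM].
have conjE T : T *m P = P *m (invmx P *m T *m P) by rewrite !mulmxA mulmxV // mul1mx.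
exists (fun x => invmx P *m f x *m P); last first.
  by move=> x y Kx Ky; rewrite fM // !mulmxA mulmxK.
split=> [x Kx|x y Kx Ky E|D GD].
- by have /(Gplus_conj _ uP (conjE (f x))) := ffun x Kx.
- apply: (finj x y) => //; have := congr1 (fun Z => P *m Z *m invmx P) E.
  by rewrite !mulmxA !mulmxV // !mul1mx !mulmxK.
- have E : P *m D *m invmx P *m P = P *m D by rewrite mulmxKV.
  have /fsurj[x Kx fx] : Gplus G (P *m D *m invmx P) by apply/(Gplus_conj _ uP E).
  by exists x => //; rewrite fx !mulmxA mulVmx // mul1mx mulmxKV.
Qed.

Lemma mxgroup_isog_finite (X : set 'M[R]_3) (gT : finGroupType) (K : {group gT}) :
  mxgroup_isog X K -> finite_set X.
Proof.
move=> [f [_ _ fsurj] _]; apply: (sub_finite_set fsurj).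
exact/finite_image/finite_finset.
Qed.

Definition trL G : 'cV[R]_3 := \col_i \tr (Lmx G i).

Definition ric_trace G : 'cV[R]_3 :=
  \sum_i \sum_j invmx (ricci G) i j *: col j (Lmx G i).

(** The factor before [Lmx G j] is the rho-adjoint of L_i, so this is the pairing that rho induces
    on endomorphisms, pulled back along x -> L_x. *)
Definition ric_form G : 'M[R]_3 :=
  \matrix_(i, j) \tr (invmx (ricci G) *m (Lmx G i)^T *m ricci G *m Lmx G j).

Section Invariance.
Variables (G : christoffel R) (T : 'M[R]_3).
Hypotheses (tfG : torsion_free G) (uric : ricci G \in unitmx) (GT : Gplus G T).
Let rho := ricci G.
Let K := invmx rho.

Lemma Gplus_ricci : T^T *m rho *m T = rho.
Proof. by rewrite -ricci_act // ?(Gplus_unit GT) //; case: GT => _ ->. Qed.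

Lemma Gplus_det : \det T = 1.
Proof.
have := congr1 determinant Gplus_ricci; rewrite !det_mulmx det_tr.
move: uric; rewrite unitmxE unitfE => d0 E.
have : (\det T - 1) * (\det T + 1) * \det rho = 0.
  by rewrite -[in X in _ * X]E; move: E; rewrite /rho => E; nra.
move/eqP; rewrite !mulf_eq0 (negPf d0) orbF => /orP[]; first by rewrite subr_eq0 => /eqP.
by case: GT => dT _; rewrite addr_eq0 => /eqP; lra.
Qed.

Lemma Gplus_Lmx i : T *m Lmx G i = (\sum_a T a i *: Lmx G a) *m T.
Proof. by move: i; apply/(actP _ _ (Gplus_unit GT)); case: GT. Qed.

Lemma Gplus_riccil : T^T *m rho = rho *m invmx T.
Proof. by rewrite -[in RHS]Gplus_ricci mulmxK // (Gplus_unit GT). Qed.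

Lemma Gplus_invricci : T *m K *m T^T = K.
Proof.
have uT := Gplus_unit GT.
apply: (can_inj (mulmxK uric)); rewrite -!mulmxA Gplus_riccil mulVmx //.
by rewrite (mulmxA K) mulVmx // mul1mx mulmxV.
Qed.

Lemma Gplus_trL : T^T *m trL G = trL G.
Proof.
apply/colP => i; rewrite !mxE.
have [_ fG] := GT; rewrite -{2}fG tr_Lmx_act ?(Gplus_unit GT) //.
by apply: eq_bigr => a _; rewrite !mxE.
Qed.

(** Raising the index of the invariant covector by rho produces a fixed vector, the input of
    [fixed_axis]. *)
Lemma Gplus_ric_trL : T *m (K *m trL G) = K *m trL G.
Proof. by rewrite -{1}Gplus_trL !mulmxA Gplus_invricci. Qed.

Lemma Gplus_ric_trace : T *m ric_trace G = ric_trace G.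
Proof.
have -> : T *m ric_trace G = \sum_a \sum_b (T *m K *m T^T) a b *: col b (Lmx G a).
  have g i j : T *m (K i j *: col j (Lmx G i)) =
      \sum_a \sum_b (T a i * K i j * T b j) *: col b (Lmx G a).
    rewrite -scalemxAr colE mulmxA Gplus_Lmx -!mulmxA -colE mulmx_suml.
    apply/colP => k; rewrite !mxE summxE big_distrr summxE; apply: eq_bigr => a _ /=.
    rewrite !mxE summxE big_distrr; apply: eq_bigr => b _ /=; rewrite !mxE; ring.
  rewrite /ric_trace mulmx_sumr; under eq_bigr => i _.
    rewrite mulmx_sumr; under eq_bigr => j _ do rewrite g.
    rewrite exchange_big /=; over.
  rewrite exchange_big; apply: eq_bigr => a _ /=.
  under eq_bigr => i _ do rewrite exchange_big /=.
  rewrite exchange_big; apply: eq_bigr => b _ /=.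
  rewrite mxE scaler_suml exchange_big; apply: eq_bigr => j _ /=.
  by rewrite !mxE big_distrl scaler_suml.
by rewrite Gplus_invricci.
Qed.

Lemma Gplus_ric_form : T^T *m ric_form G *m T = ric_form G.
Proof.
have uT := Gplus_unit GT.
have LE i : Lmx G i = invmx T *m (\sum_a T a i *: Lmx G a) *m T.
  by rewrite -mulmxA -Gplus_Lmx mulKmx.
apply/esym/matrixP => i j; rewrite [LHS]mxE (LE i) (LE j).
set X := \sum_a T a i *: _; set Y := \sum_a T a j *: _.
have -> : \tr (invmx (ricci G) *m (invmx T *m X *m T)^T *m ricci G *m (invmx T *m Y *m T)) =
    \tr (K *m X^T *m rho *m Y).
  rewrite !trmx_mul.
  have -> : (invmx (ricci G) *m (T^T *m (X^T *m (invmx T)^T)) *m ricci G *m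
     (invmx T *m Y *m T)) = (K *m T^T *m X^T *m ((invmx T)^T *m (rho *m invmx T)) *m Y) *m T.
    by rewrite /K /rho !mulmxA.
  (* The isometry equation trades rho T^-1 for T^T rho, after which the factors T cancel in
     pairs. *)
  rewrite -Gplus_riccil (mulmxA _ T^T) -trmx_mul mulmxV // trmx1 mul1mx.
  by rewrite mxtrace_mulC !mulmxA Gplus_invricci.
rewrite /X /Y mulmx_sumr raddf_sum /=.
rewrite !mxE; apply: eq_bigr => b _.
rewrite -scalemxAr /= mxtraceZ linear_sum mulmx_sumr !mulmx_suml raddf_sum /= mulrC.
congr (_ * _); rewrite !mxE; apply: eq_bigr => a _.
by rewrite !mxE linearZ /= -scalemxAr -!scalemxAl mxtraceZ.
Qed.

End Invariance.
End Automorphisms.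

(** * The parametrized families and their Ricci tensors *)

Section Families.
Variable R : realType.
Implicit Types (G H : christoffel R) (a b c d e : R).

Lemma christoffelP G H : torsion_free G -> torsion_free H ->
  (forall k, G i1 i1 k = H i1 i1 k) -> (forall k, G i1 i2 k = H i1 i2 k) ->
  (forall k, G i1 i3 k = H i1 i3 k) -> (forall k, G i2 i2 k = H i2 i2 k) ->
  (forall k, G i2 i3 k = H i2 i3 k) -> (forall k, G i3 i3 k = H i3 i3 k) -> G = H.
Proof.
move=> tfG tfH E11 E12 E13 E22 E23 E33.
apply/funext => i; apply/funext => j; apply/funext => k; move: i j.
by do 2!apply: ord3P => //; rewrite tfG tfH.
Qed.

Lemma symbols_torsion_free s : torsion_free (@symbols R s).
Proof.
move=> i j k; apply: eq_bigl => -[[[i' j'] k'] x] /=.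
by rewrite orbC; do 2!rewrite [X in X || _]andbC; congr ((_ || _) && _); rewrite andbC.
Qed.

Lemma symbols_cons s i j k i' j' k' x :
  @symbols R ((i, j, k, x) :: s) i' j' k' =
  (if ((i' == i) && (j' == j) || (i' == j) && (j' == i)) && (k' == k) then x else 0)
  + symbols s i' j' k'.
Proof. by rewrite /symbols big_cons /=; case: ifP; rewrite ?add0r. Qed.

Lemma symbols_nil i j k : @symbols R [::] i j k = 0.
Proof. by rewrite /symbols big_nil. Qed.

Definition symbolsE := (symbols_cons, symbols_nil).

Lemma mul_mx3 (a11 a12 a13 a21 a22 a23 a31 a32 a33 : R) (b11 b12 b13 b21 b22 b23 b31 b32 b33 : R) :
  mx3 [:: [:: a11; a12; a13]; [:: a21; a22; a23]; [:: a31; a32; a33]] *m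
  mx3 [:: [:: b11; b12; b13]; [:: b21; b22; b23]; [:: b31; b32; b33]] =
  mx3 [:: [:: a11 * b11 + a12 * b21 + a13 * b31; a11 * b12 + a12 * b22 + a13 * b32;
              a11 * b13 + a12 * b23 + a13 * b33];
          [:: a21 * b11 + a22 * b21 + a23 * b31; a21 * b12 + a22 * b22 + a23 * b32;
              a21 * b13 + a22 * b23 + a23 * b33];
          [:: a31 * b11 + a32 * b21 + a33 * b31; a31 * b12 + a32 * b22 + a33 * b32;
              a31 * b13 + a32 * b23 + a33 * b33]].
Proof. by apply: mx3P; rewrite mulmx3 !mxE. Qed.

Lemma mx3E (s : seq (seq R)) (i j : 'I_3) : mx3 s i j = (nth [::] s i)`_j.
Proof. by rewrite mxE. Qed.

Lemma comb_mx3 (x y z : R) (a11 a12 a13 a21 a22 a23 a31 a32 a33 : R)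
  (b11 b12 b13 b21 b22 b23 b31 b32 b33 c11 c12 c13 c21 c22 c23 c31 c32 c33 : R) :
  x *: mx3 [:: [:: a11; a12; a13]; [:: a21; a22; a23]; [:: a31; a32; a33]] +
  y *: mx3 [:: [:: b11; b12; b13]; [:: b21; b22; b23]; [:: b31; b32; b33]] +
  z *: mx3 [:: [:: c11; c12; c13]; [:: c21; c22; c23]; [:: c31; c32; c33]] =
  mx3 [:: [:: x * a11 + y * b11 + z * c11; x * a12 + y * b12 + z * c12; x * a13 + y * b13 + z * c13];
          [:: x * a21 + y * b21 + z * c21; x * a22 + y * b22 + z * c22; x * a23 + y * b23 + z * c23];
          [:: x * a31 + y * b31 + z * c31; x * a32 + y * b32 + z * c32; x * a33 + y * b33 + z * c33]].
Proof. by apply: mx3P; rewrite !mxE. Qed.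

Lemma mx3_congr (a11 a12 a13 a21 a22 a23 a31 a32 a33 b11 b12 b13 b21 b22 b23 b31 b32 b33 : R) :
  a11 = b11 -> a12 = b12 -> a13 = b13 -> a21 = b21 -> a22 = b22 -> a23 = b23 ->
  a31 = b31 -> a32 = b32 -> a33 = b33 ->
  mx3 [:: [:: a11; a12; a13]; [:: a21; a22; a23]; [:: a31; a32; a33]] =
  mx3 [:: [:: b11; b12; b13]; [:: b21; b22; b23]; [:: b31; b32; b33]].
Proof. by move=> -> -> -> -> -> -> -> -> ->. Qed.

(* The algebras [Gamma_SO2] ([e = 0]) and [Gamma_ord3] ([e = 1]). *)
Definition Gam e a b c d : christoffel R :=
  symbols [:: (i1, i1, i1, e); (i1, i1, i3, a); (i1, i2, i2, - e);
              (i1, i3, i1, b); (i1, i3, i2, c); (i2, i2, i1, - e);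
              (i2, i2, i3, a); (i2, i3, i1, - c); (i2, i3, i2, b);
              (i3, i3, i3, d)].

Lemma Lmx_Gam e a b c d :
  [/\ Lmx (Gam e a b c d) i1 = mx3 [:: [:: e; 0; b]; [:: 0; -e; c]; [:: a; 0; 0]],
      Lmx (Gam e a b c d) i2 = mx3 [:: [:: 0; -e; -c]; [:: -e; 0; b]; [:: 0; a; 0]] &
      Lmx (Gam e a b c d) i3 = mx3 [:: [:: b; -c; 0]; [:: c; b; 0]; [:: 0; 0; d]]].
Proof.
by split; apply: mx3P; rewrite /Gam !mxE /= !symbolsE /= ?addr0 ?add0r.
Qed.

Lemma Gam0 a b c d : Gamma_SO2 a b c d = Gam 0 a b c d.
Proof.
apply: christoffelP; try exact: symbols_torsion_free.
all: by apply: ord3P; rewrite /Gam /Gamma_SO2 !symbolsE /= ?oppr0 ?addr0 ?add0r.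
Qed.

Lemma ricci_Gam e a b c d : ricci (Gam e a b c d) =
  mx3 [:: [:: a * d - 2 * e ^+ 2; 0; 0]; [:: 0; a * d - 2 * e ^+ 2; 0];
          [:: 0; 0; 2 * (b * d - b ^+ 2 + c ^+ 2)]].
Proof.
rewrite ricciE; last exact: symbols_torsion_free.
have [L1 L2 L3] := Lmx_Gam e a b c d.
apply: mx3P; rewrite !mxE sum3 L1 L2 L3 mul_mx3 !tr3 !mx3E /= /Gam !symbolsE /=; ring.
Qed.

Lemma Lmx_SO11 a b c d :
  [/\ Lmx (Gamma_SO11 a b c d) i1 = mx3 [:: [:: 0; 0; b]; [:: 0; 0; 0]; [:: 0; a; 0]],
      Lmx (Gamma_SO11 a b c d) i2 = mx3 [:: [:: 0; 0; 0]; [:: 0; 0; c]; [:: a; 0; 0]] &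
      Lmx (Gamma_SO11 a b c d) i3 = mx3 [:: [:: b; 0; 0]; [:: 0; c; 0]; [:: 0; 0; d]]].
Proof.
by split; apply: mx3P; rewrite /Gamma_SO11 !mxE /= !symbolsE /= ?addr0 ?add0r.
Qed.

Lemma ricci_SO11 a b c d : ricci (Gamma_SO11 a b c d) =
  mx3 [:: [:: 0; a * d; 0]; [:: a * d; 0; 0];
          [:: 0; 0; - b ^+ 2 + b * d + c * (- c + d)]].
Proof.
rewrite ricciE; last exact: symbols_torsion_free.
have [L1 L2 L3] := Lmx_SO11 a b c d.
apply: mx3P; rewrite !mxE sum3 L1 L2 L3 mul_mx3 !tr3 !mx3E /= /Gamma_SO11 !symbolsE /=; ring.
Qed.

Lemma mx3_inj (a11 a12 a13 a21 a22 a23 a31 a32 a33 b11 b12 b13 b21 b22 b23 b31 b32 b33 : R) :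
  mx3 [:: [:: a11; a12; a13]; [:: a21; a22; a23]; [:: a31; a32; a33]] =
  mx3 [:: [:: b11; b12; b13]; [:: b21; b22; b23]; [:: b31; b32; b33]] ->
  [/\ a11 = b11, a12 = b12 & a13 = b13] /\ [/\ a21 = b21, a22 = b22 & a23 = b23] /\
  [/\ a31 = b31, a32 = b32 & a33 = b33].
Proof.
move=> /matrixP E; move: (E i1 i1) (E i1 i2) (E i1 i3) (E i2 i1) (E i2 i2) (E i2 i3)
  (E i3 i1) (E i3 i2) (E i3 i3).
by rewrite !mx3E /= => -> -> -> -> -> -> -> -> ->.
Qed.

Lemma Lmx_mx3 G i : Lmx G i = mx3 [:: [:: G i i1 i1; G i i2 i1; G i i3 i1];
  [:: G i i1 i2; G i i2 i2; G i i3 i2]; [:: G i i1 i3; G i i2 i3; G i i3 i3]].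
Proof. by apply: mx3P; rewrite !mxE. Qed.

Lemma tr_mx3 (a11 a12 a13 a21 a22 a23 a31 a32 a33 : R) :
  (mx3 [:: [:: a11; a12; a13]; [:: a21; a22; a23]; [:: a31; a32; a33]])^T =
  mx3 [:: [:: a11; a21; a31]; [:: a12; a22; a32]; [:: a13; a23; a33]].
Proof. by apply: mx3P; rewrite !mxE. Qed.

Lemma tr_diag_mul (A B : 'M[R]_3) (k1 k2 k3 r1 r2 r3 : R) :
  \tr (mx3 [:: [:: k1; 0; 0]; [:: 0; k2; 0]; [:: 0; 0; k3]] *m A^T *m
       mx3 [:: [:: r1; 0; 0]; [:: 0; r2; 0]; [:: 0; 0; r3]] *m B) =
  k1 * (r1 * A i1 i1 * B i1 i1 + r2 * A i2 i1 * B i2 i1 + r3 * A i3 i1 * B i3 i1) +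
  k2 * (r1 * A i1 i2 * B i1 i2 + r2 * A i2 i2 * B i2 i2 + r3 * A i3 i2 * B i3 i2) +
  k3 * (r1 * A i1 i3 * B i1 i3 + r2 * A i2 i3 * B i2 i3 + r3 * A i3 i3 * B i3 i3).
Proof.
have mk (C : 'M[R]_3) : C = mx3 [:: [:: C i1 i1; C i1 i2; C i1 i3]; [:: C i2 i1; C i2 i2; C i2 i3];
    [:: C i3 i1; C i3 i2; C i3 i3]] by apply: mx3P; rewrite mx3E.
rewrite [in LHS](mk A) [in LHS](mk B) tr_mx3 !mul_mx3 tr3 !mx3E /=.
by ring.
Qed.

Lemma tr_adiag_mul (A B : 'M[R]_3) (k1 k3 r1 r3 : R) :
  \tr (mx3 [:: [:: 0; k1; 0]; [:: k1; 0; 0]; [:: 0; 0; k3]] *m A^T *m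
       mx3 [:: [:: 0; r1; 0]; [:: r1; 0; 0]; [:: 0; 0; r3]] *m B) =
  k1 * (r1 * A i2 i2 * B i1 i1 + r1 * A i1 i2 * B i2 i1 + r3 * A i3 i2 * B i3 i1) +
  k1 * (r1 * A i2 i1 * B i1 i2 + r1 * A i1 i1 * B i2 i2 + r3 * A i3 i1 * B i3 i2) +
  k3 * (r1 * A i2 i3 * B i1 i3 + r1 * A i1 i3 * B i2 i3 + r3 * A i3 i3 * B i3 i3).
Proof.
have mk (C : 'M[R]_3) : C = mx3 [:: [:: C i1 i1; C i1 i2; C i1 i3]; [:: C i2 i1; C i2 i2; C i2 i3];
    [:: C i3 i1; C i3 i2; C i3 i3]] by apply: mx3P; rewrite mx3E.
rewrite [in LHS](mk A) [in LHS](mk B) tr_mx3 !mul_mx3 tr3 !mx3E /=.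
by ring.
Qed.

Lemma mx3_diag_unit x y z : (mx3 [:: [:: x; 0; 0]; [:: 0; y; 0]; [:: 0; 0; z]] : 'M[R]_3) \in unitmx ->
  [/\ x != 0, y != 0 & z != 0].
Proof.
rewrite unitmxE unitfE det3 !mxE /= !(mulr0, mul0r, subr0, addr0) !mulf_eq0 !negb_or.
by case/and3P.
Qed.

Lemma mx3_diag_inv x y z : x != 0 -> y != 0 -> z != 0 ->
  invmx (mx3 [:: [:: x; 0; 0]; [:: 0; y; 0]; [:: 0; 0; z]]) =
  mx3 [:: [:: x^-1; 0; 0]; [:: 0; y^-1; 0]; [:: 0; 0; z^-1]] :> 'M[R]_3.
Proof.
move=> x0 y0 z0; set D := mx3 _; set E := mx3 _.
have DE : D *m E = 1%:M.
  by apply: mx3P; rewrite mulmx3 !mxE /= ?(mulr0, mul0r, addr0, add0r) ?divff.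
have [uD _] := mulmx1_unit DE.
by rewrite -[invmx D]mulmx1 -DE mulKmx.
Qed.

Lemma mx3_adiag_inv x z : x != 0 -> z != 0 ->
  invmx (mx3 [:: [:: 0; x; 0]; [:: x; 0; 0]; [:: 0; 0; z]]) =
  mx3 [:: [:: 0; x^-1; 0]; [:: x^-1; 0; 0]; [:: 0; 0; z^-1]] :> 'M[R]_3.
Proof.
move=> x0 z0; set D := mx3 _; set E := mx3 _.
have DE : D *m E = 1%:M.
  by apply: mx3P; rewrite mulmx3 !mxE /= ?(mulr0, mul0r, addr0, add0r) ?divff.
have [uD _] := mulmx1_unit DE.
by rewrite -[invmx D]mulmx1 -DE mulKmx.
Qed.

Lemma mx3_adiag_unit x z : (mx3 [:: [:: 0; x; 0]; [:: x; 0; 0]; [:: 0; 0; z]] : 'M[R]_3) \in unitmx ->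
  x != 0 /\ z != 0.
Proof.
rewrite unitmxE unitfE det3 !mxE /= !(mulr0, mul0r, sub0r, subr0, addr0, add0r).
by rewrite oppr_eq0 !mulf_eq0 !negb_or => /and3P[].
Qed.

End Families.

Ltac act_mx3 := rewrite !mx3E /= comb_mx3 !mul_mx3; apply: mx3_congr.

(** * When automorphisms preserve the e3-axis *)

Section Axis.
Variable R : realType.
Implicit Types (G H : christoffel R) (a b c d e x y z : R) (T : 'M[R]_3).

(** T e3 is a multiple of e3, so T also preserves the rho-orthogonal complement of e3, which is the
    plane of e1 and e2. *)
Lemma isometry_axis (rho T : 'M[R]_3) :
  rho i3 i1 = 0 -> rho i3 i2 = 0 -> rho i3 i3 != 0 -> T^T *m rho *m T = rho ->
  T i1 i3 = 0 -> T i2 i3 = 0 -> [/\ T i3 i1 = 0, T i3 i2 = 0 & T i3 i3 ^+ 2 = 1].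
Proof.
move=> r31 r32 r33 E T13 T23.
have E31 : T i3 i3 * rho i3 i3 * T i3 i1 = 0.
  have /matrixP/(_ i3 i1) := E; rewrite !mulmx3 !mxE T13 T23 r31 r32 => F; lra.
have E32 : T i3 i3 * rho i3 i3 * T i3 i2 = 0.
  have /matrixP/(_ i3 i2) := E; rewrite !mulmx3 !mxE T13 T23 r31 r32 => F; lra.
have E33 : T i3 i3 ^+ 2 * rho i3 i3 = 1 * rho i3 i3.
  have /matrixP/(_ i3 i3) := E; rewrite !mulmx3 !mxE T13 T23 r31 r32 => F; lra.
have T2 := mulIf r33 E33.
have T33 : T i3 i3 != 0 by apply: contra_eqN T2 => /eqP->; rewrite expr0n eq_sym oner_eq0.
move/eqP: E31; move/eqP: E32; rewrite !mulf_eq0 (negPf T33) (negPf r33) /=.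
by move=> /eqP-> /eqP->.
Qed.

Lemma fixed_axis T x : x != 0 ->
  T *m (\col_i (if i == i3 then x else 0)) = \col_i (if i == i3 then x else 0) ->
  T i1 i3 = 0 /\ T i2 i3 = 0.
Proof.
move=> x0 E; have /colP/(_ i1) := E; have /colP/(_ i2) := E.
rewrite !mulmx3 !mxE /= !(mulr0, add0r) => /eqP; rewrite mulf_eq0 (negPf x0) orbF.
by move=> /eqP-> /eqP; rewrite mulf_eq0 (negPf x0) orbF => /eqP->.
Qed.

(** The kernel of the invariant form A is the line of e3, and T maps this kernel to itself. *)
Lemma kernel_axis (T A : 'M[R]_3) : T \in unitmx -> T^T *m A *m T = A ->
  (forall i, A i i3 = 0) -> A i1 i1 * A i2 i2 - A i1 i2 * A i2 i1 != 0 ->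
  T i1 i3 = 0 /\ T i2 i3 = 0.
Proof.
move=> uT E A3 dA.
have AT : A *m col i3 T = 0.
  apply: (can_inj (mulKmx (_ : T^T \in unitmx))); first by rewrite unitmx_tr.
  by rewrite mulmx0 colE !mulmxA E -colE; apply/colP => i; rewrite !mxE A3.
have /colP/(_ i1) := AT; have /colP/(_ i2) := AT; rewrite !mulmx3 !mxE !A3 => e2 e1.
have F1 k := congr1 (fun z => k * z) e1; have F2 k := congr1 (fun z => k * z) e2.
split; apply: (mulfI dA); rewrite mulr0.
  by move: (F1 (A i2 i2)) (F2 (A i1 i2)) => /= *; lra.
by move: (F1 (A i2 i1)) (F2 (A i1 i1)) => /= *; lra.
Qed.

Lemma Gam_trL e a b c d : trL (Gam e a b c d) = \col_i (if i == i3 then 2 * b + d else 0).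
Proof.
have [L1 L2 L3] := Lmx_Gam e a b c d.
by apply/colP; apply: ord3P; rewrite !mxE ?L1 ?L2 ?L3 tr3 !mxE /=; ring.
Qed.

Lemma ric_traceE G k : ric_trace G k 0 =
  \sum_i \sum_j invmx (ricci G) i j * Lmx G i k j.
Proof.
rewrite /ric_trace summxE; apply: eq_bigr => i _; rewrite summxE.
by apply: eq_bigr => j _; rewrite !mxE.
Qed.

Section GamAxis.
Variables e a b c d : R.
Let G := Gam e a b c d.
Let g := a * d - 2 * e ^+ 2.
Let h := 2 * (b * d - b ^+ 2 + c ^+ 2).
Hypotheses (g0 : g != 0) (h0 : h != 0).

Lemma Gam_ric_unit : ricci G \in unitmx.
Proof.
rewrite /G ricci_Gam unitmxE unitfE det3 !mxE /=.
by rewrite -/g -/h !(mulr0, mul0r, subr0, addr0) 2!mulf_eq0 !negb_or g0 h0.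
Qed.

Lemma Gam_invric : invmx (ricci G) =
  mx3 [:: [:: g^-1; 0; 0]; [:: 0; g^-1; 0]; [:: 0; 0; h^-1]].
Proof. by rewrite /G ricci_Gam mx3_diag_inv. Qed.

Lemma Gam_ric_trace : ric_trace G = \col_i (if i == i3 then 2 * a * g^-1 + d * h^-1 else 0).
Proof.
have [L1 L2 L3] := Lmx_Gam e a b c d.
apply/colP; apply: ord3P; rewrite ric_traceE Gam_invric !sum3 L1 L2 L3 !mxE /=; ring.
Qed.

Lemma Gam_ric_form : ric_form G =
  let x := 2 * e ^+ 2 + a ^+ 2 * h * g^-1 + (b ^+ 2 + c ^+ 2) * g * h^-1 in
  mx3 [:: [:: x; 0; 0]; [:: 0; x; 0]; [:: 0; 0; 2 * (b ^+ 2 + c ^+ 2) + d ^+ 2]].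
Proof.
have [L1 L2 L3] := Lmx_Gam e a b c d.
rewrite /ric_form Gam_invric /G ricci_Gam -/g -/h.
apply: mx3P; rewrite mxE tr_diag_mul ?L1 ?L2 ?L3 !mx3E /=.
all: by field; rewrite ?g0 ?h0.
Qed.

(** Each invariant in turn forces T to preserve the axis unless it degenerates. The second
    alternative is what remains when all three do; for e = 1 it is an a_4 structure up to
    [Gam_scale]. *)
Lemma Gam_axis T : Gplus G T ->
  (T i1 i3 = 0 /\ T i2 i3 = 0) \/ [/\ e != 0, c = 0, d = - 2 * b & 2 * a * b = e ^+ 2].
Proof.
move=> GT.
have tfG : torsion_free G by exact: symbols_torsion_free.
have uric := Gam_ric_unit.
have uT := Gplus_unit GT.
have [w0|w0] := eqVneq (2 * b + d) 0; last first.
  left; apply: (fixed_axis (x := (2 * b + d) * h^-1)); first by rewrite mulf_neq0 ?invr_eq0.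
  have := Gplus_ric_trL tfG uric GT; suff -> : invmx (ricci G) *m trL G = \col_i (if i == i3 then (2 * b + d) / h else 0) by [].
  rewrite Gam_invric Gam_trL; apply/colP; apply: ord3P; rewrite mulmx3 !mxE /=; ring.
have [u0|u0] := eqVneq (2 * a * g^-1 + d * h^-1) 0; last first.
  by left; apply: (fixed_axis u0); rewrite -Gam_ric_trace Gplus_ric_trace.
set x := 2 * e ^+ 2 + a ^+ 2 * h * g^-1 + (b ^+ 2 + c ^+ 2) * g * h^-1.
set y := 2 * (b ^+ 2 + c ^+ 2) + d ^+ 2.
(* The e3-entries of [ric_form G] and rho are y and h, so this combination of the two forms kills
   e3; hx - yg is its remaining diagonal entry. *)
have [A0|A0] := eqVneq (h * x - y * g) 0; last first.
  left; apply: (kernel_axis (A := h *: ric_form G - y *: ricci G) uT).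
  - rewrite mulmxBr mulmxBl -!scalemxAr -!scalemxAl.
    by rewrite Gplus_ric_form // Gplus_ricci.
  - by apply: ord3P; rewrite Gam_ric_form /G ricci_Gam !mxE /= -/y -/h; ring.
  - rewrite Gam_ric_form /G ricci_Gam !mxE /= -/x -/y -/g !(mulr0, mul0r, subr0, oppr0).
    by rewrite mulf_neq0.
right.
have dE : d = - 2 * b by lra.
have hE : h = 2 * (c ^+ 2 - 3 * b ^+ 2) by rewrite /h dE; ring.
have gE : g = - 2 * (a * b + e ^+ 2) by rewrite /g dE; ring.
have U : a * (c ^+ 2 - 2 * b ^+ 2) + b * e ^+ 2 = 0.
  have : (2 * a * g^-1 + d * h^-1) * (g * h) = 0 by rewrite u0 mul0r.
  have -> : (2 * a * g^-1 + d * h^-1) * (g * h) = 2 * a * h + d * g by field; rewrite g0 h0.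
  by rewrite hE gE dE; lra.
have V : e ^+ 2 * (3 * c ^+ 2 - 2 * b ^+ 2) + a * b * (4 * b ^+ 2 + c ^+ 2) = 0.
  have : (h * x - y * g) * g = 0 by rewrite A0 mul0r.
  (* The vanishing vector gives a h = - d g / 2. This makes (a h)^2 a multiple of g^2, so that a
     factor g can be cancelled. *)
  have U' : a * h = - d * g / 2 by rewrite hE gE dE; lra.
  have -> : (h * x - y * g) * g =
     (2 * e ^+ 2 * h + (b ^+ 2 + c ^+ 2) * g - y * g) * g + (a * h) ^+ 2.
    by rewrite /x; field; rewrite g0 h0.
  rewrite U'; have -> : (2 * e ^+ 2 * h + (b ^+ 2 + c ^+ 2) * g - y * g) * g + (- d * g / 2) ^+ 2
    = (2 * e ^+ 2 * h - (b ^+ 2 + c ^+ 2 + 3 / 4 * d ^+ 2) * g) * g by rewrite /y; field.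
  move/eqP; rewrite mulf_eq0 (negPf g0) orbF => /eqP; rewrite hE gE dE; lra.
have W : e ^+ 2 * c ^+ 2 = 0.
  have : e ^+ 2 * c ^+ 2 * (3 / 2 * h) = 0.
    rewrite hE.
    (* The combination of [U] and [V] that eliminates a; its b^4 terms cancel and the rest is a
       multiple of h. *)
    have -> : e ^+ 2 * c ^+ 2 * (3 / 2 * (2 * (c ^+ 2 - 3 * b ^+ 2))) =
     (e ^+ 2 * (3 * c ^+ 2 - 2 * b ^+ 2) + a * b * (4 * b ^+ 2 + c ^+ 2)) * (c ^+ 2 - 2 * b ^+ 2)
     - b * (4 * b ^+ 2 + c ^+ 2) * (a * (c ^+ 2 - 2 * b ^+ 2) + b * e ^+ 2) by field.
    by rewrite U V; ring.
  move/eqP; rewrite mulf_eq0 => /orP[/eqP//|].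
  by rewrite mulf_eq0 (negPf h0) orbF => /eqP; lra.
move/eqP: W; rewrite mulf_eq0 !expf_eq0 /= => /orP[/eqP e0|/eqP c0].
  (* With e = 0 the equations become c^2 = 2 b^2 and b (4 b^2 + c^2) = 0, whence b = c = 0 and h =
     0. *)
  exfalso; have a0 : a != 0 by apply: contra_neq g0; rewrite gE e0 => ->; ring.
  move: U V; rewrite e0 expr0n /= !(mulr0, mul0r, add0r, addr0) => /eqP.
  rewrite mulf_eq0 (negPf a0) /= => /eqP U /eqP; rewrite !mulf_eq0 (negPf a0) /=.
  have c2 : 0 <= c ^+ 2 by rewrite sqr_ge0.
  have b2 : 0 <= b ^+ 2 by rewrite sqr_ge0.
  move=> /orP[/eqP b0|/eqP F]; case/eqP: h0; rewrite hE; last lra.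
  have bb : b ^+ 2 = 0 by rewrite b0 expr0n.
  by lra.
have b0 : b != 0 by apply: contra_neq h0; rewrite hE c0 => ->; ring.
have abE : 2 * a * b = e ^+ 2.
  move: V; rewrite c0 => V; apply: (mulIf (expf_neq0 2 b0)); lra.
split=> //; apply: contra_neq g0 => e0.
move: abE; rewrite gE e0; lra.
Qed.

(** On the plane of e1 and e2 the form rho is g times the standard one, so the upper block of T is
    orthogonal; since det T = 1, the block has determinant [T i3 i3]. *)
Lemma Gam_axis_entries T : Gplus G T -> T i1 i3 = 0 -> T i2 i3 = 0 ->
  [/\ T i3 i1 = 0, T i3 i2 = 0, T i3 i3 ^+ 2 = 1,
      T i1 i1 ^+ 2 + T i2 i1 ^+ 2 = 1 & T i1 i2 = - T i3 i3 * T i2 i1 /\ T i2 i2 = T i3 i3 * T i1 i1].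
Proof.
move=> GT T13 T23.
have tfG : torsion_free G by exact: symbols_torsion_free.
have uric := Gam_ric_unit.
have E := Gplus_ricci tfG GT; have D1 := Gplus_det tfG uric GT.
have [|||T31 T32 T33] := isometry_axis _ _ _ E T13 T23; rewrite /G ?ricci_Gam ?mxE //.
have E11 : g * (T i1 i1 ^+ 2 + T i2 i1 ^+ 2) = g * 1.
  have /matrixP/(_ i1 i1) := E; rewrite !mulmx3 /G ricci_Gam !mxE /= -/g T31; lra.
have E12 : g * (T i1 i1 * T i1 i2 + T i2 i1 * T i2 i2) = g * 0.
  have /matrixP/(_ i1 i2) := E; rewrite !mulmx3 /G ricci_Gam !mxE /= -/g T31 T32; lra.
move/(mulfI g0): E11 => E11; move/(mulfI g0): E12 => E12.
move: D1; rewrite det3 T13 T23 T31 T32 => D1.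
have D2 : T i1 i1 * T i2 i2 - T i1 i2 * T i2 i1 = T i3 i3.
  transitivity (T i3 i3 ^+ 2 * (T i1 i1 * T i2 i2 - T i1 i2 * T i2 i1)).
    by rewrite T33 mul1r.
  by have := congr1 (fun z => T i3 i3 * z) D1 => /= F; lra.
split=> //; split.
- transitivity (T i1 i2 * (T i1 i1 ^+ 2 + T i2 i1 ^+ 2)); first by rewrite E11 mulr1.
  transitivity (T i1 i1 * (T i1 i1 * T i1 i2 + T i2 i1 * T i2 i2) - T i2 i1 * (T i1 i1 * T i2 i2 - T i1 i2 * T i2 i1)); first by ring.
  by rewrite E12 D2; ring.
- transitivity (T i2 i2 * (T i1 i1 ^+ 2 + T i2 i1 ^+ 2)); first by rewrite E11 mulr1.
  transitivity (T i2 i1 * (T i1 i1 * T i1 i2 + T i2 i1 * T i2 i2) + T i1 i1 * (T i1 i1 * T i2 i2 - T i1 i2 * T i2 i1)); first by ring.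
  by rewrite E12 D2; ring.
Qed.

End GamAxis.
End Axis.

(** * The exact groups of the SO(1,1) and SO(2) families *)

Section ExactFamilies.
Variable R : realType.
Implicit Types (G H : christoffel R) (a b c d e x y z : R) (T : 'M[R]_3).

Lemma actP3 T G H : T \in unitmx ->
  (act T G = H) <->
  (forall i, T *m Lmx H i = (T i1 i *: Lmx G i1 + T i2 i *: Lmx G i2 + T i3 i *: Lmx G i3) *m T).
Proof.
by move=> uT; split=> [/(actP _ _ uT) + i|E] => [/(_ i)|]; [rewrite sum3|apply/actP => // i; rewrite sum3].
Qed.

Section SO11Axis.
Variables a b c d : R.
Let G := Gamma_SO11 a b c d.
Let h := - b ^+ 2 + b * d + c * (- c + d).
Hypotheses (ad0 : a * d != 0) (h0 : h != 0).

Lemma SO11_ric_unit : ricci G \in unitmx.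
Proof.
rewrite /G ricci_SO11 unitmxE unitfE det3 !mxE /= -/h.
by rewrite !(mulr0, mul0r, subr0, addr0, sub0r) oppr_eq0 !mulf_neq0 //; move: ad0; rewrite mulf_eq0 negb_or => /andP[].
Qed.

Lemma SO11_axis T : Gplus G T -> T i1 i3 = 0 /\ T i2 i3 = 0.
Proof.
move=> GT.
have [L1 L2 L3] := Lmx_SO11 a b c d.
have tfG : torsion_free G by exact: symbols_torsion_free.
have uric := SO11_ric_unit.
have uT := Gplus_unit GT.
have [a0 d0] : a != 0 /\ d != 0 by move: ad0; rewrite mulf_eq0 negb_or => /andP[].
have KE : invmx (ricci G) = mx3 [:: [:: 0; (a * d)^-1; 0]; [:: (a * d)^-1; 0; 0]; [:: 0; 0; h^-1]].
  by rewrite /G ricci_SO11 mx3_adiag_inv.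
have [w0|w0] := eqVneq (b + c + d) 0; last first.
  apply: (fixed_axis (x := (b + c + d) * h^-1)); first by rewrite mulf_neq0 ?invr_eq0.
  have := Gplus_ric_trL tfG uric GT; suff -> : invmx (ricci G) *m trL G = \col_i (if i == i3 then (b + c + d) / h else 0) by [].
  by rewrite KE; apply/colP; apply: ord3P; rewrite mulmx3 !mxE ?L1 ?L2 ?L3 !tr3 !mxE /=; ring.
have [u0|u0] := eqVneq (2 * a * (a * d)^-1 + d * h^-1) 0; last first.
  apply: (fixed_axis u0).
  suff <- : ric_trace G = \col_i (if i == i3 then 2 * a / (a * d) + d / h else 0) by exact: Gplus_ric_trace.
  apply/colP; apply: ord3P; rewrite ric_traceE KE !sum3 L1 L2 L3 !mxE /=; ring.
set x := a ^+ 2 * h * (a * d)^-1 + b * c * (a * d) * h^-1.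
set y := 2 * (b * c) + d ^+ 2.
have AE : ric_form G = mx3 [:: [:: 0; x; 0]; [:: x; 0; 0]; [:: 0; 0; y]].
  rewrite /ric_form KE /G ricci_SO11 -/h /x /y.
  apply: mx3P; rewrite mxE tr_adiag_mul ?L1 ?L2 ?L3 !mx3E /=;
    by field; rewrite ?a0 ?d0 ?h0.
have [A0|A0] := eqVneq (h * x - y * (a * d)) 0; last first.
  apply: (kernel_axis (A := h *: ric_form G - y *: ricci G) uT).
  - rewrite mulmxBr mulmxBl -!scalemxAr -!scalemxAl.
    by rewrite Gplus_ric_form // Gplus_ricci.
  - by apply: ord3P; rewrite AE /G ricci_SO11 !mxE /= -/h; ring.
  - rewrite AE /G ricci_SO11 !mxE /= !(mulr0, mul0r, subr0, oppr0, sub0r).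
    by rewrite oppr_eq0 mulf_neq0.
exfalso.
have U : 2 * h = - d ^+ 2.
  have : (2 * a * (a * d)^-1 + d * h^-1) * (d * h) = 0 by rewrite u0 mul0r.
  have -> : (2 * a * (a * d)^-1 + d * h^-1) * (d * h) = 2 * h + d ^+ 2.
    by field; rewrite a0 d0 h0.
  lra.
have V : 4 * (b * c) = - 3 * d ^+ 2.
  have : (h * x - y * (a * d)) * d = 0 by rewrite A0 mul0r.
  have -> : (h * x - y * (a * d)) * d = a * (h ^+ 2 + b * c * d ^+ 2 - y * d ^+ 2).
    by rewrite /x; field; rewrite a0 d0 h0.
  have -> : h = - d ^+ 2 / 2 by lra.
  move/eqP; rewrite mulf_eq0 (negPf a0) /y => /eqP E.
  have : d ^+ 2 * (4 * (b * c) + 3 * d ^+ 2) = 0 by move: E => /=; lra.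
  by move/eqP; rewrite mulf_eq0 expf_eq0 (negPf d0) /= => /eqP; lra.
(* With b + c = - d one has 2 h = 4 b c - 4 d^2 = - 7 d^2, against 2 h = - d^2 with d nonzero: the
   three invariants never degenerate together. *)
have bE : b = - c - d by lra.
have d2 : 0 < d ^+ 2 by rewrite exprn_even_gt0.
by move: U V; rewrite /h bE; nra.
Qed.

Lemma Gplus_SO11 : Gplus G = SO11 R.
Proof.
have [L1 L2 L3] := Lmx_SO11 a b c d.
have tfG : torsion_free G by exact: symbols_torsion_free.
have uric := SO11_ric_unit.
have [a0 d0] : a != 0 /\ d != 0 by move: ad0; rewrite mulf_eq0 negb_or => /andP[].
apply/seteqP; split=> T.
  move=> GT; have [T13 T23] := SO11_axis GT.
  have E := Gplus_ricci tfG GT; have D1 := Gplus_det tfG uric GT.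
  have [|||T31 T32 T33] := isometry_axis _ _ _ E T13 T23; rewrite /G ?ricci_SO11 ?mxE //.
  have uT := Gplus_unit GT.
  have [_ /(actP3 _ _ uT)/(_ i3)] := GT.
  rewrite L1 L2 L3 => /matrixP/(_ i3 i3).
  rewrite !mulmx3 !mxE /= T13 T23 T31 T32 => E33.
  (* Applying T to e3 e3 = d e3 gives t d = t^2 d for t = [T i3 i3]; together with t^2 = 1 this
     selects t = 1. *)
  have t1 : T i3 i3 = 1.
    apply: (mulIf d0); move: E33; rewrite !(mul0r, mulr0, add0r, addr0).
    move=> ->; have -> : T i3 i3 * d * T i3 i3 = T i3 i3 ^+ 2 * d by ring.
    by rewrite T33.
  have E11 : T i1 i1 * T i2 i1 = 0.
    apply: (mulfI ad0); have /matrixP/(_ i1 i1) := E; rewrite !mulmx3 /G ricci_SO11 !mxE /= T31; lra.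
  have E22 : T i1 i2 * T i2 i2 = 0.
    apply: (mulfI ad0); have /matrixP/(_ i2 i2) := E; rewrite !mulmx3 /G ricci_SO11 !mxE /= T32; lra.
  have E12 : T i1 i1 * T i2 i2 + T i1 i2 * T i2 i1 = 1.
    apply: (mulfI ad0); have /matrixP/(_ i1 i2) := E; rewrite !mulmx3 /G ricci_SO11 !mxE /= T31 T32; lra.
  move: D1; rewrite det3 T13 T23 T31 T32 t1 => D1.
  (* The sum of the determinant equation and the isometry equation [E12] for the hyperbolic
     plane. *)
  have ps : T i1 i1 * T i2 i2 = 1 by lra.
  have p0 : T i1 i1 != 0 by apply: contra_eq_neq ps => ->; rewrite mul0r eq_sym oner_neq0.
  have s0 : T i2 i2 != 0 by apply: contra_eq_neq ps => ->; rewrite mulr0 eq_sym oner_neq0.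
  have T21 : T i2 i1 = 0 by apply: (mulfI p0); rewrite mulr0.
  have T12 : T i1 i2 = 0 by apply: (mulIf s0); rewrite mul0r.
  exists (T i1 i1) => //; apply: mx3P; rewrite ?mxE //=.
  by apply: (mulfI p0); rewrite ps divff.
move=> [x x0 <-]; set D := mx3 _; have x0' : x != 0 by exact: x0.
have dD : \det D = 1 by rewrite det3 !mxE /=; field.
split; first by rewrite dD ltr01.
apply/actP3; first by rewrite unitmxE dD unitr1.
apply: ord3P; rewrite /G /D L1 L2 L3; act_mx3; field; rewrite ?x0' //.
Qed.

End SO11Axis.

Lemma cos_sin_surj x y : x ^+ 2 + y ^+ 2 = 1 ->
  exists2 t : R, 0 <= t <= 2 * pi & x = cos t /\ y = sin t.
Proof.
move=> xy; have x1 : -1 <= x <= 1 by nra.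
have cx := acosK x1; have sx := sin_acos x1.
have y2 : Num.sqrt (1 - x ^+ 2) = `|y| by rewrite -xy (addrC (x ^+ 2)) addrK sqrtr_sqr.
have a0 : 0 <= acos x by rewrite acos_ge0.
have ap : acos x <= pi by rewrite acos_lepi.
have p0 : 0 < pi :> R by exact: pi_gt0.
have [y0|y0] := leP 0 y.
  exists (acos x); first by apply/andP; split; lra.
  by rewrite cx sx y2 ger0_norm.
(* [acos] parametrizes the upper half circle only; the lower half is reached by reflection. *)
exists (2 * pi - acos x); first by apply/andP; split; lra.
have -> : 2 * pi - acos x = - acos x + pi *+ 2 by rewrite mulr2n; ring.
rewrite -(addr0 (- acos x)) (addr0 _) cosD2pi sinD2pi cosN sinN cx sx y2 ltr0_norm //.
by rewrite opprK.
Qed.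

Lemma Gplus_SO2 a b c d : a * d != 0 -> b * d - b ^+ 2 + c ^+ 2 != 0 ->
  Gplus (Gam 0 a b c d) = SO2 R.
Proof.
move=> ad0 h0; set G := Gam 0 a b c d.
have [a0 d0] : a != 0 /\ d != 0 by move: ad0; rewrite mulf_eq0 negb_or => /andP[].
have [L1 L2 L3] := Lmx_Gam 0 a b c d.
have g0' : a * d - 2 * 0 ^+ 2 != 0 by rewrite expr0n mulr0 subr0.
have h0' : 2 * (b * d - b ^+ 2 + c ^+ 2) != 0 by rewrite mulf_neq0 // pnatr_eq0.
apply/seteqP; split=> T.
  move=> GT; have [[T13 T23]|[]] := Gam_axis g0' h0' GT; last by rewrite eqxx.
  have [T31 T32 T33 T1 [T12 T22]] := Gam_axis_entries g0' h0' GT T13 T23.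
  have uT := Gplus_unit GT.
  have [_ /(actP3 _ _ uT)/(_ i3)] := GT.
  rewrite L1 L2 L3 => /matrixP/(_ i3 i3).
  rewrite !mulmx3 !mxE /= T13 T23 T31 T32 => E33.
  have t1 : T i3 i3 = 1.
    apply: (mulIf d0); move: E33; rewrite !(mul0r, mulr0, add0r, addr0).
    move=> ->; have -> : T i3 i3 * d * T i3 i3 = T i3 i3 ^+ 2 * d by ring.
    by rewrite T33.
  have [t t02 [ct st]] : exists2 t : R, 0 <= t <= 2 * pi & T i1 i1 = cos t /\ T i1 i2 = sin t.
    by apply: cos_sin_surj; rewrite T12 t1; move: T1; lra.
  by exists t => //; apply: mx3P; rewrite ?mxE //= -?ct -?st ?T22 ?T12 t1; ring.
move=> [t _ <-]; set D := mx3 _.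
have cs := cos2Dsin2 t.
have dD : \det D = 1 by rewrite det3 !mxE /= -[RHS]cs; ring.
split; first by rewrite dD ltr01.
apply/actP3; first by rewrite unitmxE dD unitr1.
apply: ord3P; rewrite /G /D L1 L2 L3; act_mx3;
  try ring; have := congr1 (fun z => a * z) cs; lra.
Qed.

End ExactFamilies.

(** * The family with an automorphism of order three *)

Section OrderThree.
Variable R : realType.
Implicit Types (G H : christoffel R) (a b c d e x y z : R) (T : 'M[R]_3).

Lemma Gam_scale e a b c d x : x != 0 ->
  isomorphic (Gam e a b c d) (Gam e (a / x) (x * b) (x * c) (x * d)).
Proof.
move=> x0; set D : 'M[R]_3 := mx3 [:: [:: 1; 0; 0]; [:: 0; 1; 0]; [:: 0; 0; x]].
have uD : D \in unitmx by rewrite unitmxE unitfE det3 !mxE /= !(mul0r, mulr0, mul1r, subr0, addr0).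
exists D => //; apply/esym/actP3 => //.
have [L1 L2 L3] := Lmx_Gam e a b c d.
have [M1 M2 M3] := Lmx_Gam e (a / x) (x * b) (x * c) (x * d).
apply: ord3P; rewrite /D L1 L2 L3 ?M1 ?M2 ?M3; act_mx3;
  by field.
Qed.

Definition rot3 : 'M[R]_3 :=
  mx3 [:: [:: - (1 / 2); - (Num.sqrt 3 / 2); 0]; [:: Num.sqrt 3 / 2; - (1 / 2); 0]; [:: 0; 0; 1]].

Let r3 : Num.sqrt 3 ^+ 2 = 3 :> R.
Proof. by rewrite sqr_sqrtr ?ler0n. Qed.

Let r3_gt0 : 0 < Num.sqrt 3 :> R.
Proof. by rewrite sqrtr_gt0 ltr0n. Qed.

Lemma rot3_sqr : rot3 ^+ 2 =
  mx3 [:: [:: - (1 / 2); Num.sqrt 3 / 2; 0]; [:: - (Num.sqrt 3 / 2); - (1 / 2); 0]; [:: 0; 0; 1]].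
Proof. by rewrite expr2 -mulmxE mul_mx3; apply: mx3P; rewrite !mxE /=; have := r3; lra. Qed.

Lemma rot3_cube : rot3 ^+ 3 = 1.
Proof.
rewrite exprS rot3_sqr -mulmxE mul_mx3; apply: mx3P; rewrite !mxE /=; have := r3; lra.
Qed.

Lemma rot3_neq1 : rot3 <> 1.
Proof. by move=> /matrixP/(_ i1 i1); rewrite !mxE /=; lra. Qed.

Lemma rot3_sqr_neq1 : rot3 ^+ 2 <> 1.
Proof. by rewrite rot3_sqr => /matrixP/(_ i1 i1); rewrite !mxE /=; lra. Qed.

Lemma rot3_order : has_order rot3 3.
Proof.
split=> //; first exact: rot3_cube.
by case=> [|[|[|m]]] // _; [exact: rot3_neq1|exact: rot3_sqr_neq1].
Qed.

(** Let omega be the cube root of unity by which [rot3] acts on the plane: it multiplies conj(z)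
    conj(w) by omega^-2 = omega. *)
Lemma Gplus_rot3 a b c d : Gplus (Gam 1 a b c d) rot3.
Proof.
have [L1 L2 L3] := Lmx_Gam 1 a b c d.
have dD : \det rot3 = 1 by rewrite det3 !mxE /=; have := r3; lra.
split; first by rewrite dD ltr01.
apply/actP3; first by rewrite unitmxE dD unitr1.
have r3z z := congr1 (fun y => z * y) r3.
apply: ord3P; rewrite /rot3 L1 L2 L3; act_mx3;
 have := r3z a; have := r3; lra.
Qed.

Lemma Z3_isog (X : set 'M[R]_3) : X rot3 -> (forall S T, X S -> X T -> X (S *m T)) ->
  (forall T, X T -> [\/ T = 1, T = rot3 | T = rot3 ^+ 2]) -> mxgroup_isog X [set: 'Z_3]%G.
Proof.
move=> X1 XM XE; exists (fun x : 'Z_3 => rot3 ^+ x).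
  split=> [x _|x y _ _|T /XE].
  - case: x => [[|[|[|//]]] lt_x] /=; rewrite ?expr0 ?expr1 //; last exact: XM.
    by rewrite -rot3_cube exprS expr2; apply: (XM) => //; apply: XM.
  - case: x y => [[|[|[|//]]] ltx] [[|[|[|//]]] lty] /= E; apply: val_inj => //=; exfalso; move: E.
    all: rewrite ?expr0 ?expr1.
    + by move/esym/rot3_neq1.
    + by move/esym/rot3_sqr_neq1.
    + by move/rot3_neq1.
    + by rewrite rot3_sqr => /matrixP/(_ i1 i2); rewrite !mxE /=; have := r3_gt0; lra.
    + by move/rot3_sqr_neq1.
    + by rewrite rot3_sqr => /matrixP/(_ i1 i2); rewrite !mxE /=; have := r3_gt0; lra.
  - by case=> ->; [exists 0|exists 1|exists (1 + 1)] => //; rewrite /= inE.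
move=> x y _ _; rewrite mulmxE -exprD.
have -> : (x * y)%g = ((x + y) %% 3)%N :> nat by [].
exact: expr_mod rot3_cube.
Qed.

Section GamOne.
Variables a b c d : R.
Let G := Gam 1 a b c d.
Hypotheses (g0 : a * d - 2 * 1 ^+ 2 != 0) (h0 : 2 * (b * d - b ^+ 2 + c ^+ 2) != 0).

Lemma Gplus_Gam1_cases T : Gplus G T ->
  [\/ [\/ T = 1, T = rot3 | T = rot3 ^+ 2], [/\ a = 0, b = 0 & d = 0]
    | [/\ c = 0, d = - 2 * b & 2 * a * b = 1]].
Proof.
move=> GT; have [[T13 T23]|[_ c0 dE abE]] := Gam_axis g0 h0 GT; last first.
  by apply: Or33; split=> //; rewrite abE expr1n.
have [T31 T32 T33 T1 [T12 T22]] := Gam_axis_entries g0 h0 GT T13 T23.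
have [L1 L2 L3] := Lmx_Gam 1 a b c d.
have uT := Gplus_unit GT.
have [_ /(actP3 _ _ uT) E] := GT.
have /matrixP E1 := E i1; have /matrixP E3 := E i3.
have := E1 i1 i1; have := E1 i2 i1; have := E1 i3 i1; have := E1 i1 i3; have := E1 i2 i3.
have := E3 i3 i3; rewrite /G L1 L2 L3 !mulmx3 !mxE /= T13 T23 T31 T32.
set p := T i1 i1 in T1 T22 *; set q := T i2 i1 in T1 T12 *.
rewrite T12 T22 => F33 F23 F13 F31 F21 F11.
have : (T i3 i3 - 1) * (T i3 i3 + 1) = 0 by rewrite -subr_sqr T33 expr1n subrr.
move/eqP; rewrite mulf_eq0 => /orP[/eqP|/eqP] t1; last first.
  (* T is a half-turn reversing e3. The products e3 e3 and e1 e1 then give d = 0 and a = 0, and b =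
     0 because the reflection that T induces on the plane conjugates b + i c and must send it to its
     opposite. *)
  have tE : T i3 i3 = -1 by lra.
  apply: Or32; rewrite tE in F33 F23 F13 F31 *.
  have bp : b * p = 0 by lra.
  have bq : b * q = 0 by lra.
  have aE := congr1 (fun z => a * z) T1; split; [by move: aE F31 => /= *; lra| |lra].
  by rewrite -[b]mulr1 -T1 mulrDr !expr2 !mulrA bp bq; ring.
have tE : T i3 i3 = 1 by lra.
apply: Or31.
(* The plane component of T (e1 e1) = (T e1) (T e1): the unit complex number p + i q equals the
   square of its conjugate, so it is a cube root of unity. *)
have P1 : p = p ^+ 2 - q ^+ 2 by lra.
have Q1 : q * (1 + 2 * p) = 0 by lra.
have TE : T = mx3 [:: [:: p; - q; 0]; [:: q; p; 0]; [:: 0; 0; 1]].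
  by apply: mx3P; rewrite !mxE //= ?T12 ?T22 tE; ring.
move/eqP: Q1; rewrite mulf_eq0 => /orP[/eqP q0|/eqP pE].
  have pp : (p - 1) * (p + 1) = 0 by move: T1; rewrite q0 expr0n /=; lra.
  have p1 : p = 1 by move: P1; rewrite q0 expr0n /=; lra.
  by apply: Or31; rewrite TE q0 p1; apply: mx3P; rewrite !mxE //= oppr0.
have pE' : p = - (1 / 2) by lra.
have : (q - Num.sqrt 3 / 2) * (q + Num.sqrt 3 / 2) = 0.
  by move: T1; rewrite pE'; have := r3; lra.
move/eqP; rewrite mulf_eq0 => /orP[/eqP|/eqP] qE.
- have qE' : q = Num.sqrt 3 / 2 by lra.
  by apply: Or32; rewrite TE qE' pE'.
- have qE' : q = - (Num.sqrt 3 / 2) by lra.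
  by apply: Or33; rewrite TE rot3_sqr qE' pE' opprK.
Qed.

Lemma Gam1_generic :
  ~ isomorphic (Gamma_s3 R) G -> ~ (exists s, isomorphic (Gamma_a4 R s) G) ->
  mxgroup_isog (Gplus G) [set: 'Z_3]%G.
Proof.
move=> ns3 na4; apply: Z3_isog; first exact: Gplus_rot3.
  by move=> S T; exact: GplusM.
move=> T /Gplus_Gam1_cases[//|[a0 b0 d0]|[c0 dE abE]]; exfalso.
- apply: ns3; apply: isom_sym.
  have c0 : c != 0 by apply: contra_neq h0 => ->; rewrite b0 d0; ring.
  have -> : Gamma_s3 R = Gam 1 (a / c^-1) (c^-1 * b) (c^-1 * c) (c^-1 * d).
    by rewrite a0 b0 d0 mul0r !mulr0 mulVf.
  by apply: Gam_scale; rewrite invr_eq0.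
- apply: na4; exists true; apply: isom_sym.
  have b0 : b != 0 by apply: contra_neq h0 => b0; rewrite c0 b0; ring.
  have r2 : Num.sqrt 2 ^+ 2 = 2 :> R by rewrite sqr_sqrtr ?ler0n.
  have s0 : Num.sqrt 2 != 0 :> R by apply: contra_eq_neq r2 => ->; rewrite expr0n eq_sym pnatr_eq0.
  (* The factor carries the sign of b, so the scaling always reaches the structure with sign +. *)
  pose x := (Num.sqrt 2 * b)^-1.
  have -> : Gamma_a4 R true = Gam 1 (a / x) (x * b) (x * c) (x * d).
    rewrite /Gamma_a4 /Gamma_ord3 -/(Gam _ _ _ _ _) c0 mulr0 /x.
    congr (Gam _ _ _ _ _).
    + apply: (mulIf s0); rewrite divfK // invrK.
      have -> : a * (Num.sqrt 2 * b) * Num.sqrt 2 = a * b * Num.sqrt 2 ^+ 2 by ring.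
      by rewrite r2; lra.
    + by field; rewrite s0 b0.
    + rewrite dE; have -> : (Num.sqrt 2 * b)^-1 * (-2 * b) = - 2 / Num.sqrt 2 by field; rewrite s0 b0.
      by apply: (mulIf s0); rewrite divfK // -mulrA -expr2 r2; ring.
  by apply: Gam_scale; rewrite invr_eq0 mulf_neq0.
Qed.

End GamOne.
End OrderThree.

(** * The structure with group s_3 *)

Section SymmetricGroup.
Variable R : realType.
Implicit Types (G H : christoffel R) (a b c d e x y z : R) (T : 'M[R]_3).

(* [Gamma_s3] in a basis g1, g2, g3 of elements of square zero, normalised so that
   g_i g_(i+1) = g_i - g_(i+1) with cyclic indices. *)
Definition Gamma_null : christoffel R :=
  symbols [:: (i1, i2, i1, 1); (i1, i2, i2, -1); (i2, i3, i2, 1); (i2, i3, i3, -1);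
              (i1, i3, i3, 1); (i1, i3, i1, -1)].

Lemma Lmx_null :
  [/\ Lmx Gamma_null i1 = mx3 [:: [:: 0; 1; -1]; [:: 0; -1; 0]; [:: 0; 0; 1]],
      Lmx Gamma_null i2 = mx3 [:: [:: 1; 0; 0]; [:: -1; 0; 1]; [:: 0; 0; -1]] &
      Lmx Gamma_null i3 = mx3 [:: [:: -1; 0; 0]; [:: 0; 1; 0]; [:: 1; -1; 0]]].
Proof.
by split; apply: mx3P; rewrite /Gamma_null !mxE /= !symbolsE /= ?addr0 ?add0r.
Qed.

Lemma ricci_null : ricci Gamma_null =
  mx3 [:: [:: -2; 2; 2]; [:: 2; -2; 2]; [:: 2; 2; -2]].
Proof.
rewrite ricciE; last exact: symbols_torsion_free.
have [L1 L2 L3] := Lmx_null.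
apply: mx3P; rewrite !mxE sum3 L1 L2 L3 mul_mx3 !tr3 !mx3E /= /Gamma_null !symbolsE /=; ring.
Qed.

(** For z + t e3 to square to zero one needs conj(z)^2 = - 2 i t z. The columns of [P] are the three
    solutions with z nonzero and t = - sqrt 3 / 3; there |z| = 2 / sqrt 3 and the arguments differ
    by thirds of a turn. *)
Lemma isom_s3_null : isomorphic (Gamma_s3 R) Gamma_null.
Proof.
have r3 : Num.sqrt 3 ^+ 2 = 3 :> R by rewrite sqr_sqrtr ?ler0n.
set s := Num.sqrt 3 in r3.
have r3z z := congr1 (fun y => z * y) r3.
set P : 'M[R]_3 := mx3 [:: [:: -1; 1; 0]; [:: - (s / 3); - (s / 3); 2 * s / 3];
                           [:: - (s / 3); - (s / 3); - (s / 3)]].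
have dP : \det P = -2.
  by rewrite det3 !mxE /=; lra.
have uP : P \in unitmx by rewrite unitmxE unitfE dP oppr_eq0 pnatr_eq0.
exists P => //; apply/esym/actP3 => //.
have [L1 L2 L3] := Lmx_Gam (1 : R) 0 0 1 0.
have [M1 M2 M3] := Lmx_null.
rewrite /Gamma_s3 /Gamma_ord3 -/(Gam _ _ _ _ _).
apply: ord3P; rewrite /P L1 L2 L3 ?M1 ?M2 ?M3; act_mx3;
  have := r3z s; lra.
Qed.

(** A transposition reverses the cyclic order in g_i g_(i+1) = g_i - g_(i+1), which the sign
    compensates; it also makes the determinant 1. *)
Definition sperm_mx (s : {perm 'I_3}) : 'M[R]_3 := (-1) ^+ s *: perm_mx s.

Lemma sperm_mxM s t : sperm_mx (s * t)%g = sperm_mx s *m sperm_mx t.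
Proof.
by rewrite /sperm_mx -scalemxAl -scalemxAr scalerA perm_mxM odd_permM signr_addb.
Qed.

Lemma sperm_mx_inj : injective sperm_mx.
Proof.
move=> s t E; apply/permP => k; have /matrixP/(_ k (s k)) := E.
rewrite !mxE eqxx /=; case: (t k =P s k) => [->//|_].
by rewrite mulr0 mulr1 => /eqP; rewrite signr_eq0.
Qed.

Lemma sperm_mx12 : sperm_mx (tperm i1 i2) = mx3 [:: [:: 0; -1; 0]; [:: -1; 0; 0]; [:: 0; 0; -1]].
Proof.
by apply: mx3P; rewrite !mxE !permE odd_tperm /= ?expr1 ?mulr0 ?mulr1.
Qed.

Lemma sperm_mx13 : sperm_mx (tperm i1 i3) = mx3 [:: [:: 0; 0; -1]; [:: 0; -1; 0]; [:: -1; 0; 0]].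
Proof.
by apply: mx3P; rewrite !mxE !permE odd_tperm /= ?expr1 ?mulr0 ?mulr1.
Qed.

Lemma sperm_mx23 : sperm_mx (tperm i2 i3) = mx3 [:: [:: -1; 0; 0]; [:: 0; 0; -1]; [:: 0; -1; 0]].
Proof.
by apply: mx3P; rewrite !mxE !permE odd_tperm /= ?expr1 ?mulr0 ?mulr1.
Qed.

Lemma Gplus_null_sperm s : Gplus Gamma_null (sperm_mx s).
Proof.
have [M1 M2 M3] := Lmx_null.
have G12 : Gplus Gamma_null (sperm_mx (tperm i1 i2)).
  rewrite sperm_mx12; set T := mx3 _; have dT : \det T = 1 by rewrite det3 !mxE /=; ring.
  split; first by rewrite dT ltr01.
  apply/actP3; first by rewrite unitmxE dT unitr1.
  by apply: ord3P; rewrite /T M1 M2 M3; act_mx3; ring.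
have G13 : Gplus Gamma_null (sperm_mx (tperm i1 i3)).
  rewrite sperm_mx13; set T := mx3 _; have dT : \det T = 1 by rewrite det3 !mxE /=; ring.
  split; first by rewrite dT ltr01.
  apply/actP3; first by rewrite unitmxE dT unitr1.
  by apply: ord3P; rewrite /T M1 M2 M3; act_mx3; ring.
have G23 : Gplus Gamma_null (sperm_mx (tperm i2 i3)).
  rewrite sperm_mx23; set T := mx3 _; have dT : \det T = 1 by rewrite det3 !mxE /=; ring.
  split; first by rewrite dT ltr01.
  apply/actP3; first by rewrite unitmxE dT unitr1.
  by apply: ord3P; rewrite /T M1 M2 M3; act_mx3; ring.
have Gt (x y : 'I_3) : x != y -> Gplus Gamma_null (sperm_mx (tperm x y)).
  by move: x y; do 2!apply: ord3P => //; rewrite tpermC.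
have [ts -> ts_d] := prod_tpermP s.
elim: ts ts_d => [|t ts IH] /=; first by rewrite big_nil /sperm_mx odd_perm1 scale1r perm_mx1 => _; exact: Gplus1.
by case/andP=> d_t /IH Gts; rewrite big_cons sperm_mxM; apply: GplusM => //; exact: Gt.
Qed.

Lemma sperm_mx312 : sperm_mx (tperm i1 i2 * tperm i1 i3)%g =
  mx3 [:: [:: 0; 1; 0]; [:: 0; 0; 1]; [:: 1; 0; 0]].
Proof.
by rewrite sperm_mxM sperm_mx12 sperm_mx13 mul_mx3; apply: mx3P; rewrite !mxE /=; ring.
Qed.

Lemma sperm_mx231 : sperm_mx (tperm i1 i3 * tperm i1 i2)%g =
  mx3 [:: [:: 0; 0; 1]; [:: 1; 0; 0]; [:: 0; 1; 0]].
Proof.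
by rewrite sperm_mxM sperm_mx12 sperm_mx13 mul_mx3; apply: mx3P; rewrite !mxE /=; ring.
Qed.

Lemma sperm_mx1 : sperm_mx 1 = mx3 [:: [:: 1; 0; 0]; [:: 0; 1; 0]; [:: 0; 0; 1]].
Proof.
by rewrite /sperm_mx odd_perm1 scale1r perm_mx1; apply: mx3P; rewrite !mxE.
Qed.

Lemma sqr_eq1P x : x ^+ 2 = 1 -> x = 1 \/ x = -1.
Proof. by move/eqP; rewrite sqrf_eq1 => /orP[/eqP|/eqP]; [left|right]. Qed.

(** The first three equations say that u squares to zero, which leaves the lines of g1, g2, g3 and
    g1 + g2 + g3. The last equation normalises the form - rho / 2, which is negative on the fourth
    line. *)
Lemma null_columns (u1 u2 u3 : R) :
  u1 * (u2 - u3) = 0 -> u2 * (u3 - u1) = 0 -> u3 * (u1 - u2) = 0 ->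
  u1 ^+ 2 + u2 ^+ 2 + u3 ^+ 2 - 2 * (u1 * u2 + u2 * u3 + u1 * u3) = 1 ->
  [\/ [/\ u2 = 0, u3 = 0 & u1 = 1 \/ u1 = -1], [/\ u1 = 0, u3 = 0 & u2 = 1 \/ u2 = -1]
    | [/\ u1 = 0, u2 = 0 & u3 = 1 \/ u3 = -1]].
Proof.
move=> e1 e2 e3 q.
have [z1|z1] := eqVneq u1 0.
  have [z2|z2] := eqVneq u2 0.
    apply: Or33; split=> //; apply: sqr_eq1P; move: q; rewrite z1 z2; lra.
  move: e2 => /eqP; rewrite mulf_eq0 (negPf z2) /= => /eqP e2.
  apply: Or32; split=> //; first lra.
  have z3 : u3 = 0 by lra.
  by apply: sqr_eq1P; move: q; rewrite z1 z3; lra.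
move: e1 => /eqP; rewrite mulf_eq0 (negPf z1) /= => /eqP e1.
have E3 : u3 = u2 by lra.
have [z2|z2] := eqVneq u2 0.
  apply: Or31; split => //; first lra.
  by apply: sqr_eq1P; move: q; rewrite E3 z2; lra.
move: e2 => /eqP; rewrite mulf_eq0 (negPf z2) /= => /eqP e2.
have E1 : u1 = u2 by lra.
by exfalso; move: q; rewrite E1 E3; have := sqr_ge0 u2; lra.
Qed.

Lemma Gplus_null T : Gplus Gamma_null T -> exists s, sperm_mx s = T.
Proof.
move=> GT; have [L1 L2 L3] := Lmx_null.
have tfG : torsion_free Gamma_null by exact: symbols_torsion_free.
have uric : ricci Gamma_null \in unitmx.
  rewrite ricci_null unitmxE unitfE det3 !mxE /=; apply/eqP; lra.
have D1 := Gplus_det tfG uric GT; rewrite det3 in D1.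
have Q := Gplus_ricci tfG GT.
have uT := Gplus_unit GT.
have [_ /(actP3 _ _ uT) E] := GT.
have /matrixP F1 := E i1; have /matrixP F2 := E i2; have /matrixP F3 := E i3.
(* Column j of T squares to zero and has the same rho-norm as g_j. *)
have C j : [\/ [/\ T i2 j = 0, T i3 j = 0 & T i1 j = 1 \/ T i1 j = -1],
    [/\ T i1 j = 0, T i3 j = 0 & T i2 j = 1 \/ T i2 j = -1]
  | [/\ T i1 j = 0, T i2 j = 0 & T i3 j = 1 \/ T i3 j = -1]].
  by apply: null_columns; [have /matrixP/(_ i1 j) := E j|have /matrixP/(_ i2 j) := E j
    |have /matrixP/(_ i3 j) := E j|have /matrixP/(_ j j) := Q];
    move: j; apply: ord3P; rewrite ?ricci_null ?L1 ?L2 ?L3 !mulmx3 !mxE /=; lra.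
have C1 := C i1; have C2 := C i2; have C3 := C i3.
have := F1 i1 i2; have := F1 i2 i2; have := F1 i3 i2.
have := F1 i1 i3; have := F1 i2 i3; have := F1 i3 i3.
have {F1 F2 F3 E Q C} pick s (A : 'M[R]_3) : sperm_mx s = A -> T = A -> exists s, sperm_mx s = T.
  by move=> es ->; exists s.
rewrite L1 L2 L3 !mulmx3 !mxE /=.
move=> f6 f5 f4 f3 f2 f1.
(* The determinant discards the patterns with a repeated row, leaving six permutation patterns. The
   products g1 g2 and g1 g3 with the determinant then determine the signs. *)
case: C1 => -[z1 z1' s1]; case: C2 => -[z2 z2' s2]; case: C3 => -[z3 z3' s3];
  rewrite z1 z1' z2 z2' z3 z3' !(mul0r, mulr0, addr0, add0r, subr0, sub0r, oppr0) in D1;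
  try by move/eqP: D1; rewrite eq_sym oner_eq0.
all: rewrite z1 z1' z2 z2' z3 z3' !(mul0r, mulr0, mulr1, addr0, add0r) in f1 f2 f3 f4 f5 f6.
all: [> apply: (pick _ _ sperm_mx1) | apply: (pick _ _ sperm_mx23)
      | apply: (pick _ _ sperm_mx12) | apply: (pick _ _ sperm_mx231)
      | apply: (pick _ _ sperm_mx312) | apply: (pick _ _ sperm_mx13) ].
all: case: s1 => E1; case: s2 => E2; case: s3 => E3; rewrite E1 E2 E3 in D1 f1 f2 f3 f4 f5 f6;
  try (exfalso; clear -f1 f2 f3 f4 f5 f6 D1; lra);
  by apply: mx3P; rewrite !mxE /= ?z1 ?z1' ?z2 ?z2' ?z3 ?z3' ?E1 ?E2 ?E3.
Qed.

Lemma isog_null : mxgroup_isog (Gplus Gamma_null) [set: {perm 'I_3}]%G.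
Proof.
exists sperm_mx; last by move=> s t _ _; exact: sperm_mxM.
split=> [s _|s t _ _|T GT]; [exact: Gplus_null_sperm|exact: sperm_mx_inj|].
by have [s <-] := Gplus_null GT; exists s; rewrite //= inE.
Qed.

End SymmetricGroup.

(** * The structures with group a_4 *)

Section AlternatingGroup.
Variable R : realType.
Implicit Types (G H : christoffel R) (x y z : R) (T : 'M[R]_3).

(** The products invariant under the half-turns about the three coordinate axes; they serve the a_4
    structures as well as the Klein group. *)
Definition klein x y z : christoffel R :=
  symbols [:: (i1, i2, i3, x); (i1, i3, i2, y); (i2, i3, i1, z)].

Lemma Lmx_klein x y z :
  [/\ Lmx (klein x y z) i1 = mx3 [:: [:: 0; 0; 0]; [:: 0; 0; y]; [:: 0; x; 0]],
      Lmx (klein x y z) i2 = mx3 [:: [:: 0; 0; z]; [:: 0; 0; 0]; [:: x; 0; 0]] &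
      Lmx (klein x y z) i3 = mx3 [:: [:: 0; z; 0]; [:: y; 0; 0]; [:: 0; 0; 0]]].
Proof.
by split; apply: mx3P; rewrite /klein !mxE /= !symbolsE /= ?addr0 ?add0r.
Qed.

(** The columns of [P] form one orbit of [rot3], with plane parts 2/3 times the cube roots of unity;
    in this basis [rot3] becomes the cyclic permutation of the coordinates. *)
Lemma isom_Gam_klein x : x ^+ 2 = 2 ->
  isomorphic (Gam 1 (x / 2) (x / 2) 0 (- x)) (klein 1 1 1).
Proof.
move=> x2; have r3 : Num.sqrt 3 ^+ 2 = 3 :> R by rewrite sqr_sqrtr ?ler0n.
have s3 : Num.sqrt 3 != 0 :> R by apply: contra_eq_neq r3 => ->; rewrite expr0n eq_sym pnatr_eq0.
set r : R := Num.sqrt 3 in r3 s3 *.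
have x0 : x != 0 by apply: contra_eq_neq x2 => ->; rewrite expr0n eq_sym pnatr_eq0.
set P : 'M[R]_3 := mx3 [:: [:: 2 / 3; - (1 / 3); - (1 / 3)]; [:: 0; r / 3; - (r / 3)];
                           [:: - (x / 3); - (x / 3); - (x / 3)]].
have dP : \det P = - (2 / 9) * (r * x).
  by rewrite det3 !mxE /=; field.
have uP : P \in unitmx.
  by rewrite unitmxE unitfE dP !mulf_neq0 // ?oppr_eq0 ?mulf_neq0 ?invr_eq0 ?pnatr_eq0.
exists P => //; apply/esym/actP3 => //.
have [L1 L2 L3] := Lmx_Gam 1 (x / 2) (x / 2) 0 (- x).
have [M1 M2 M3] := Lmx_klein 1 1 1.
have xr3 := congr1 (fun z => x * z) r3; have xx2 := congr1 (fun z => x * z) x2.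
have rx2 := congr1 (fun z => r * z) x2.
by apply: ord3P; rewrite /P L1 L2 L3 ?M1 ?M2 ?M3; act_mx3; first [ring | move: r3 x2 xr3 xx2 rx2 => /= *; lra].
Qed.

Lemma isom_a4_klein (s : bool) : isomorphic (Gamma_a4 R s) (klein 1 1 1).
Proof.
have [e e2 ->] : exists2 e : R, e ^+ 2 = 1 &
    Gamma_a4 R s = Gam 1 (e / Num.sqrt 2) (e / Num.sqrt 2) 0 (- e * Num.sqrt 2).
  by exists (if s then 1 else -1) => //; case: s; rewrite ?sqrrN expr1n.
have r2 : Num.sqrt 2 ^+ 2 = 2 :> R by rewrite sqr_sqrtr ?ler0n.
have s0 : Num.sqrt 2 != 0 :> R by apply: contra_eq_neq r2 => ->; rewrite expr0n eq_sym pnatr_eq0.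
have -> : e / Num.sqrt 2 = e * Num.sqrt 2 / 2.
  apply: (mulIf s0); rewrite divfK //.
  by transitivity (e * Num.sqrt 2 ^+ 2 / 2); [rewrite r2|]; field.
by rewrite mulNr; apply: isom_Gam_klein; rewrite exprMn e2 r2 mul1r.
Qed.

Lemma ord4P (Q : 'I_4 -> Prop) : Q (@Ordinal 4 0 isT) -> Q (@Ordinal 4 1 isT) ->
  Q (@Ordinal 4 2 isT) -> Q (@Ordinal 4 3 isT) -> forall i, Q i.
Proof.
move=> q0 q1 q2 q3 [[|[|[|[|//]]]] lt_i].
- by have <- : @Ordinal 4 0 isT = Ordinal lt_i by apply: val_inj.
- by have <- : @Ordinal 4 1 isT = Ordinal lt_i by apply: val_inj.
- by have <- : @Ordinal 4 2 isT = Ordinal lt_i by apply: val_inj.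
- by have <- : @Ordinal 4 3 isT = Ordinal lt_i by apply: val_inj.
Qed.

Lemma sum4 (V : nmodType) (F : 'I_4 -> V) : \sum_i F i =
  F (@Ordinal 4 0 isT) + F (@Ordinal 4 1 isT) + F (@Ordinal 4 2 isT) + F (@Ordinal 4 3 isT).
Proof.
rewrite !big_ord_recl big_ord0 addr0 !addrA.
by congr (F _ + F _ + F _ + F _); apply: val_inj.
Qed.

(* The columns are the vertices of a tetrahedron, twice the idempotents of [klein 1 1 1]. *)
Definition tetra : 'M[R]_(3, 4) :=
  \matrix_(i, j) (nth [::] [:: [:: 1; 1; -1; -1]; [:: 1; -1; 1; -1]; [:: 1; -1; -1; 1]] i)`_j.

(** The linear map inducing a permutation of the vertices: [tetra^T] divided by 4 is a right inverse
    of [tetra]. *)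
Definition tetra_mx (s : {perm 'I_4}) : 'M[R]_3 := 4^-1 *: (tetra *m perm_mx s *m tetra^T).

Lemma tetra_tr : tetra *m tetra^T = 4%:M.
Proof.
by apply: mx3P; rewrite mxE sum4 !mxE /=; ring.
Qed.

Lemma tetra_sum : tetra *m const_mx 1 = 0 :> 'M[R]_(3, 4).
Proof.
by apply/matrixP; apply: ord3P => j; rewrite mxE sum4 !mxE /=; ring.
Qed.

Lemma tr_tetra : tetra^T *m tetra = 4%:M - const_mx 1.
Proof.
by apply/matrixP; do 2!apply: ord4P; rewrite mxE sum3 !mxE /=; ring.
Qed.

(** The matrix [tetra^T *m tetra] differs from 4 by the all-ones matrix, which absorbs permutation
    matrices and is killed by [tetra] because the vertices sum to zero. *)
Lemma tetra_mx_tetra s : tetra_mx s *m tetra = tetra *m perm_mx s.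
Proof.
have pJ : perm_mx s *m const_mx 1 = const_mx 1 :> 'M[R]_4.
  by rewrite -row_permE; apply/matrixP => i j; rewrite !mxE.
rewrite /tetra_mx -scalemxAl -[_ *m _ *m tetra]mulmxA tr_tetra mulmxBr -(mulmxA _ _ (const_mx 1)) pJ tetra_sum subr0.
by rewrite mul_mx_scalar scalerA mulVf ?scale1r // pnatr_eq0.
Qed.

Lemma tetra_mx_inj_mul (A B : 'M[R]_3) : A *m tetra = B *m tetra -> A = B.
Proof.
move=> /(congr1 (fun Z => Z *m tetra^T)); rewrite -!mulmxA tetra_tr !mul_mx_scalar.
by apply: scalerI; rewrite pnatr_eq0.
Qed.

Lemma tetra_mxM s t : tetra_mx (s * t)%g = tetra_mx s *m tetra_mx t.
Proof.
apply: tetra_mx_inj_mul; rewrite -mulmxA !tetra_mx_tetra perm_mxM !mulmxA.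
by rewrite tetra_mx_tetra.
Qed.

Lemma tetra_col_inj (a b : 'I_4) : (forall k, tetra k a = tetra k b) -> a = b.
Proof.
move=> E; move: (E i1) (E i2) (E i3) => {E}; move: a b.
by do 2!apply: ord4P => //; rewrite !mxE /= => *; exfalso; lra.
Qed.

(** The inverse reflects the left-to-right composition of permutations, which makes [tetra_mx]
    multiplicative. *)
Lemma tetra_mx_col s k a : (tetra *m perm_mx s) k a = tetra k ((s^-1)%g a).
Proof.
rewrite mxE (bigD1 ((s^-1)%g a)) //= big1 ?addr0; first by rewrite !mxE permKV eqxx mulr1.
move=> b ba; rewrite !mxE; case: eqP => [E|]; last by rewrite mulr0.
by case/eqP: ba; rewrite -E permK.
Qed.

Lemma tetra_mx_inj : injective tetra_mx.
Proof.
move=> s t E; apply: invg_inj; apply/permP => a; apply: tetra_col_inj => k.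
by rewrite -!tetra_mx_col -!tetra_mx_tetra E.
Qed.

(** The equations say u u = 2 u. If u1 is nonzero they give u2^2 = u3^2 = 1, and u is a sign vector
    with product 1, that is a vertex. *)
Lemma klein_fixed_cases (u1 u2 u3 : R) : u1 = u2 * u3 -> u2 = u1 * u3 -> u3 = u1 * u2 ->
  [/\ u1 = 0, u2 = 0 & u3 = 0] \/
  exists b : 'I_4, [/\ u1 = tetra i1 b, u2 = tetra i2 b & u3 = tetra i3 b].
Proof.
move=> e1 e2 e3; have [z1|z1] := eqVneq u1 0.
  by left; rewrite e3 e2 z1 !mul0r.
right.
have q2 : u2 ^+ 2 = 1 by apply: (mulfI z1); rewrite mulr1 [RHS]e1 e3; ring.
have q3 : u3 ^+ 2 = 1 by apply: (mulfI z1); rewrite mulr1 [RHS]e1 e2; ring.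
have [p2|p2] := sqr_eq1P q2; have [p3|p3] := sqr_eq1P q3.
- by exists (@Ordinal 4 0 isT); rewrite !mxE /= e1 p2 p3 mulr1.
- by exists (@Ordinal 4 2 isT); rewrite !mxE /= e1 p2 p3 mul1r.
- by exists (@Ordinal 4 3 isT); rewrite !mxE /= e1 p2 p3 mulr1.
- by exists (@Ordinal 4 1 isT); rewrite !mxE /= e1 p2 p3 mulrNN mulr1.
Qed.

Lemma Gplus_klein_cols T a : Gplus (klein 1 1 1) T ->
  exists b, forall k, (T *m tetra) k a = tetra k b.
Proof.
move=> GT; have uT := Gplus_unit GT.
have [L1 L2 L3] := Lmx_klein 1 1 1.
have [_ /(actP3 _ _ uT) E] := GT.
have F i n k : (T *m Lmx (klein 1 1 1) i) k n =
   ((T i1 i *: Lmx (klein 1 1 1) i1 + T i2 i *: Lmx (klein 1 1 1) i2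
    + T i3 i *: Lmx (klein 1 1 1) i3) *m T) k n by rewrite E.
(* [D] expresses e_j e_j = 0, and the triples [A], [B], [C] express e2 e3 = e1, e1 e3 = e2, e1 e2 =
   e3; together they yield u u = 2 u for the image u of a vertex. *)
have D j : T i1 j * T i2 j = 0 /\ T i1 j * T i3 j = 0 /\ T i2 j * T i3 j = 0.
  move: (F j j i1) (F j j i2) (F j j i3); move: j; apply: ord3P;
  by rewrite L1 L2 L3 !mulmx3 !mxE /= => *; repeat split; lra.
have [A1 A2 A3] : [/\ T i1 i1 = T i2 i2 * T i3 i3 + T i3 i2 * T i2 i3,
   T i2 i1 = T i1 i2 * T i3 i3 + T i3 i2 * T i1 i3 &
   T i3 i1 = T i1 i2 * T i2 i3 + T i2 i2 * T i1 i3].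
  move: (F i2 i3 i1) (F i2 i3 i2) (F i2 i3 i3).
  by rewrite L1 L2 L3 !mulmx3 !mxE /= => *; split; lra.
have [B1 B2 B3] : [/\ T i1 i2 = T i2 i1 * T i3 i3 + T i3 i1 * T i2 i3,
   T i2 i2 = T i1 i1 * T i3 i3 + T i3 i1 * T i1 i3 &
   T i3 i2 = T i1 i1 * T i2 i3 + T i2 i1 * T i1 i3].
  move: (F i1 i3 i1) (F i1 i3 i2) (F i1 i3 i3).
  by rewrite L1 L2 L3 !mulmx3 !mxE /= => *; split; lra.
have [C1 C2 C3] : [/\ T i1 i3 = T i2 i1 * T i3 i2 + T i3 i1 * T i2 i2,
   T i2 i3 = T i1 i1 * T i3 i2 + T i3 i1 * T i1 i2 &
   T i3 i3 = T i1 i1 * T i2 i2 + T i2 i1 * T i1 i2].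
  move: (F i1 i2 i1) (F i1 i2 i2) (F i1 i2 i3).
  by rewrite L1 L2 L3 !mulmx3 !mxE /= => *; split; lra.
have [D11 [D12 D13]] := D i1; have [D21 [D22 D23]] := D i2; have [D31 [D32 D33]] := D i3.
set u := T *m tetra.
have U : u i1 a = u i2 a * u i3 a /\ u i2 a = u i1 a * u i3 a /\ u i3 a = u i1 a * u i2 a.
  clear -D11 D12 D13 D21 D22 D23 D31 D32 D33 A1 A2 A3 B1 B2 B3 C1 C2 C3; subst u.
  by move: a; apply: ord4P; rewrite !mulmx3 !mxE /=; repeat split; lra.
have [U1 [U2 U3]] := U.
have [[z1 z2 z3]|[b [b1 b2 b3]]] := klein_fixed_cases U1 U2 U3; last by exists b; apply: ord3P.
have : col a tetra = 0.
  apply: (can_inj (mulKmx uT)); rewrite mulmx0 colE mulmxA -colE.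
  by apply: col3_eq0; rewrite mxE.
move/colP/(_ i1); rewrite mxE [RHS]mxE => ta; exfalso; clear -ta.
by move: a ta; apply: ord4P; rewrite mxE /=; lra.
Qed.

(** All permutations of the vertices are automorphisms, and transpositions act as reflections;
    positivity of the determinant therefore cuts out the alternating group. *)
Lemma tetra_tperm (x y : 'I_4) : x != y ->
  \det (tetra_mx (tperm x y)) = -1 /\ act (tetra_mx (tperm x y)) (klein 1 1 1) = klein 1 1 1.
Proof.
have [M1 M2 M3] := Lmx_klein 1 1 1.
have K (x' y' : 'I_4) (T : 'M[R]_3) : (forall k a, (T *m tetra) k a = tetra k (tperm x' y' a)) ->
    \det T = -1 ->
    (forall i, T *m Lmx (klein 1 1 1) i = (T i1 i *: Lmx (klein 1 1 1) i1
       + T i2 i *: Lmx (klein 1 1 1) i2 + T i3 i *: Lmx (klein 1 1 1) i3) *m T) ->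
    \det (tetra_mx (tperm x' y')) = -1 /\ act (tetra_mx (tperm x' y')) (klein 1 1 1) = klein 1 1 1.
  move=> TE dT E; have -> : tetra_mx (tperm x' y') = T.
    apply: tetra_mx_inj_mul; rewrite tetra_mx_tetra; apply/matrixP => k a.
    by rewrite tetra_mx_col TE tpermV.
  by split=> //; apply/actP3 => //; rewrite unitmxE dT unitrN1.
wlog lt_xy : x y / (x < y)%N.
  move=> W xy; have : (x < y)%N || (y < x)%N by rewrite -neq_ltn.
  by case/orP => [|yx]; [|rewrite tpermC]; move=> *; apply: W; rewrite // eq_sym.
move=> _; move: x y lt_xy; do 2!apply: ord4P => //.
all: move=> _; [> apply: (K _ _ (mx3 [:: [:: 1; 0; 0]; [:: 0; 0; -1]; [:: 0; -1; 0]]))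
  | apply: (K _ _ (mx3 [:: [:: 0; 0; -1]; [:: 0; 1; 0]; [:: -1; 0; 0]]))
  | apply: (K _ _ (mx3 [:: [:: 0; -1; 0]; [:: -1; 0; 0]; [:: 0; 0; 1]]))
  | apply: (K _ _ (mx3 [:: [:: 0; 1; 0]; [:: 1; 0; 0]; [:: 0; 0; 1]]))
  | apply: (K _ _ (mx3 [:: [:: 0; 0; 1]; [:: 0; 1; 0]; [:: 1; 0; 0]]))
  | apply: (K _ _ (mx3 [:: [:: 1; 0; 0]; [:: 0; 0; 1]; [:: 0; 1; 0]])) ].
all: try by rewrite det3 !mx3E /=; ring.
all: try by apply: ord3P; rewrite M1 M2 M3; act_mx3; ring.
all: by apply: ord3P; apply: ord4P; rewrite mulmx3 permE !mxE /=; ring.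
Qed.

Lemma tetra_mx1 : tetra_mx 1 = 1%:M.
Proof.
by apply: tetra_mx_inj_mul; rewrite tetra_mx_tetra perm_mx1 mulmx1 mul1mx.
Qed.

Lemma tetra_mx_act s :
  \det (tetra_mx s) = (-1) ^+ s /\ act (tetra_mx s) (klein 1 1 1) = klein 1 1 1.
Proof.
have [ts -> ts_d] := prod_tpermP s.
elim: ts ts_d => [|t ts IH] /=.
  by rewrite big_nil tetra_mx1 odd_perm1 det1 act1.
case/andP=> nt /IH[d2 a2]; have nt' : t.1 != t.2 by exact: nt.
have [d1 a1] := tetra_tperm nt'.
rewrite big_cons tetra_mxM det_mulmx d1 d2 odd_permM.
have u1 : tetra_mx (tperm t.1 t.2) \in unitmx by rewrite unitmxE d1 unitrN1.
have u2 : tetra_mx (\prod_(t <- ts) tperm t.1 t.2) \in unitmx by rewrite unitmxE d2 unitrX ?unitrN1.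
rewrite actM // a1 a2; split=> //.
by rewrite signr_addb odd_tperm nt'.
Qed.

Lemma isog_klein : mxgroup_isog (Gplus (klein 1 1 1)) ('Alt_('I_4))%G.
Proof.
exists tetra_mx; last by move=> s t _ _; exact: tetra_mxM.
split=> [s|s t _ _|T GT]; last 1 first.
- have [f fE] : exists f : 'I_4 -> 'I_4, forall a k, (T *m tetra) k a = tetra k (f a).
    have := fun a => Gplus_klein_cols a GT.
    by move=> /choice[f fE]; exists f.
  have uT := Gplus_unit GT.
  have injf : injective f.
    move=> a b fab; apply: tetra_col_inj => k.
    have E : T *m col a tetra = T *m col b tetra.
      by rewrite !colE !mulmxA -!colE; apply/colP => i; rewrite mxE [RHS]mxE !fE fab.
    by have /colP/(_ k) := can_inj (mulKmx uT) E; rewrite !mxE.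
  have [s sT] : exists s, tetra_mx s = T.
    exists ((perm injf)^-1)%g.
    apply: tetra_mx_inj_mul; rewrite tetra_mx_tetra; apply/matrixP => k a.
    by rewrite tetra_mx_col invgK permE fE.
  exists s => //; rewrite /= Alt_even; apply/negP => odd_s.
  have [dT _] := GT; have [ds _] := tetra_mx_act s.
  by move: dT; rewrite -sT ds odd_s expr1 ltr0N1.
- rewrite /= Alt_even => /negbTE even_s; have [ds fs] := tetra_mx_act s.
  by split=> //; rewrite ds even_s ltr01.
- exact: tetra_mx_inj.
Qed.

End AlternatingGroup.

(** * Normal forms for hyperbolic and elliptic automorphisms *)

Section NormalForms.
Variable R : realType.
Implicit Types (G H : christoffel R) (a b c d e x y z p q : R) (T : 'M[R]_3).

Lemma diag_fixed G (t : 'rV[R]_3) i n k : Gplus G (diag_mx t) ->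
  t 0 k * G i n k = t 0 i * t 0 n * G i n k.
Proof.
move=> GT; have [_ /(actP _ _ (Gplus_unit GT))/(_ i)/matrixP/(_ k n)] := GT.
rewrite mul_diag_mx mul_mx_diag !mxE summxE (bigD1 i) //= big1 ?addr0.
  by rewrite !mxE eqxx mulr1n => ->; ring.
by move=> j ji; rewrite !mxE (negPf ji) mulr0n mul0r.
Qed.

Lemma mx3_diag x y z :
  mx3 [:: [:: x; 0; 0]; [:: 0; y; 0]; [:: 0; 0; z]] =
  diag_mx (\row_j (if j == i1 then x else if j == i2 then y else z)) :> 'M[R]_3.
Proof. by apply: mx3P; rewrite !mxE. Qed.

Lemma diag3_fixed G x y z : Gplus G (mx3 [:: [:: x; 0; 0]; [:: 0; y; 0]; [:: 0; 0; z]]) ->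
  let t j := if j == i1 then x else if j == i2 then y else z in
  forall i n k, t k * G i n k = t i * t n * G i n k.
Proof.
by rewrite mx3_diag => GT t i n k; have := diag_fixed i n k GT; rewrite !mxE.
Qed.

(** Invariance multiplies Gamma_(ij)^k by x^w with |w| <= 3 determined by the indices; a real x
    other than 0, 1, -1 has x^w <> 1 unless w = 0. *)
Lemma hyperbolic_normal_form G x : torsion_free G -> x != 0 -> x ^+ 2 != 1 ->
  Gplus G (mx3 [:: [:: x; 0; 0]; [:: 0; x^-1; 0]; [:: 0; 0; 1]]) ->
  exists a b c d, G = Gamma_SO11 a b c d.
Proof.
move=> tfG x0 x21 /diag3_fixed /= F.
have m1 : x - 1 != 0 by apply: contra_neq x21 => /subr0_eq ->; rewrite expr1n.
have p1 : x + 1 != 0.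
  by apply: contra_neq x21 => /eqP; rewrite addr_eq0 => /eqP ->; rewrite sqrrN expr1n.
(* The cofactor of x - 1 in x^3 - 1, for the two symbols of weight 3 and -3. *)
have q1 : x ^+ 2 + x + 1 != 0 by rewrite gt_eqF //; have := sqr_ge0 (x + 1 / 2); lra.
have Z (u k l m n : R) : k != 0 -> k * u = l * (m - n) -> m = n -> u = 0.
  by move=> k0 E mn; apply: (mulfI k0); rewrite E mn subrr !mulr0.
exists (G i1 i2 i3), (G i1 i3 i1), (G i2 i3 i2), (G i3 i3 i3).
apply: christoffelP => //; first exact: symbols_torsion_free.
all: apply: ord3P; rewrite /Gamma_SO11 !symbolsE /= ?addr0 ?add0r //.
- by apply: (Z _ _ (- x^-1) _ _ m1 _ (F i1 i1 i1)); rewrite /=; field.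
- by apply: (Z _ _ (- x) _ _ (mulf_neq0 m1 q1) _ (F i1 i1 i2)); rewrite /=; field.
- by apply: (Z _ _ (- 1) _ _ (mulf_neq0 m1 p1) _ (F i1 i1 i3)); rewrite /=; field.
- by apply: (Z _ _ 1 _ _ m1 _ (F i1 i2 i1)); rewrite /=; field.
- by apply: (Z _ _ (- x) _ _ m1 _ (F i1 i2 i2)); rewrite /=; field.
- by apply: (Z _ _ (- x) _ _ (mulf_neq0 m1 p1) _ (F i1 i3 i2)); rewrite /=; field.
- by apply: (Z _ _ (- 1) _ _ m1 _ (F i1 i3 i3)); rewrite /=; field.
- by apply: (Z _ _ (x ^+ 2) _ _ (mulf_neq0 m1 q1) _ (F i2 i2 i1)); rewrite /=; field.
- by apply: (Z _ _ (x ^+ 2) _ _ m1 _ (F i2 i2 i2)); rewrite /=; field.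
- by apply: (Z _ _ (x ^+ 2) _ _ (mulf_neq0 m1 p1) _ (F i2 i2 i3)); rewrite /=; field.
- by apply: (Z _ _ x _ _ (mulf_neq0 m1 p1) _ (F i2 i3 i1)); rewrite /=; field.
- by apply: (Z _ _ x _ _ m1 _ (F i2 i3 i3)); rewrite /=; field.
- by apply: (Z _ _ 1 _ _ m1 _ (F i3 i3 i1)); rewrite /=; field.
- by apply: (Z _ _ (- x) _ _ m1 _ (F i3 i3 i2)); rewrite /=; field.
Qed.

Definition rot p q : 'M[R]_3 := mx3 [:: [:: p; - q; 0]; [:: q; p; 0]; [:: 0; 0; 1]].

(** The two equations are the real and imaginary parts of (r + i s) (x + i y) = 0. *)
Lemma complex_eq0 (r s x y : R) : r ^+ 2 + s ^+ 2 != 0 ->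
  r * x - s * y = 0 -> s * x + r * y = 0 -> x = 0 /\ y = 0.
Proof.
move=> n0 e1 e2; have f1 k := congr1 (fun z => k * z) e1; have f2 k := congr1 (fun z => k * z) e2.
split; apply: (mulfI n0); rewrite mulr0.
  by move: (f1 r) (f2 s) => /= *; lra.
by move: (f1 s) (f2 r) => /= *; lra.
Qed.

(* Writing the plane of rotation as the complex line, the product of two of its vectors
   z, w is kappa z^* w^* + a Re(z w^* ) e3, with kappa = e + i f, and e3 acts on it by
   multiplication by b + i c. *)
Lemma rot_fixed G p q : torsion_free G -> p ^+ 2 + q ^+ 2 = 1 -> q != 0 ->
  Gplus G (rot p q) -> exists e f a b c d,
  [/\ Lmx G i1 = mx3 [:: [:: e; f; b]; [:: f; - e; c]; [:: a; 0; 0]],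
      Lmx G i2 = mx3 [:: [:: f; - e; - c]; [:: - e; - f; b]; [:: 0; a; 0]] &
      Lmx G i3 = mx3 [:: [:: b; - c; 0]; [:: c; b; 0]; [:: 0; 0; d]]].
Proof.
move=> tfG pq q0 GT; have [_ /(actP3 _ _ (Gplus_unit GT)) E] := GT.
have F i n k : (rot p q *m Lmx G i) k n = ((rot p q i1 i *: Lmx G i1
    + rot p q i2 i *: Lmx G i2 + rot p q i3 i *: Lmx G i3) *m rot p q) k n by rewrite E.
have q2 : q ^+ 2 != 0 by rewrite expf_neq0.
have pq0 : (p - 1) ^+ 2 + q ^+ 2 != 0.
  by rewrite gt_eqF // ltr_wpDl ?sqr_ge0 // exprn_even_gt0.
have pqz z := congr1 (fun y => z * y) pq.
have [z331 z332] : G i3 i3 i1 = 0 /\ G i3 i3 i2 = 0.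
  by apply: (complex_eq0 pq0); [have := F i3 i3 i1|have := F i3 i3 i2];
    rewrite /rot !mulmx3 !mxE /=; lra.
have [z133 z233] : G i1 i3 i3 = 0 /\ G i2 i3 i3 = 0.
  have pq0' : (p - 1) ^+ 2 + (- q) ^+ 2 != 0 by rewrite sqrrN.
  by apply: (complex_eq0 pq0'); [have := F i1 i3 i3|have := F i2 i3 i3];
    rewrite /rot !mulmx3 !mxE /=; lra.
(* Put zeta = p + i q. The trace-free part of the e3-component on the plane is annihilated by
   conj(zeta)^2 - 1, of squared modulus 4 q^2. *)
have [z113 z123] : G i1 i1 i3 - G i2 i2 i3 = 0 /\ 2 * G i1 i2 i3 = 0.
  apply: (@complex_eq0 (p ^+ 2 - q ^+ 2 - 1) (- (2 * p * q))).
  - have -> : (p ^+ 2 - q ^+ 2 - 1) ^+ 2 + (- (2 * p * q)) ^+ 2 = 4 * q ^+ 2 by nra.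
    by rewrite mulf_neq0 // pnatr_eq0.
  - by move: (F i1 i1 i3) (F i2 i2 i3); rewrite /rot !mulmx3 !mxE /= !(tfG i2 i1); lra.
  - by move: (F i1 i2 i3); rewrite /rot !mulmx3 !mxE /= !(tfG i2 i1); lra.
(* The coefficient of z conj(w) + conj(z) w is fixed by the rotation, hence zero. *)
have [z111 z112] : G i1 i1 i1 + G i2 i2 i1 = 0 /\ G i1 i1 i2 + G i2 i2 i2 = 0.
  apply: (complex_eq0 pq0).
  - have := pqz (G i1 i1 i1); have := pqz (G i2 i2 i1).
    by move: (F i1 i1 i1) (F i2 i2 i1); rewrite /rot !mulmx3 !mxE /= !(tfG i2 i1); lra.
  - have := pqz (G i1 i1 i2); have := pqz (G i2 i2 i2).
    by move: (F i1 i1 i2) (F i2 i2 i2); rewrite /rot !mulmx3 !mxE /= !(tfG i2 i1); lra.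
have E1 : G i2 i2 i1 = - G i1 i1 i1 by lra.
have E2 : G i2 i2 i2 = - G i1 i1 i2 by lra.
(* The coefficient of z w is annihilated by zeta^2 - zeta, which is nonzero. *)
have [y1 y2] : G i1 i1 i1 + G i1 i2 i2 = 0 /\ G i1 i1 i2 - G i1 i2 i1 = 0.
  apply: (@complex_eq0 (p ^+ 2 - q ^+ 2 - p) (2 * p * q - q)).
  - have [p12|p12] := eqVneq (2 * p - 1) 0.
      rewrite gt_eqF // ltr_pwDl ?sqr_ge0 // exprn_even_gt0 //=.
      have pE : p = 1 / 2 by lra.
      by apply/eqP; move: pq; rewrite pE; lra.
    by rewrite gt_eqF // ltr_wpDl ?sqr_ge0 // exprn_even_gt0 //= -[X in _ - X]mul1r -mulrBl mulf_neq0.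
  - move: (F i1 i1 i1) (F i1 i2 i2); rewrite /rot !mulmx3 !mxE /= !(tfG i2 i1) !E1 !E2; lra.
  - move: (F i1 i1 i2) (F i1 i2 i1); rewrite /rot !mulmx3 !mxE /= !(tfG i2 i1) !E1 !E2; lra.
have x1 : G i1 i3 i2 + G i2 i3 i1 = 0.
  by apply: (mulfI q0); move: (F i1 i3 i1); rewrite /rot !mulmx3 !mxE /=; lra.
have x2 : G i1 i3 i1 - G i2 i3 i2 = 0.
  by apply: (mulfI q0); move: (F i1 i3 i2); rewrite /rot !mulmx3 !mxE /=; lra.
exists (G i1 i1 i1), (G i1 i1 i2), (G i1 i1 i3), (G i1 i3 i1), (G i1 i3 i2), (G i3 i3 i3).
by split; rewrite Lmx_mx3; apply: mx3_congr; rewrite ?(tfG i2 i1) ?(tfG i3 i1) ?(tfG i3 i2) //; lra.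
Qed.

Lemma polar e f : e ^+ 2 + f ^+ 2 != 0 ->
  exists r t : R, [/\ r != 0, e = r * cos t & f = r * sin t].
Proof.
move=> n0; have n1 : 0 < e ^+ 2 + f ^+ 2 by rewrite lt_def n0 addr_ge0 ?sqr_ge0.
set r := Num.sqrt (e ^+ 2 + f ^+ 2).
have r2 : r ^+ 2 = e ^+ 2 + f ^+ 2 by rewrite sqr_sqrtr // ltW.
have r0 : r != 0 by rewrite gt_eqF // sqrtr_gt0.
have [|t _ [ct st]] := @cos_sin_surj R (e / r) (f / r).
  by rewrite !expr_div_n -mulrDl -r2 divff // expf_neq0.
by exists r, t; rewrite -ct -st; split => //; rewrite mulrC divfK.
Qed.

Lemma elliptic_normal_form G p q : torsion_free G -> p ^+ 2 + q ^+ 2 = 1 -> q != 0 ->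
  Gplus G (rot p q) ->
  exists2 H, isomorphic G H & exists a b c d, H = Gam 0 a b c d \/ H = Gam 1 a b c d.
Proof.
move=> tfG pq q0 /(rot_fixed tfG pq q0)[e [f [a [b [c [d [L1 L2 L3]]]]]]].
have [n0|n0] := eqVneq (e ^+ 2 + f ^+ 2) 0.
  have e0 : e = 0 by apply/eqP; rewrite -sqrf_eq0; apply/eqP; have := sqr_ge0 e; have := sqr_ge0 f; lra.
  have f0 : f = 0 by apply/eqP; rewrite -sqrf_eq0; apply/eqP; have := sqr_ge0 e; have := sqr_ge0 f; lra.
  exists G; first exact: isom_refl.
  exists a, b, c, d; left; apply: Lmx_inj.
  have [M1 M2 M3] := Lmx_Gam 0 a b c d.
  by apply: ord3P; rewrite ?L1 ?L2 ?L3 ?M1 ?M2 ?M3 ?e0 ?f0 ?oppr0.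
have [r [t [r0 eE fE]]] := polar n0.
(* The substitution z -> mu z multiplies kappa by conj(mu)^2 / mu. For kappa = r exp(i t) the choice
   mu = exp(i t / 3) / r brings it to 1. *)
pose s := t / 3.
have tE : t = s + s + s by rewrite /s; field.
have cs := cos2Dsin2 s.
set C := cos s in cs *; set S := sin s in cs *.
have ct : cos t = (C ^+ 2 - S ^+ 2) * C - 2 * C * S * S.
  by rewrite tE !cosD sinD -/C -/S; ring.
have st : sin t = 2 * C * S * C + (C ^+ 2 - S ^+ 2) * S.
  by rewrite tE !sinD cosD -/C -/S; ring.
set u := C / r; set v := S / r.
(* [k1] and [k2] are the real and imaginary parts of kappa conj(mu)^2 = mu for mu = u + i v. *)
have k1 : e * (u ^+ 2 - v ^+ 2) + 2 * f * u * v = u.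
  have -> : e * (u ^+ 2 - v ^+ 2) + 2 * f * u * v = (cos t * (C ^+ 2 - S ^+ 2) + 2 * sin t * C * S) / r.
    by rewrite eE fE /u /v; field.
  have -> : cos t * (C ^+ 2 - S ^+ 2) + 2 * sin t * C * S = C * (C ^+ 2 + S ^+ 2) ^+ 2.
    by rewrite ct st; ring.
  by rewrite cs expr1n mulr1.
have k2 : f * (u ^+ 2 - v ^+ 2) - 2 * e * u * v = v.
  have -> : f * (u ^+ 2 - v ^+ 2) - 2 * e * u * v = (sin t * (C ^+ 2 - S ^+ 2) - 2 * cos t * C * S) / r.
    by rewrite eE fE /u /v; field.
  have -> : sin t * (C ^+ 2 - S ^+ 2) - 2 * cos t * C * S = S * (C ^+ 2 + S ^+ 2) ^+ 2.
    by rewrite ct st; ring.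
  by rewrite cs expr1n mulr1.
have dP : \det (rot u v) = r ^- 2.
  rewrite det3 !mxE /=; transitivity ((C ^+ 2 + S ^+ 2) * r ^- 2); last by rewrite cs mul1r.
  by rewrite /u /v; field.
have uP : rot u v \in unitmx by rewrite unitmxE unitfE dP invr_eq0 expf_neq0.
exists (act (rot u v) G); first by exists (rot u v).
exists (a * (u ^+ 2 + v ^+ 2)), b, c, d; right.
apply/(actP3 _ _ uP).
have [M1 M2 M3] := Lmx_Gam 1 (a * (u ^+ 2 + v ^+ 2)) b c d.
by apply: ord3P; rewrite /rot L1 L2 L3 ?M1 ?M2 ?M3; act_mx3; first [ring | move: k1 k2; lra].
Qed.

End NormalForms.

(** * Spectral types of automorphisms *)

Section SpectralTypes.
Variable R : realType.
Implicit Types (G H : christoffel R) (a b c d p q : R) (A T P : 'M[R]_3) (u v w x y z : 'cV[R]_3).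

(** The second elementary symmetric function of the eigenvalues. *)
Definition minors2 A : R :=
  A i1 i1 * A i2 i2 - A i1 i2 * A i2 i1 + (A i1 i1 * A i3 i3 - A i1 i3 * A i3 i1)
  + (A i2 i2 * A i3 i3 - A i2 i3 * A i3 i2).

Lemma cayley_hamilton3 A :
  A *m A *m A = \tr A *: (A *m A) - minors2 A *: A + \det A *: 1%:M.
Proof.
by apply: mx3P; rewrite det3 tr3 /minors2 mulmx3 !mxE !sum3 /= ?eqxx; ring.
Qed.

Lemma det_sub_scalar A c :
  \det (A - c%:M) = - (c ^+ 3 - \tr A * c ^+ 2 + minors2 A * c - \det A).
Proof. by rewrite !det3 tr3 /minors2 !mxE /=; ring. Qed.

Lemma minors2_inv A : \det A = 1 -> minors2 A = \tr (invmx A).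
Proof.
move=> d1; have uA : A \in unitmx by rewrite unitmxE d1 unitr1.
have -> : invmx A = A *m A - \tr A *: A + minors2 A *: 1%:M.
  apply: (can_inj (mulKmx uA)); rewrite mulmxV // mulmxDr mulmxBr -!scalemxAr mulmx1 mulmxA.
  by rewrite cayley_hamilton3 d1 scale1r; apply/matrixP => i j; rewrite !mxE; ring.
by rewrite !tr3 /minors2 !mxE !sum3 /=; ring.
Qed.

Lemma exists_kernel A : \det A = 0 -> exists2 v : 'cV[R]_3, v != 0 & A *m v = 0.
Proof.
move=> dA; apply: contrapT => nv.
have : A \in unitmx.
  apply: unitmx_ker0 => x Ax; apply/eqP; apply: contrapT => /negP x0.
  by apply: nv; exists x.
by rewrite unitmxE dA unitr0.
Qed.

Lemma exists_eigenvector A c : \det (A - c%:M) = 0 -> exists2 v : 'cV[R]_3, v != 0 & A *m v = c *: v.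
Proof.
move=> /exists_kernel[v v0 /eqP]; rewrite mulmxBl subr_eq0 mul_scalar_mx => /eqP.
by exists v.
Qed.

(** Invariance under the full Jordan block gives e1 e1 = e1 e2 = 0 and puts e1 e3 on the line of e1,
    so e1 lies in the radical of rho. *)
Lemma shift_degenerate G : torsion_free G ->
  Gplus G (mx3 [:: [:: 1; 1; 0]; [:: 0; 1; 1]; [:: 0; 0; 1]]) -> ricci G \notin unitmx.
Proof.
move=> tfG; set D := mx3 _ => GT; have [_ /(actP3 _ _ (Gplus_unit GT)) E] := GT.
have := E i1; have := E i2; have := E i3.
rewrite !Lmx_mx3 /D !mx3E /= !comb_mx3 !mul_mx3 !(tfG i2 i1, tfG i3 i1, tfG i3 i2).
rewrite !(mul0r, mul1r, mulr0, mulr1, addr0, add0r) => {E GT D}.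
move=> /mx3_inj[[_ _ e31] [[_ _ e32] [_ _ e33]]] /mx3_inj[[_ e22 e23] [[_ e24 e25] [_ e26 e27]]].
move=> /mx3_inj[[e1 e2 e3] [[e4 e5 e6] [e7 e8 e9]]].
have z112 : G i1 i1 i2 = 0 by lra.
have z113 : G i1 i1 i3 = 0 by lra.
have z123 : G i1 i2 i3 = 0 by lra.
have z111 : G i1 i1 i1 = 0 by lra.
have z122 : G i1 i2 i2 = 0 by lra.
have z133 : G i1 i3 i3 = 0 by lra.
have z121 : G i1 i2 i1 = 0 by lra.
have z132 : G i1 i3 i2 = 0 by lra.
have r k : ricci G i1 k = 0.
  rewrite mxE !sum3 !(tfG i2 i1) !(tfG i3 i1) z112 z113 z123 z111 z122 z133 z121 z132.
  by move: k; apply: ord3P; rewrite ?(tfG i2 i1) ?(tfG i3 i1) ?z112 ?z113 ?z123 ?z111 ?z122 ?z133 ?z121 ?z132; ring.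
by rewrite unitmxE det3 !r !mul0r subrr addr0 unitr0.
Qed.

Section Isometry.
Variables (G : christoffel R) (T : 'M[R]_3).
Hypotheses (tfG : torsion_free G) (uric : ricci G \in unitmx) (GT : Gplus G T).
Let rho := ricci G.
Let B x y : R := (x^T *m rho *m y) 0 0.
Let s := \tr T.

(** The isometry equation makes T^-1 conjugate to T^T, so both traces agree. *)
Lemma Gplus_minors2 : minors2 T = s.
Proof.
rewrite minors2_inv ?(Gplus_det tfG uric GT) //.
have -> : invmx T = invmx rho *m (T^T *m rho) by rewrite (Gplus_riccil tfG GT) mulKmx.
by rewrite mulmxA mxtrace_mulC mulmxA mulmxV // mul1mx mxtrace_tr.
Qed.

Lemma Gplus_cubic x : T *m (T *m (T *m x)) = s *: (T *m (T *m x)) - s *: (T *m x) + x.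
Proof.
rewrite !mulmxA cayley_hamilton3 Gplus_minors2 (Gplus_det tfG uric GT).
by rewrite !mulmxDl mulNmx -!scalemxAl mul1mx scale1r.
Qed.

Lemma Gplus_eigenvector c : c ^+ 3 - s * c ^+ 2 + s * c - 1 = 0 ->
  exists2 v : 'cV[R]_3, v != 0 & T *m v = c *: v.
Proof.
move=> E; apply: exists_eigenvector.
by rewrite det_sub_scalar Gplus_minors2 (Gplus_det tfG uric GT) E oppr0.
Qed.

Lemma Gplus_fixed : exists2 v : 'cV[R]_3, v != 0 & T *m v = v.
Proof.
have [|v v0 Tv] := @Gplus_eigenvector 1; first by ring.
by exists v; rewrite // Tv scale1r.
Qed.

Lemma Gplus_form x y : B (T *m x) (T *m y) = B x y.
Proof.
by rewrite /B /rho -[in RHS](Gplus_ricci tfG GT) trmx_mul !mulmxA.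
Qed.

Lemma form_sym x y : B x y = B y x.
Proof.
transitivity ((x^T *m rho *m y)^T 0 0); first by rewrite mxE.
by rewrite !trmx_mul trmxK ricci_sym // mulmxA.
Qed.

Lemma formDr x y z : B x (y + z) = B x y + B x z.
Proof. by rewrite /B mulmxDr mxE. Qed.

Lemma formZr c x y : B x (c *: y) = c * B x y.
Proof. by rewrite /B -scalemxAr mxE. Qed.

Lemma form_radical u v w x : cols3 u v w \in unitmx ->
  B x u = 0 -> B x v = 0 -> B x w = 0 -> x = 0.
Proof.
move=> uP Bu Bv Bw; apply: trmx_inj; rewrite trmx0.
have E : x^T *m rho *m cols3 u v w = 0.
  apply/matrixP => i j; rewrite !mxE ord1.
  transitivity (\sum_k (x^T *m rho) 0 k * (cols3 u v w) k j) => //.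
  move: j; apply: ord3P; [rewrite -[RHS]Bu|rewrite -[RHS]Bv|rewrite -[RHS]Bw];
    by rewrite /B [RHS]mxE; apply: eq_bigr => k _; congr (_ * _); rewrite mxE.
have E2 : x^T *m rho = 0 by apply: (can_inj (mulmxK uP)); rewrite E mul0mx.
by apply: (can_inj (mulmxK uric)); rewrite E2 mul0mx.
Qed.

Lemma lincomb_act x y z a b c : T *m (a *: x + b *: y + c *: z) =
  a *: (T *m x) + b *: (T *m y) + c *: (T *m z).
Proof. by rewrite !mulmxDr -!scalemxAr. Qed.

Lemma scaled_eq0 v c : v != 0 -> c *: v = 0 -> c = 0.
Proof. by move=> v0 /eqP; rewrite scaler_eq0 (negPf v0) orbF => /eqP. Qed.

Lemma eigenvectors_indep c c' u w v a b d : u != 0 -> w != 0 -> v != 0 ->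
  T *m u = c *: u -> T *m w = c' *: w -> T *m v = v ->
  c - c' != 0 -> c - 1 != 0 -> c' - 1 != 0 ->
  a *: u + b *: w + d *: v = 0 -> [/\ a = 0, b = 0 & d = 0].
Proof.
move=> u0 w0 v0 Tu Tw Tv n1 n2 n3 E.
have E1 := congr1 (mulmx T) E; rewrite mulmx0 lincomb_act Tu Tw Tv !scalerA in E1.
have E2 := congr1 (mulmx T) E1; rewrite mulmx0 lincomb_act Tu Tw Tv !scalerA in E2.
have C i : [/\ a * u i 0 + b * w i 0 + d * v i 0 = 0,
   a * c * u i 0 + b * c' * w i 0 + d * v i 0 = 0 &
   a * c * c * u i 0 + b * c' * c' * w i 0 + d * v i 0 = 0].
  by split; [move/colP/(_ i): E|move/colP/(_ i): E1|move/colP/(_ i): E2]; rewrite !mxE.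
split.
(* The combination below is (T - c') (T - 1) applied to the relation; the other two bullets use the
   remaining pairs of eigenvalues. *)
- apply: (mulfI (mulf_neq0 n1 n2)); rewrite mulr0; apply: (scaled_eq0 u0); apply/colP => i.
  have [e e1 e2] := C i; rewrite !mxE.
  transitivity ((a * c * c * u i 0 + b * c' * c' * w i 0 + d * v i 0)
    - (c' + 1) * (a * c * u i 0 + b * c' * w i 0 + d * v i 0)
    + c' * (a * u i 0 + b * w i 0 + d * v i 0)); first ring.
  by rewrite e e1 e2; ring.
- apply: (mulfI (mulf_neq0 n1 n3)); rewrite mulr0; apply: (scaled_eq0 w0); apply/colP => i.
  have [e e1 e2] := C i; rewrite !mxE.
  transitivity (- ((a * c * c * u i 0 + b * c' * c' * w i 0 + d * v i 0)
    - (c + 1) * (a * c * u i 0 + b * c' * w i 0 + d * v i 0)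
    + c * (a * u i 0 + b * w i 0 + d * v i 0))); first ring.
  by rewrite e e1 e2; ring.
- apply: (mulfI (mulf_neq0 n2 n3)); rewrite mulr0; apply: (scaled_eq0 v0); apply/colP => i.
  have [e e1 e2] := C i; rewrite !mxE.
  transitivity ((a * c * c * u i 0 + b * c' * c' * w i 0 + d * v i 0)
    - (c + c') * (a * c * u i 0 + b * c' * w i 0 + d * v i 0)
    + c * c' * (a * u i 0 + b * w i 0 + d * v i 0)); first ring.
  by rewrite e e1 e2; ring.
Qed.

Lemma reciprocal_root (t : R) : 4 < t ^+ 2 ->
  exists c, [/\ c != 0, c ^+ 2 != 1 & c + c^-1 = t].
Proof.
move=> t4; set r := Num.sqrt (t ^+ 2 - 4).
have r2 : r ^+ 2 = t ^+ 2 - 4 by rewrite sqr_sqrtr //; lra.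
set c := (t + r) / 2.
have cE : c ^+ 2 = t * c - 1.
  have -> : c ^+ 2 = (t ^+ 2 + 2 * t * r + r ^+ 2) / 4 by rewrite /c; field.
  by rewrite r2 /c; field.
have c0 : c != 0.
  by apply: contra_eq_neq cE => ->; rewrite mulr0 expr0n sub0r eq_sym oppr_eq0 oner_eq0.
exists c; split=> //.
  apply/negP => /eqP c1.
  have tc : t * c = 2 by lra.
  have : (t * c) ^+ 2 = t ^+ 2 by rewrite exprMn c1 mulr1.
  by rewrite tc; lra.
by apply: (mulIf c0); rewrite mulrDl mulVf // -expr2 cE; ring.
Qed.

Lemma hyperbolic_basis : 4 < (s - 1) ^+ 2 ->
  exists c P, [/\ P \in unitmx, c != 0, c ^+ 2 != 1 &
    T *m P = P *m mx3 [:: [:: c; 0; 0]; [:: 0; c^-1; 0]; [:: 0; 0; 1]]].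
Proof.
move=> /reciprocal_root[c [c0 c21 cE]].
have c1 : c - 1 != 0 by apply: contra_neq c21 => /subr0_eq ->; rewrite expr1n.
have c'1 : c^-1 - 1 != 0.
  by apply: contra_neq c1 => /subr0_eq E; rewrite -[c]invrK E invr1 subrr.
have cdiff : c - c^-1 != 0.
  by apply: contra_neq c21 => /subr0_eq E; rewrite expr2 {2}E divff.
have [u u0 Tu] : exists2 u : 'cV[R]_3, u != 0 & T *m u = c *: u.
  apply/Gplus_eigenvector; have -> : s = c + c^-1 + 1 by rewrite cE subrK.
  by field.
have [w w0 Tw] : exists2 w : 'cV[R]_3, w != 0 & T *m w = c^-1 *: w.
  apply/Gplus_eigenvector; have -> : s = c + c^-1 + 1 by rewrite cE subrK.
  by field.
have [v v0 Tv] := Gplus_fixed.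
exists c, (cols3 u w v); split=> //.
  by apply: cols3_unit => a b d; apply: (eigenvectors_indep u0 w0 v0 Tu Tw Tv).
rewrite mul_cols3 cols3_mulmx Tu Tw Tv !mxE /=.
by rewrite !scale0r !scale1r !addr0 !add0r.
Qed.

(* The characteristic polynomial of [T] is (X - 1) (X^2 - (s - 1) X + 1). *)
Lemma Gplus_quadratic x : let w := T *m x - x in T *m (T *m w) = (s - 1) *: (T *m w) - w.
Proof.
move=> w; rewrite /w !mulmxBr Gplus_cubic.
by apply/colP => i; rewrite !mxE; ring.
Qed.

Lemma moved_vector : T <> 1%:M -> exists x, T *m x - x != 0.
Proof.
move=> T1; apply: contrapT => nx; apply: T1.
have E x : T *m x = x.
  by apply/eqP; rewrite -subr_eq0; apply: contrapT => /negP ?; apply: nx; exists x.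
by apply/matrixP => i j; have := E (delta_mx j 0); rewrite -colE => /colP/(_ i); rewrite !mxE eqxx andbT.
Qed.

Lemma elliptic_basis : T <> 1%:M -> (s - 1) ^+ 2 < 4 ->
  exists p q P, [/\ P \in unitmx, p ^+ 2 + q ^+ 2 = 1, q != 0 &
    T *m P = P *m rot p q].
Proof.
move=> /moved_vector[x w0] s4; have := Gplus_quadratic x.
move: (T *m x - x) w0 => w w0 /= TTw.
(* The cosine and sine of the rotation angle; y is then defined so that T w = p w + q y. *)
set p := (s - 1) / 2; set q := Num.sqrt (1 - p ^+ 2).
have p1 : p ^+ 2 < 1 by rewrite /p expr_div_n; lra.
have q2 : q ^+ 2 = 1 - p ^+ 2 by rewrite sqr_sqrtr // subr_ge0 ltW.
have q0 : q != 0 by rewrite gt_eqF // sqrtr_gt0 subr_gt0.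
have sE : s - 1 = 2 * p by rewrite /p; field.
have [y yE] : exists y, y = q^-1 *: (T *m w - p *: w) by exists (q^-1 *: (T *m w - p *: w)).
have Tw : T *m w = p *: w + q *: y.
  by rewrite yE scalerA divff // scale1r addrC subrK.
have Ty : T *m y = - q *: w + p *: y.
  apply: (scalerI q0); rewrite {1}yE scalemxAr scalerA divff // scale1r mulmxBr -scalemxAr TTw sE Tw.
  have q2E : q * q = 1 - p * p by rewrite -!expr2.
  by apply/colP => i; rewrite !mxE; have := congr1 (fun z : R => z * w i 0) q2E => /= *; lra.
have [v v0 Tv] := Gplus_fixed.
exists p, q, (cols3 w y v); split; rewrite ?q2 ?subrKC //; last first.
  by rewrite mul_cols3 cols3_mulmx Tw Ty Tv !mxE /= !scale0r !scale1r !addr0 !add0r.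
apply: cols3_unit => a b d E.
have E1 := congr1 (mulmx T) E; rewrite mulmx0 lincomb_act Tw Ty Tv in E1.
have E2 := congr1 (mulmx T) E1; rewrite mulmx0 lincomb_act !mulmxDr -!scalemxAr Tw Ty Tv in E2.
(* T^2 - 2 p T + 1 kills w and y and multiplies v by 2 - 2 p. *)
have d0 : d = 0.
  have n0 : 2 - 2 * p != 0.
    by apply: contra_ltN p1 => /eqP e; have -> : p = 1 by [lra]; rewrite expr1n lexx.
  apply: (mulfI n0); rewrite mulr0; apply: (scaled_eq0 v0); apply/colP => i.
  move/colP/(_ i): E; move/colP/(_ i): E1; move/colP/(_ i): E2; rewrite !mxE => e2 e1 e.
  have f1 := congr1 (fun z : R => p * z) e1.
  have g1 := congr1 (fun z : R => z * (a * w i 0)) q2; have g2 := congr1 (fun z : R => z * (b * y i 0)) q2.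
  by move: g1 g2 f1 => /= *; lra.
(* From a w + b y = 0 and its image under T follows a y - b w = 0, and then (a^2 + b^2) w = 0. *)
have ab : a ^+ 2 + b ^+ 2 = 0.
  apply: (mulfI q0); rewrite mulr0; apply: (scaled_eq0 w0); apply/colP => i.
  move/colP/(_ i): E; move/colP/(_ i): E1; rewrite d0 !mxE => e1 e.
  have f1 := congr1 (fun z : R => (q * a) * z) e; have f2 := congr1 (fun z : R => b * z) e1.
  have f3 := congr1 (fun z : R => b * p * z) e.
  by move: f1 f2 f3 => /= *; lra.
have a2 := sqr_ge0 a; have b2 := sqr_ge0 b.
by split=> //; apply/eqP; rewrite -sqrf_eq0; apply/eqP; lra.
Qed.

Lemma formDl x y z : B (x + y) z = B x z + B y z.
Proof. by rewrite form_sym formDr !(form_sym z). Qed.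

Lemma formZl c x y : B (c *: x) y = c * B x y.
Proof. by rewrite form_sym formZr form_sym. Qed.

Lemma form_nondeg x : (forall y, B x y = 0) -> x = 0.
Proof.
move=> Bx; apply: (@form_radical (delta_mx i1 0) (delta_mx i2 0) (delta_mx i3 0)) => //.
apply: cols3_unit => a b c E.
by split; [move/colP/(_ i1): E|move/colP/(_ i2): E|move/colP/(_ i3): E];
  rewrite !mxE /=; lra.
Qed.

(** Otherwise -1 has a Jordan block w, w2, and invariance of rho makes the eigenvector w2 orthogonal
    to the basis w, w2, v. *)
Lemma negative_parabolic : s = -1 -> T *m T = 1%:M.
Proof.
move=> sE; apply: contrapT => TT1.
have [x w20] : exists x, T *m (T *m x) - x != 0.
  apply: contrapT => nx; apply: TT1; apply/matrixP => i j.
  have E : T *m (T *m delta_mx j 0) = delta_mx j 0 :> 'cV[R]_3.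
    by apply/eqP; rewrite -subr_eq0; apply: contrapT => /negP ?; apply: nx; exists (delta_mx j 0).
  by move/colP/(_ i): E; rewrite mulmxA -colE !mxE eqxx andbT.
have [w wE] : exists w, w = T *m x - x by exists (T *m x - x).
have [w2 w2E] : exists w2, w2 = T *m (T *m x) - x by exists (T *m (T *m x) - x).
rewrite -w2E in w20.
have Tw : T *m w = w2 + (-1) *: w.
  by rewrite w2E wE mulmxBr scaleN1r; apply/colP => i; rewrite !mxE; ring.
have Tw2 : T *m w2 = (-1) *: w2.
  have := Gplus_quadratic x; rewrite /= -wE sE Tw mulmxDr -scalemxAr Tw => E.
  by apply/colP => i; move/colP/(_ i): E; rewrite !mxE; lra.
have [v v0 Tv] := Gplus_fixed.
have B1 := Gplus_form w2 w; rewrite Tw Tw2 formDr !formZl !formZr in B1.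
have B2 := Gplus_form w w; rewrite Tw !formDl !formDr !formZl !formZr (form_sym w w2) in B2.
have B3 := Gplus_form w2 v; rewrite Tv Tw2 formZl in B3.
have Z : w2 = 0; last by rewrite Z eqxx in w20.
apply: (@form_radical w w2 v); [|lra..].
apply: cols3_unit => a b d E.
have E1 := congr1 (mulmx T) E; rewrite mulmx0 lincomb_act Tw Tw2 Tv in E1.
have E2 := congr1 (mulmx T) E1; rewrite mulmx0 lincomb_act !mulmxDr -!scalemxAr Tw Tw2 Tv in E2.
have C i : [/\ a * w i 0 + b * w2 i 0 + d * v i 0 = 0,
   a * (w2 i 0 - w i 0) - b * w2 i 0 + d * v i 0 = 0 &
   a * (w i 0 - 2 * w2 i 0) + b * w2 i 0 + d * v i 0 = 0].
  by split; [move/colP/(_ i): E|move/colP/(_ i): E1|move/colP/(_ i): E2]; rewrite !mxE; lra.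
have a0 : a = 0 by apply: (scaled_eq0 w20); apply/colP => i; have [? ? ?] := C i; rewrite !mxE; lra.
have d0 : d = 0 by apply: (scaled_eq0 v0); apply/colP => i; have [] := C i; rewrite a0 !mxE; lra.
split=> //; apply: (scaled_eq0 w20); apply/colP => i; have [] := C i; rewrite a0 d0 !mxE; lra.
Qed.

(** If (T - 1)^2 were nonzero, T would be a full Jordan block in the basis e1, e2, x, against
    [shift_degenerate]. *)
Lemma unipotent_square : s = 3 -> forall x, let w := T *m x - x in T *m w = w.
Proof.
move=> sE x; apply: contrapT => /eqP; rewrite -subr_eq0 /= => e10.
have [e2 e2E] : exists e2, e2 = T *m x - x by exists (T *m x - x).
rewrite -e2E in e10.
have [e1 e1E] : exists e1, e1 = T *m e2 - e2 by exists (T *m e2 - e2).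
rewrite -e1E in e10.
have T3 : T *m x = x + e2 by rewrite e2E addrC subrK.
have T2 : T *m e2 = e2 + e1 by rewrite e1E addrC subrK.
have T1 : T *m e1 = e1.
  have := Gplus_quadratic x; rewrite /= -e2E sE T2 mulmxDr T2 => E.
  by apply/colP => i; move/colP/(_ i): E; rewrite !mxE; lra.
have uP : cols3 e1 e2 x \in unitmx.
  apply: cols3_unit => a b d E.
  have E1 := congr1 (mulmx T) E; rewrite mulmx0 lincomb_act T1 T2 T3 in E1.
  have E2 := congr1 (mulmx T) E1; rewrite mulmx0 lincomb_act !mulmxDr T1 T2 T3 in E2.
  have C i : [/\ a * e1 i 0 + b * e2 i 0 + d * x i 0 = 0,
     a * e1 i 0 + b * (e2 i 0 + e1 i 0) + d * (x i 0 + e2 i 0) = 0 &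
     a * e1 i 0 + b * (e2 i 0 + 2 * e1 i 0) + d * (x i 0 + 2 * e2 i 0 + e1 i 0) = 0].
    by split; [move/colP/(_ i): E|move/colP/(_ i): E1|move/colP/(_ i): E2]; rewrite !mxE; lra.
  have d0 : d = 0 by apply: (scaled_eq0 e10); apply/colP => i; have [? ? ?] := C i; rewrite !mxE; lra.
  have b0 : b = 0 by apply: (scaled_eq0 e10); apply/colP => i; have [] := C i; rewrite d0 !mxE; lra.
  by split=> //; apply: (scaled_eq0 e10); apply/colP => i; have [] := C i; rewrite d0 b0 !mxE; lra.
have TP : T *m cols3 e1 e2 x = cols3 e1 e2 x *m mx3 [:: [:: 1; 1; 0]; [:: 0; 1; 1]; [:: 0; 0; 1]].
  rewrite mul_cols3 cols3_mulmx T1 T2 T3 !mxE /= !scale0r !scale1r !addr0 !add0r.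
  by rewrite (addrC e1) (addrC e2 x).
have /shift_degenerate : Gplus (act (cols3 e1 e2 x) G) (mx3 [:: [:: 1; 1; 0]; [:: 0; 1; 1]; [:: 0; 0; 1]]).
  by apply/(Gplus_conj _ uP TP).
move/(_ (act_torsion_free _ tfG)); rewrite ricci_act // !unitmx_mul unitmx_tr uP /= andbT.
by rewrite uric.
Qed.

(** Now (T - 1)^2 = 0. A nonzero e1 = T e2 - e2 is orthogonal to itself, to e2 and to the image of T
    - 1. If that image is not a line this already covers a basis; if it is, invariance of rho(e2, z)
    gives rho(e1, z) = 0 for all z. *)
Lemma positive_parabolic : s = 3 -> T = 1%:M.
Proof.
move=> sE; apply: contrapT => /moved_vector[e2 e10].
have fix_ := unipotent_square sE; have := fix_ e2.
have [e1 e1E] : exists e1, e1 = T *m e2 - e2 by exists (T *m e2 - e2).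
rewrite -e1E in e10 *; rewrite /= => T1.
have T2 : T *m e2 = e2 + e1 by rewrite e1E addrC subrK.
have B1 := Gplus_form e1 e2; rewrite T1 T2 formDr in B1.
have B2 := Gplus_form e2 e2; rewrite T2 !formDl !formDr (form_sym e2 e1) in B2.
have Z : e1 = 0; last by rewrite Z eqxx in e10.
have [[z nz]|par] := pselect (exists z, forall m, T *m z - z <> m *: e1).
  have := fix_ z; rewrite /=; have [f fE] : exists f, f = T *m z - z by exists (T *m z - z).
  rewrite -fE in nz * => Tf.
  have Tz : T *m z = z + f by rewrite fE addrC subrK.
  have B3 := Gplus_form e1 z; rewrite T1 Tz formDr in B3.
  apply: (@form_radical e1 f e2); [|lra..].
  apply: cols3_unit => a b d E.
  have E1 := congr1 (mulmx T) E; rewrite mulmx0 lincomb_act T1 Tf T2 in E1.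
  have d0 : d = 0.
    apply: (scaled_eq0 e10); apply/colP => i; move/colP/(_ i): E; move/colP/(_ i): E1; rewrite !mxE; lra.
  have b0 : b = 0.
    apply: contrapT => /eqP b0; apply: (nz (- a / b)); apply: (scalerI b0).
    apply/colP => i; move/colP/(_ i): E; rewrite d0 !mxE => e.
    by transitivity (- a * e1 i 0); [lra|field].
  by split=> //; apply: (scaled_eq0 e10); rewrite -[RHS]E b0 d0 !scale0r !addr0.
apply: form_nondeg => z.
have [m fm] : exists m, T *m z - z = m *: e1.
  by apply: contrapT => nm; apply: par; exists z => m fm; apply: nm; exists m.
have Tz : T *m z = z + m *: e1 by rewrite -fm addrC subrK.
have B3 := Gplus_form e2 z; rewrite T2 Tz !formDl !formDr !formZr (form_sym e2 e1) in B3.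
have e1e2 : B e1 e2 = 0 by lra.
have e1e1 : B e1 e1 = 0 by lra.
by move: B3; rewrite e1e2 e1e1; lra.
Qed.

Lemma spectral_trichotomy : T <> 1%:M ->
  [\/ exists c P, [/\ P \in unitmx, c != 0, c ^+ 2 != 1 &
         T *m P = P *m mx3 [:: [:: c; 0; 0]; [:: 0; c^-1; 0]; [:: 0; 0; 1]]],
      exists p q P, [/\ P \in unitmx, p ^+ 2 + q ^+ 2 = 1, q != 0 & T *m P = P *m rot p q]
    | T *m T = 1%:M].
Proof.
move=> T1; have [s4|s4|s4] := ltgtP ((s - 1) ^+ 2) 4.
- by apply: Or32; exact: elliptic_basis.
- by apply: Or31; exact: hyperbolic_basis.
- have : (s - 3) * (s + 1) = 0 by lra.
  move/eqP; rewrite mulf_eq0 subr_eq0 addr_eq0 => /orP[/eqP s3|/eqP s3].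
    by case: T1; exact: positive_parabolic.
  by apply: Or33; exact: negative_parabolic.
Qed.

Lemma involution_basis : T <> 1%:M -> T *m T = 1%:M ->
  exists2 P, P \in unitmx & T *m P = P *m mx3 [:: [:: -1; 0; 0]; [:: 0; -1; 0]; [:: 0; 0; 1]].
Proof.
move=> /moved_vector[x w0] TT.
have [w wE] : exists w, w = T *m x - x by exists (T *m x - x).
have anti y : T *m (T *m y - y) = - (T *m y - y) by rewrite mulmxBr mulmxA TT mul1mx opprB.
have Tw : T *m w = - w by rewrite wE anti.
rewrite -wE in w0.
have [[z nz]|par] := pselect (exists z, forall m, T *m z - z <> m *: w).
  have [u uE] : exists u, u = T *m z - z by exists (T *m z - z).
  have Tu : T *m u = - u by rewrite uE anti.
  rewrite -uE in nz.
  have [v v0 Tv] := Gplus_fixed.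
  exists (cols3 w u v); last first.
    by rewrite mul_cols3 cols3_mulmx Tw Tu Tv !mxE /= !scale0r !scaleN1r !scale1r !addr0 !add0r.
  apply: cols3_unit => a b d E.
  have E1 := congr1 (mulmx T) E; rewrite mulmx0 lincomb_act Tw Tu Tv in E1.
  have d0 : d = 0.
    apply: (scaled_eq0 v0); apply/colP => i; move/colP/(_ i): E; move/colP/(_ i): E1; rewrite !mxE; lra.
  have b0 : b = 0.
    apply: contrapT => /eqP b0; apply: (nz (- a / b)); apply: (scalerI b0).
    apply/colP => i; move/colP/(_ i): E; rewrite d0 !mxE => e.
    by transitivity (- a * w i 0); [lra|field].
  by split=> //; apply: (scaled_eq0 w0); rewrite -[RHS]E b0 d0 !scale0r !addr0.
(* Otherwise T - 1 = w f^T has rank one and T would be a reflection. *)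
exfalso.
have [f fE] : exists f : 'I_3 -> R, forall i j, T i j = (i == j)%:R + w i 0 * f j.
  have /choice[f fE] : forall j, exists m, T *m delta_mx j 0 - delta_mx j 0 = m *: w.
    by move=> j; apply: contrapT => nm; apply: par; exists (delta_mx j 0) => m fm; apply: nm; exists m.
  exists f => i j; have /colP/(_ i) := fE j; rewrite -colE !mxE eqxx andbT; lra.
have D1 := Gplus_det tfG uric GT; rewrite det3 !fE /= in D1.
(* T w = - w gives f w = - 2, whereas det (1 + w f^T) = 1 + f w must be 1. *)
have fw : f i1 * w i1 0 + f i2 * w i2 0 + f i3 * w i3 0 = - 2.
  have [i wi] : exists i, w i 0 != 0.
    apply: contrapT => nw; case/eqP: w0; apply/colP => i; rewrite [RHS]mxE; apply/eqP.
    by apply: contrapT => /negP wi; apply: nw; exists i.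
  apply: (mulfI wi); move/colP/(_ i): Tw; rewrite mulmx3 !fE mxE; move: i {wi}.
  by apply: ord3P; rewrite /=; lra.
have /eqP : (1 : R) = 0 by lra.
by rewrite oner_eq0.
Qed.

End Isometry.
End SpectralTypes.

(** * Groups of involutions *)

Section Involutions.
Variable R : realType.
Implicit Types (G H : christoffel R) (a b c d p q r x y z : R) (A T S P : 'M[R]_3).

Definition flip3 : 'M[R]_3 := mx3 [:: [:: -1; 0; 0]; [:: 0; -1; 0]; [:: 0; 0; 1]].
Definition flip1 : 'M[R]_3 := mx3 [:: [:: 1; 0; 0]; [:: 0; -1; 0]; [:: 0; 0; -1]].

Lemma flip3_sqr : flip3 *m flip3 = 1%:M.
Proof. by rewrite mul_mx3; apply: mx3P; rewrite !mxE /=; ring. Qed.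

Lemma flip1_sqr : flip1 *m flip1 = 1%:M.
Proof. by rewrite mul_mx3; apply: mx3P; rewrite !mxE /=; ring. Qed.

Lemma involution_order T : T <> 1 -> T *m T = 1%:M -> has_order T 2.
Proof.
move=> T1 TT; split=> //; by case=> [|[|m]] // _; rewrite expr1.
Qed.

Lemma involutions_commute G : (forall T, Gplus G T -> T *m T = 1%:M) ->
  forall S T, Gplus G S -> Gplus G T -> S *m T = T *m S.
Proof.
move=> inv S T GS GT; have := inv _ (GplusM GS GT).
move/(congr1 (fun Z => S *m Z *m T)); rewrite mulmx1 !mulmxA (inv _ GS) mul1mx.
by rewrite -!mulmxA (inv _ GT) mulmx1 => ->.
Qed.

Lemma Z2_isog (X : set 'M[R]_3) D : D <> 1 -> D *m D = 1%:M -> X 1 -> X D ->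
  (forall T, X T -> T = 1 \/ T = D) -> mxgroup_isog X [set: 'Z_2]%G.
Proof.
move=> D1 DD X1 XD XE; exists (fun x : 'Z_2 => D ^+ x).
  split=> [x _|x y _ _|T /XE].
  - by case: x => [[|[|//]] lt_x]; rewrite /= ?expr0 ?expr1.
  - case: x y => [[|[|//]] ltx] [[|[|//]] lty] /= E; apply: val_inj => //=; exfalso; move: E;
      by rewrite expr0 expr1 => // /esym.
  - by case=> ->; [exists 0|exists 1] => //; rewrite /= inE.
move=> x y _ _; rewrite mulmxE -exprD.
have -> : (x * y)%g = ((x + y) %% 2)%N :> nat by [].
by apply: expr_mod; rewrite expr2 -mulmxE.
Qed.

Lemma Z2Z2_isog (X : set 'M[R]_3) :
  (forall T, X T <-> [\/ T = 1, T = flip3, T = flip1 | T = flip3 *m flip1]) ->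
  mxgroup_isog X [set: 'Z_2 * 'Z_2]%G.
Proof.
move=> XE; have E31 : flip3 *m flip1 = mx3 [:: [:: -1; 0; 0]; [:: 0; 1; 0]; [:: 0; 0; -1]].
  by rewrite mul_mx3; apply: mx3P; rewrite !mxE /=; ring.
have C : flip3 *m flip1 = flip1 *m flip3.
  by rewrite !mul_mx3; apply: mx3P; rewrite !mxE /=; ring.
exists (fun x : 'Z_2 * 'Z_2 => flip3 ^+ x.1 *m flip1 ^+ x.2).
  split=> [x _|x y _ _|T /XE].
  - apply/XE; case: x => [[[|[|//]] ?] [[|[|//]] ?]] /=; rewrite ?expr0 ?expr1 ?mulmx1 ?mul1mx.
    + exact: Or41.
    + exact: Or43.
    + exact: Or42.
    + exact: Or44.
  - case: x y => [[[|[|//]] ?] [[|[|//]] ?]] [[[|[|//]] ?] [[|[|//]] ?]] /=;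
      rewrite ?expr0 ?expr1 ?mulmx1 ?mul1mx ?E31 => E; congr (_, _); apply: val_inj => //=; exfalso;
      move/matrixP: E => E; have := E i1 i1; have := E i2 i2; rewrite !mxE /=; lra.
  - by case=> ->; [exists (0, 0)|exists (1, 0)|exists (0, 1)|exists (1, 1)];
      rewrite /= ?inE // ?expr0 ?expr1 ?mulmx1 ?mul1mx.
move=> [x1 x2] [y1 y2] _ _ /=.
have E n D (x y : 'Z_2) : n = (x * y)%g -> D *m D = 1%:M -> D ^+ (n : 'Z_2) = D ^+ x *m D ^+ y :> 'M[R]_3.
  move=> -> DD; rewrite mulmxE -exprD.
  have -> : (x * y)%g = ((x + y) %% 2)%N :> nat by [].
  by apply: expr_mod; rewrite expr2 -mulmxE.
rewrite (E _ _ x1 y1 erefl flip3_sqr) (E _ _ x2 y2 erefl flip1_sqr) !mulmxA; congr (_ *m _).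
rewrite -!mulmxA; congr (_ *m _).
by rewrite !mulmxE; apply/esym/commrX/commr_sym/commrX; rewrite /GRing.comm -!mulmxE.
Qed.

Lemma klein_scale x y z p q r : p != 0 -> q != 0 -> r != 0 ->
  isomorphic (klein x y z) (klein (x * p * q / r) (y * p * r / q) (z * q * r / p)).
Proof.
move=> p0 q0 r0; set D : 'M[R]_3 := mx3 [:: [:: p; 0; 0]; [:: 0; q; 0]; [:: 0; 0; r]].
have uD : D \in unitmx by rewrite unitmxE unitfE det3 !mx3E /= !(mulr0, mul0r, subr0, addr0) !mulf_neq0.
exists D => //; apply/esym/actP3 => //.
have [L1 L2 L3] := Lmx_klein x y z.
have [M1 M2 M3] := Lmx_klein (x * p * q / r) (y * p * r / q) (z * q * r / p).
by apply: ord3P; rewrite /D L1 L2 L3 ?M1 ?M2 ?M3; act_mx3; field; rewrite ?p0 ?q0 ?r0.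
Qed.

Lemma klein_swap12 x y z : isomorphic (klein x y z) (klein x z y).
Proof.
set D : 'M[R]_3 := mx3 [:: [:: 0; 1; 0]; [:: 1; 0; 0]; [:: 0; 0; 1]].
have uD : D \in unitmx.
  have dD : \det D = -1 by rewrite det3 !mx3E /=; ring.
  by rewrite unitmxE dD unitrN1.
exists D => //; apply/esym/actP3 => //.
have [L1 L2 L3] := Lmx_klein x y z; have [M1 M2 M3] := Lmx_klein x z y.
by apply: ord3P; rewrite /D L1 L2 L3 ?M1 ?M2 ?M3; act_mx3; ring.
Qed.

Lemma klein_swap23 x y z : isomorphic (klein x y z) (klein y x z).
Proof.
set D : 'M[R]_3 := mx3 [:: [:: 1; 0; 0]; [:: 0; 0; 1]; [:: 0; 1; 0]].
have uD : D \in unitmx.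
  have dD : \det D = -1 by rewrite det3 !mx3E /=; ring.
  by rewrite unitmxE dD unitrN1.
exists D => //; apply/esym/actP3 => //.
have [L1 L2 L3] := Lmx_klein x y z; have [M1 M2 M3] := Lmx_klein y x z.
by apply: ord3P; rewrite /D L1 L2 L3 ?M1 ?M2 ?M3; act_mx3; ring.
Qed.

Lemma klein_opp x y z : isomorphic (klein x y z) (klein (- x) (- y) (- z)).
Proof.
have := @klein_scale x y z (-1) 1 1; rewrite oppr_eq0 oner_eq0 => /(_ isT isT isT).
by rewrite invrN1 !divr1 !mulr1 !mulrN1.
Qed.

Lemma klein_signs x y z : x != 0 -> y != 0 -> z != 0 ->
  isomorphic (klein x y z) (klein (Num.sg x) (Num.sg y) (Num.sg z)).
Proof.
move=> x0 y0 z0.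
have sq (u : R) : u != 0 -> exists2 r : R, r != 0 & u = Num.sg u * r ^+ 2.
  move=> u0; exists (Num.sqrt `|u|); first by rewrite gt_eqF // sqrtr_gt0 normr_gt0.
  by rewrite sqr_sqrtr // -numEsg.
have [X X0 xE] := sq _ x0; have [Y Y0 yE] := sq _ y0; have [Z Z0 zE] := sq _ z0.
(* The scale factors are p = 1/(X Y), q = 1/(X Z), r = 1/(Y Z), for which p q / r = 1/X^2 and
   cyclically. *)
have -> : Num.sg x = x * (X * Y)^-1 * (X * Z)^-1 / (Y * Z)^-1.
  by rewrite [in RHS]xE; field; rewrite X0 Y0 Z0.
have -> : Num.sg y = y * (X * Y)^-1 * (Y * Z)^-1 / (X * Z)^-1.
  by rewrite [in RHS]yE; field; rewrite X0 Y0 Z0.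
have -> : Num.sg z = z * (X * Z)^-1 * (Y * Z)^-1 / (X * Y)^-1.
  by rewrite [in RHS]zE; field; rewrite X0 Y0 Z0.
by apply: klein_scale; rewrite invr_eq0 mulf_neq0.
Qed.

(** Exchanging basis vectors permutes the signs and e1 -> - e1 reverses all three, so only the
    patterns + + + and + + - remain. *)
Lemma klein_normal_form x y z : x != 0 -> y != 0 -> z != 0 ->
  isomorphic (klein x y z) (klein 1 1 1) \/ isomorphic (klein x y z) (Gamma_Z2Z2 R).
Proof.
move=> x0 y0 z0; have S := klein_signs x0 y0 z0.
suff : isomorphic (klein (Num.sg x) (Num.sg y) (Num.sg z)) (klein 1 1 1) \/
       isomorphic (klein (Num.sg x) (Num.sg y) (Num.sg z)) (klein 1 1 (-1)).
  by case=> h; [left|right]; exact: isom_trans S h.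
have Opp (a b c : R) H : isomorphic (klein (- a) (- b) (- c)) H -> isomorphic (klein a b c) H.
  exact/isom_trans/klein_opp.
have S12 (a b c : R) H : isomorphic (klein a c b) H -> isomorphic (klein a b c) H.
  exact/isom_trans/klein_swap12.
have S23 (a b c : R) H : isomorphic (klein b a c) H -> isomorphic (klein a b c) H.
  exact/isom_trans/klein_swap23.
have sgn (u : R) : u != 0 -> Num.sg u = 1 \/ Num.sg u = -1.
  by move=> u0; have [/gtr0_sg|/ltr0_sg|E] := ltgtP 0 u; [left|right|rewrite -E eqxx in u0].
have [->|->] := sgn x x0; have [->|->] := sgn y y0; have [->|->] := sgn z z0.
- by left; exact: isom_refl.
- by right; exact: isom_refl.
- by right; apply: S12; exact: isom_refl.
- by right; apply: Opp; rewrite !opprK; apply: S23; apply: S12; exact: isom_refl.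
- by right; apply: S23; apply: S12; exact: isom_refl.
- by right; apply: Opp; rewrite !opprK; apply: S12; exact: isom_refl.
- by right; apply: Opp; rewrite !opprK; exact: isom_refl.
- by left; apply: Opp; rewrite !opprK; exact: isom_refl.
Qed.

Lemma ricci_klein x y z : ricci (klein x y z) =
  mx3 [:: [:: - 2 * x * y; 0; 0]; [:: 0; - 2 * x * z; 0]; [:: 0; 0; - 2 * y * z]].
Proof.
rewrite ricciE; last exact: symbols_torsion_free.
have [L1 L2 L3] := Lmx_klein x y z.
apply: mx3P; rewrite !mxE sum3 L1 L2 L3 mul_mx3 !tr3 !mx3E /= /klein !symbolsE /=; ring.
Qed.

(** The two flips kill every symbol in which the indices 3 and 1 do not both appear an odd number of
    times; what survives has three distinct indices. *)
Lemma flips_normal_form G : torsion_free G -> ricci G \in unitmx ->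
  Gplus G flip3 -> Gplus G flip1 ->
  isomorphic G (klein 1 1 1) \/ isomorphic G (Gamma_Z2Z2 R).
Proof.
move=> tfG uric /diag3_fixed /= F3 /diag3_fixed /= F1.
have GE : G = klein (G i1 i2 i3) (G i1 i3 i2) (G i2 i3 i1).
  apply: christoffelP; first [exact: tfG | exact: symbols_torsion_free |
    apply: ord3P; rewrite /klein !symbolsE /= ?addr0 ?add0r //].
  - by have := F1 i1 i1 i1; have := F3 i1 i1 i1; rewrite /=; lra.
  - by have := F1 i1 i1 i2; have := F3 i1 i1 i2; rewrite /=; lra.
  - by have := F1 i1 i1 i3; have := F3 i1 i1 i3; rewrite /=; lra.
  - by have := F1 i1 i2 i1; have := F3 i1 i2 i1; rewrite /=; lra.
  - by have := F1 i1 i2 i2; have := F3 i1 i2 i2; rewrite /=; lra.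
  - by have := F1 i1 i3 i1; have := F3 i1 i3 i1; rewrite /=; lra.
  - by have := F1 i1 i3 i3; have := F3 i1 i3 i3; rewrite /=; lra.
  - by have := F1 i2 i2 i1; have := F3 i2 i2 i1; rewrite /=; lra.
  - by have := F1 i2 i2 i2; have := F3 i2 i2 i2; rewrite /=; lra.
  - by have := F1 i2 i2 i3; have := F3 i2 i2 i3; rewrite /=; lra.
  - by have := F1 i2 i3 i2; have := F3 i2 i3 i2; rewrite /=; lra.
  - by have := F1 i2 i3 i3; have := F3 i2 i3 i3; rewrite /=; lra.
  - by have := F1 i3 i3 i1; have := F3 i3 i3 i1; rewrite /=; lra.
  - by have := F1 i3 i3 i2; have := F3 i3 i3 i2; rewrite /=; lra.
  - by have := F1 i3 i3 i3; have := F3 i3 i3 i3; rewrite /=; lra.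
move: uric; rewrite GE ricci_klein => /mx3_diag_unit[].
rewrite !mulf_eq0 !negb_or => /andP[/andP[_ x0] y0] /andP[_ z0] _.
exact: klein_normal_form.
Qed.

Lemma commuting_flip G S : Gplus G flip3 -> Gplus G S -> S *m flip3 = flip3 *m S ->
  S *m S = 1%:M -> \det S = 1 -> S <> 1%:M -> S <> flip3 ->
  exists2 P, P \in unitmx & Gplus (act P G) flip3 /\ Gplus (act P G) flip1.
Proof.
move=> G3 GS /matrixP C /matrixP SS dS S1 S3.
have S13 : S i1 i3 = 0 by have := C i1 i3; rewrite !mulmx3 !mxE /=; lra.
have S23 : S i2 i3 = 0 by have := C i2 i3; rewrite !mulmx3 !mxE /=; lra.
have S31 : S i3 i1 = 0 by have := C i3 i1; rewrite !mulmx3 !mxE /=; lra.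
have S32 : S i3 i2 = 0 by have := C i3 i2; rewrite !mulmx3 !mxE /=; lra.
have [p [q [r [s [t SE]]]]] : exists p q r s t,
    S = mx3 [:: [:: p; q; 0]; [:: r; s; 0]; [:: 0; 0; t]].
  exists (S i1 i1), (S i1 i2), (S i2 i1), (S i2 i2), (S i3 i3).
  by apply: mx3P; rewrite [RHS]mxE.
subst S; rewrite det3 !mx3E /= in dS => {C S13 S23 S31 S32}.
have t2 : t ^+ 2 = 1 by have := SS i3 i3; rewrite mulmx3 !mxE /=; lra.
have pq : p ^+ 2 + q * r = 1 by have := SS i1 i1; rewrite mulmx3 !mxE /=; lra.
have sq : s ^+ 2 + q * r = 1 by have := SS i2 i2; rewrite mulmx3 !mxE /=; lra.
have qps : q * (p + s) = 0 by have := SS i1 i2; rewrite mulmx3 !mxE /=; lra.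
have rps : r * (p + s) = 0 by have := SS i2 i1; rewrite mulmx3 !mxE /=; lra.
(* Otherwise the block of S is 1 or -1, and det S = 1 leaves only S = 1 or S = [flip3]. *)
have tr0 : p + s = 0.
  apply: contrapT => /eqP ps.
  have q0 : q = 0 by apply: (mulIf ps); rewrite mul0r.
  have r0 : r = 0 by apply: (mulIf ps); rewrite mul0r.
  have p2 : p ^+ 2 = 1 by move: pq; rewrite q0; lra.
  have s2 : s ^+ 2 = 1 by move: sq; rewrite q0; lra.
  move: dS S1 S3; rewrite q0 r0; move: ps; case: (sqr_eq1P t2) => ->;
    case: (sqr_eq1P p2) => ->; case: (sqr_eq1P s2) => -> ps dS S1 S3.
  - by apply: S1; apply: mx3P; rewrite !mxE.
  - by have /eqP : (1 : R) = 0 by [lra]; rewrite oner_eq0.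
  - by have /eqP : (1 : R) = 0 by [lra]; rewrite oner_eq0.
  - by apply: S3.
  - by have /eqP : (1 : R) = 0 by [lra]; rewrite oner_eq0.
  - by move: ps; rewrite subrr eqxx.
  - by move: ps; rewrite addNr eqxx.
  - by have /eqP : (1 : R) = 0 by [lra]; rewrite oner_eq0.
have sE : s = - p by lra.
have tE : t = -1.
  have : t * (p * s - q * r) = 1 by move: dS; lra.
  by have -> : p * s - q * r = -1; [rewrite sE|]; lra.
rewrite sE tE in GS.
(* The columns of P are eigenvectors of the block for 1 and -1. The general formula, used in the
   second case, reads them off from the block plus and minus 1 and fails at p = -1. *)
have [p1|p1] := eqVneq (1 + p) 0.
  set P : 'M[R]_3 := mx3 [:: [:: q; 2; 0]; [:: 2; - r; 0]; [:: 0; 0; 1]].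
  have pE : p = -1 by lra.
  have qr : q * r = 0 by move: pq; rewrite pE; lra.
  have uP : P \in unitmx.
    rewrite unitmxE unitfE det3 !mx3E /=.
    suff -> : q * (- r * 1 - 0 * 0) - 2 * (2 * 1 - 0 * 0) + 0 * (2 * 0 - - r * 0) = - 4 by rewrite oppr_eq0 pnatr_eq0.
    by lra.
  exists P => //; split.
  - suff h : flip3 *m P = P *m flip3 by exact: (proj1 (Gplus_conj _ uP h) G3).
  by rewrite /P /flip3 !mul_mx3; apply: mx3_congr; lra.
  suff h : mx3 [:: [:: p; q; 0]; [:: r; - p; 0]; [:: 0; 0; -1]] *m P = P *m flip1
  by exact: (proj1 (Gplus_conj _ uP h) GS).
by rewrite /P /flip1 !mul_mx3 pE; apply: mx3_congr; lra.
set P : 'M[R]_3 := mx3 [:: [:: 1 + p; - q; 0]; [:: r; 1 + p; 0]; [:: 0; 0; 1]].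
have uP : P \in unitmx.
  rewrite unitmxE unitfE det3 !mx3E /=.
  suff -> : (1 + p) * ((1 + p) * 1 - 0 * 0) - - q * (r * 1 - 0 * 0) + 0 * (r * 0 - (1 + p) * 0) = 2 * (1 + p).
    by rewrite mulf_neq0 // pnatr_eq0.
  by lra.
exists P => //; split.
- suff h : flip3 *m P = P *m flip3 by exact: (proj1 (Gplus_conj _ uP h) G3).
  by rewrite /P /flip3 !mul_mx3; apply: mx3_congr; lra.
suff h : mx3 [:: [:: p; q; 0]; [:: r; - p; 0]; [:: 0; 0; -1]] *m P = P *m flip1
  by exact: (proj1 (Gplus_conj _ uP h) GS).
by rewrite /P /flip1 !mul_mx3; apply: mx3_congr; lra.
Qed.

Lemma klein_not_involutive : exists2 T, Gplus (klein (1 : R) 1 1) T & T *m T <> 1%:M.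
Proof.
have [L1 L2 L3] := Lmx_klein (1 : R) 1 1.
set T : 'M[R]_3 := mx3 [:: [:: 0; 1; 0]; [:: 0; 0; 1]; [:: 1; 0; 0]].
have dT : \det T = 1 by rewrite det3 !mx3E /=; ring.
exists T.
  split; rewrite ?dT ?ltr01 //; apply/actP3; first by rewrite unitmxE dT unitr1.
  by apply: ord3P; rewrite /T L1 L2 L3; act_mx3; ring.
by rewrite /T mul_mx3 => /matrixP/(_ i1 i1); rewrite !mxE /=; lra.
Qed.

(** T commutes with both flips, hence is diagonal with entries 1 and -1, and the determinant leaves
    four such matrices. The assumption on involutions is inherited from the original structure
    through the isomorphism. *)
Lemma Gplus_Z2Z2 : (forall T, Gplus (Gamma_Z2Z2 R) T -> T *m T = 1%:M) ->
  forall T, Gplus (Gamma_Z2Z2 R) T <-> [\/ T = 1, T = flip3, T = flip1 | T = flip3 *m flip1].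
Proof.
rewrite -/(klein 1 1 (-1)) => inv T.
have [L1 L2 L3] := Lmx_klein (1 : R) 1 (-1).
have G3 : Gplus (klein 1 1 (-1)) flip3.
  have dT : \det flip3 = 1 by rewrite det3 !mx3E /=; ring.
  split; rewrite ?dT ?ltr01 //; apply/actP3; first by rewrite unitmxE dT unitr1.
  by apply: ord3P; rewrite /flip3 L1 L2 L3; act_mx3; ring.
have G1 : Gplus (klein 1 1 (-1)) flip1.
  have dT : \det flip1 = 1 by rewrite det3 !mx3E /=; ring.
  split; rewrite ?dT ?ltr01 //; apply/actP3; first by rewrite unitmxE dT unitr1.
  by apply: ord3P; rewrite /flip1 L1 L2 L3; act_mx3; ring.
split=> [GT|]; last by case=> ->; [exact: Gplus1| | |exact: GplusM].
have /matrixP C3 := involutions_commute inv GT G3.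
have /matrixP C1 := involutions_commute inv GT G1.
have /matrixP TT := inv _ GT.
have T12 : T i1 i2 = 0 by have := C1 i1 i2; rewrite !mulmx3 !mxE /=; lra.
have T21 : T i2 i1 = 0 by have := C1 i2 i1; rewrite !mulmx3 !mxE /=; lra.
have T13 : T i1 i3 = 0 by have := C3 i1 i3; rewrite !mulmx3 !mxE /=; lra.
have T31 : T i3 i1 = 0 by have := C3 i3 i1; rewrite !mulmx3 !mxE /=; lra.
have T23 : T i2 i3 = 0 by have := C3 i2 i3; rewrite !mulmx3 !mxE /=; lra.
have T32 : T i3 i2 = 0 by have := C3 i3 i2; rewrite !mulmx3 !mxE /=; lra.
have s1 : T i1 i1 ^+ 2 = 1 by have := TT i1 i1; rewrite mulmx3 !mxE /= T12 T13; lra.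
have s2 : T i2 i2 ^+ 2 = 1 by have := TT i2 i2; rewrite mulmx3 !mxE /= T21 T23; lra.
have s3 : T i3 i3 ^+ 2 = 1 by have := TT i3 i3; rewrite mulmx3 !mxE /= T31 T32; lra.
have TE : T = mx3 [:: [:: T i1 i1; 0; 0]; [:: 0; T i2 i2; 0]; [:: 0; 0; T i3 i3]].
  by apply: mx3P; rewrite [RHS]mxE.
have [dT _] := GT; rewrite det3 T12 T13 T21 T23 T31 T32 in dT; rewrite TE.
move: dT; case: (sqr_eq1P s1) => ->; case: (sqr_eq1P s2) => ->; case: (sqr_eq1P s3) => -> dT;
  try by have /eqP : (1 : R) = 0 by [lra]; rewrite oner_eq0.
- by apply: Or41; apply: mx3P; rewrite !mxE.
- exact: Or43.
- by apply: Or44; rewrite mul_mx3; apply: mx3_congr; ring.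
- exact: Or42.
Qed.

End Involutions.

(** * Assembling the cases *)

Section Cases.
Variable R : realType.
Implicit Types (G H : christoffel R) (a b c d p q r x y z : R) (A T S P : 'M[R]_3).

Lemma ricci_isom_unit G H : torsion_free G -> isomorphic G H ->
  ricci G \in unitmx -> ricci H \in unitmx.
Proof.
by move=> tfG [P uP ->] uric; rewrite ricci_act // !unitmx_mul unitmx_tr uP uric.
Qed.

Lemma isom_torsion_free G H : torsion_free G -> isomorphic G H -> torsion_free H.
Proof. by move=> tfG [P _ ->]; exact: act_torsion_free. Qed.

Lemma Gam_unit e a b c d : ricci (Gam e a b c d) \in unitmx ->
  a * d - 2 * e ^+ 2 != 0 /\ 2 * (b * d - b ^+ 2 + c ^+ 2) != 0 :> R.
Proof. by rewrite ricci_Gam => /mx3_diag_unit[]. Qed.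

Lemma ord3_group a b c d : ricci (Gam 1 a b c d) \in unitmx ->
  let G := Gam 1 a b c d in
  [/\ isomorphic (Gamma_s3 R) G -> mxgroup_isog (Gplus G) [set: {perm 'I_3}]%G,
      (exists s : bool, isomorphic (Gamma_a4 R s) G) -> mxgroup_isog (Gplus G) ('Alt_('I_4))%G
    & ~ isomorphic (Gamma_s3 R) G -> ~ (exists s : bool, isomorphic (Gamma_a4 R s) G) ->
      mxgroup_isog (Gplus G) [set: 'Z_3]%G].
Proof.
move=> /Gam_unit[g0 h0] G; split.
- move=> s3G; apply: isog_isom (isog_null R).
  exact: isom_trans (isom_sym (isom_s3_null R)) s3G.
- move=> [s a4G]; apply: isog_isom (isog_klein R).
  exact: isom_trans (isom_sym (isom_a4_klein R s)) a4G.
- exact: Gam1_generic.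
Qed.

Lemma ord3_finite a b c d : ricci (Gam 1 a b c d) \in unitmx ->
  finite_set (Gplus (Gam 1 a b c d)).
Proof.
move=> /ord3_group[gs3 ga4 gZ3].
have [/gs3|ns3] := pselect (isomorphic (Gamma_s3 R) (Gam 1 a b c d)).
  exact: mxgroup_isog_finite.
have [/ga4|na4] := pselect (exists s, isomorphic (Gamma_a4 R s) (Gam 1 a b c d)).
  exact: mxgroup_isog_finite.
exact: mxgroup_isog_finite (gZ3 ns3 na4).
Qed.

Lemma involutive_isom G H : isomorphic G H ->
  (forall T, Gplus G T -> T *m T = 1%:M) -> forall T, Gplus H T -> T *m T = 1%:M.
Proof.
move=> [P uP ->] inv T GT.
have E : P *m T *m invmx P *m P = P *m T by rewrite mulmxKV.
have /inv EE := proj2 (Gplus_conj _ uP E) GT.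
apply: (can_inj (mulKmx uP)); rewrite mulmx1 -[RHS]mul1mx -EE !mulmxA.
by rewrite !mulmxKV.
Qed.

Lemma flip3_neq1 : flip3 R <> 1.
Proof. by move=> /matrixP/(_ i1 i1); rewrite !mxE /=; lra. Qed.

Lemma flip3_normal_form G : torsion_free G -> Gplus G (flip3 R) ->
  exists a b c d e f g h, G = Gamma_Z2 a b c d e f g h.
Proof.
move=> tfG /diag3_fixed /= F.
exists (G i1 i1 i3), (G i1 i2 i3), (G i1 i3 i1), (G i1 i3 i2), (G i2 i2 i3), (G i2 i3 i1),
  (G i2 i3 i2), (G i3 i3 i3).
apply: christoffelP; first [exact: tfG | exact: symbols_torsion_free |
  apply: ord3P; rewrite /Gamma_Z2 !symbolsE /= ?addr0 ?add0r //].
- by have := F i1 i1 i1; rewrite /=; lra.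
- by have := F i1 i1 i2; rewrite /=; lra.
- by have := F i1 i2 i1; rewrite /=; lra.
- by have := F i1 i2 i2; rewrite /=; lra.
- by have := F i1 i3 i3; rewrite /=; lra.
- by have := F i2 i2 i1; rewrite /=; lra.
- by have := F i2 i2 i2; rewrite /=; lra.
- by have := F i2 i3 i3; rewrite /=; lra.
- by have := F i3 i3 i1; rewrite /=; lra.
- by have := F i3 i3 i2; rewrite /=; lra.
Qed.

Lemma Lmx_Z2 (a b c d e f g h : R) (G := Gamma_Z2 a b c d e f g h) :
  [/\ Lmx G i1 = mx3 [:: [:: 0; 0; c]; [:: 0; 0; d]; [:: a; b; 0]],
      Lmx G i2 = mx3 [:: [:: 0; 0; f]; [:: 0; 0; g]; [:: b; e; 0]] &
      Lmx G i3 = mx3 [:: [:: c; f; 0]; [:: d; g; 0]; [:: 0; 0; h]]].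
Proof.
by split; apply: mx3P; rewrite /G /Gamma_Z2 !mxE /= !symbolsE /= ?addr0 ?add0r.
Qed.

Lemma ricci_Z2 (a b c d e f g h : R) : let rho := ricci (Gamma_Z2 a b c d e f g h) in
  [/\ rho i1 i1 = - 2 * b * d + a * (- c + g + h),
      rho i1 i2 = - d * e - a * f + b * h /\ rho i2 i1 = - d * e - a * f + b * h
    & rho i3 i3 = - c ^+ 2 - 2 * d * f + c * h + g * (- g + h)].
Proof.
have [L1 L2 L3] := Lmx_Z2 a b c d e f g h.
rewrite ricciE; last exact: symbols_torsion_free.
split; [|split|]; rewrite mxE sum3 L1 L2 L3 mul_mx3 !tr3 !mx3E /= /Gamma_Z2 !symbolsE /=; ring.
Qed.

(* Two commuting involutions lead to [klein 1 1 1] or [Gamma_Z2Z2]; the former has an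
   automorphism of order 3. *)
Lemma involutive_normal_form G : torsion_free G -> ricci G \in unitmx ->
  Gplus G <> [set 1] -> (forall T, Gplus G T -> T *m T = 1%:M) ->
  exists2 H, isomorphic G H &
    (H = Gamma_Z2Z2 R /\ mxgroup_isog (Gplus H) [set: 'Z_2 * 'Z_2]%G) \/
    (mxgroup_isog (Gplus H) [set: 'Z_2]%G /\
     exists a b c d e f g h, H = Gamma_Z2 a b c d e f g h).
Proof.
move=> tfG uric ne inv.
have [T GT T1] : exists2 T, Gplus G T & T <> 1%:M.
  apply: contrapT => nT; apply: ne; apply/seteqP; split=> [T GT|T ->] /=; last exact: Gplus1.
  by apply: contrapT => T1; apply: nT; exists T.
have [P uP TP] := involution_basis tfG uric GT T1 (inv _ GT).
have G3 : Gplus (act P G) (flip3 R) := proj1 (Gplus_conj _ uP TP) GT.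
have isoP : isomorphic G (act P G) by exists P.
have tfP := isom_torsion_free tfG isoP; have uricP := ricci_isom_unit tfG isoP uric.
have invP := involutive_isom isoP inv.
have [[S GS [S1 S3]]|only] := pselect (exists2 S, Gplus (act P G) S & S <> 1%:M /\ S <> flip3 R).
  have comm := involutions_commute invP GS G3.
  have [Q uQ [GQ3 GQ1]] := commuting_flip G3 GS comm (invP _ GS) (Gplus_det tfP uricP GS) S1 S3.
  have isoQ : isomorphic (act P G) (act Q (act P G)) by exists Q.
  have isoPQ := isom_trans isoP isoQ.
  have [iso1|isoK] := flips_normal_form (isom_torsion_free tfP isoQ) (ricci_isom_unit tfP isoQ uricP) GQ3 GQ1.
    have [K GK KK] := klein_not_involutive R.
    by case: KK; exact: involutive_isom (isom_trans isoPQ iso1) inv _ GK.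
  exists (Gamma_Z2Z2 R); first exact: isom_trans isoPQ isoK.
  left; split=> //; apply: Z2Z2_isog; apply: Gplus_Z2Z2.
  exact: involutive_isom (isom_trans isoPQ isoK) inv.
exists (act P G) => //; right; split; last exact: flip3_normal_form.
apply: Z2_isog (flip3_neq1) (flip3_sqr R) _ G3 _; first exact: Gplus1.
move=> S GS; have [->|S1] := pselect (S = 1%:M); first by left.
right; apply: contrapT => S3; apply: only; by exists S.
Qed.

End Cases.

Theorem theorem1p12 (R : realType) (p q : nat) (hpq : (p + q = 3)%N)
  (G0 : christoffel R) (hG0 : Zpq p q G0) (hne : Gplus G0 <> [set 1]) :
  exists2 G : christoffel R, isomorphic G0 G &
  [\/ exists a b c d : R,
        [/\ Gplus G = SO11 R,
            G = Gamma_SO11 a b c d,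
            ricci G = (a * d) *: (tens R i1 i2 + tens R i2 i1)
                      + (- b ^+ 2 + b * d + c * (- c + d)) *: tens R i3 i3,
            a * d != 0
          & - b ^+ 2 + b * d + c * (- c + d) != 0],
      exists a b c d : R,
        [/\ Gplus G = SO2 R,
            G = Gamma_SO2 a b c d,
            ricci G = mx3 [:: [:: a * d; 0; 0];
                              [:: 0; a * d; 0];
                              [:: 0; 0; 2 * (b * d - b ^+ 2 + c ^+ 2)]],
            a * d != 0
          & b * d - b ^+ 2 + c ^+ 2 != 0],
      [/\ finite_set (Gplus G),
          (exists2 T, Gplus G T & has_order T 3),
          (exists a b c d : R,
            [/\ G = Gamma_ord3 a b c d,
                ricci G = (a * d - 2) *: (tens R i1 i1 + tens R i2 i2)
                          + (2 * (b * d - b ^+ 2 + c ^+ 2)) *: tens R i3 i3,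
                a * d - 2 != 0
              & - b ^+ 2 + c ^+ 2 + b * d != 0])
        & [/\ isomorphic (Gamma_s3 R) G ->
                mxgroup_isog (Gplus G) [set: {perm 'I_3}]%G,
              (exists s : bool, isomorphic (Gamma_a4 R s) G) ->
                mxgroup_isog (Gplus G) ('Alt_('I_4))%G
            & ~ isomorphic (Gamma_s3 R) G ->
              ~ (exists s : bool, isomorphic (Gamma_a4 R s) G) ->
                mxgroup_isog (Gplus G) [set: 'Z_3]%G]]
    | [/\ finite_set (Gplus G),
          (forall T, Gplus G T -> T <> 1 -> has_order T 2)
        & [/\ mxgroup_isog (Gplus G) [set: 'Z_2 * 'Z_2]%G,
              G = Gamma_Z2Z2 R
            & ricci G = (- 2) *: tens R i1 i1
                        + 2 *: (tens R i2 i2 + tens R i3 i3)]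
          \/
          mxgroup_isog (Gplus G) [set: 'Z_2]%G /\
          exists a b c d e f g h : R,
            [/\ G = Gamma_Z2 a b c d e f g h,
                ricci G i1 i1 = - 2 * b * d + a * (- c + g + h),
                (ricci G i1 i2 = - d * e - a * f + b * h
                 /\ ricci G i2 i1 = - d * e - a * f + b * h),
                ricci G i3 i3 = - c ^+ 2 - 2 * d * f + c * h + g * (- g + h)
              & \det (ricci G) != 0]]].
Proof.
have [tfG uric _] := hG0.
(* The distinction is on the existence of an automorphism of each type in the whole group, so that
   the last case has only involutions. *)
have [[T GT [x [P [uP x0 x21 TP]]]]|nhyp] := pselect (exists2 T, Gplus G0 T &
    exists x P, [/\ P \in unitmx, x != 0, x ^+ 2 != 1 &
      T *m P = P *m mx3 [:: [:: x; 0; 0]; [:: 0; x^-1; 0]; [:: 0; 0; 1]]]).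
  have iso : isomorphic G0 (act P G0) by exists P.
  have GD := proj1 (Gplus_conj _ uP TP) GT.
  exists (act P G0) => //; apply: Or41.
  have [a [b [c [d GE]]]] := hyperbolic_normal_form (isom_torsion_free tfG iso) x0 x21 GD.
  have := ricci_isom_unit tfG iso uric; rewrite GE ricci_SO11 => /mx3_adiag_unit[ad0 h0].
  exists a, b, c, d; split=> //; first exact: Gplus_SO11.
  by apply: mx3P; rewrite !mxE /=; ring.
have [[T GT [x [y [P [uP xy y0 TP]]]]]|nell] := pselect (exists2 T, Gplus G0 T &
    exists x y P, [/\ P \in unitmx, x ^+ 2 + y ^+ 2 = 1, y != 0 & T *m P = P *m rot x y]).
  have iso : isomorphic G0 (act P G0) by exists P.
  have GD := proj1 (Gplus_conj _ uP TP) GT.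
  have [H isoH [a [b [c [d HE]]]]] := elliptic_normal_form (isom_torsion_free tfG iso) xy y0 GD.
  have iso0 := isom_trans iso isoH.
  have uricH := ricci_isom_unit tfG iso0 uric.
  (* The first branch is kappa = 0, the second kappa = 1. *)
  exists H => //; case: HE => HE; rewrite HE in uricH *; have [g0 h0] := Gam_unit uricH.
    have ad0 : a * d != 0 by move: g0; rewrite expr0n mulr0 subr0.
    have h0' : b * d - b ^+ 2 + c ^+ 2 != 0 by move: h0; rewrite mulf_eq0 negb_or => /andP[].
    apply: Or42; exists a, b, c, d; split=> //; first exact: Gplus_SO2.
      by rewrite Gam0.
    by rewrite ricci_Gam expr0n mulr0 subr0.
  apply: Or43; split; first exact: ord3_finite.
  - by exists (rot3 R); [exact: Gplus_rot3|exact: rot3_order].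
  - exists a, b, c, d; split=> //.
    + by rewrite ricci_Gam; apply: mx3P; rewrite !mxE /=; ring.
    + by move: g0; rewrite expr1n mulr1.
    + move: h0; rewrite mulf_eq0 negb_or => /andP[_]; congr (_ != 0); ring.
  - exact: ord3_group.
have inv T : Gplus G0 T -> T *m T = 1%:M.
  move=> GT; have [->|T1] := pselect (T = 1%:M); first by rewrite mulmx1.
  have [hyp|ell|//] := spectral_trichotomy tfG uric GT T1.
    by case: nhyp; exists T.
  by case: nell; exists T.
have [H isoH HE] := involutive_normal_form tfG uric hne inv.
have uricH := ricci_isom_unit tfG isoH uric.
have invH := involutive_isom isoH inv.
exists H => //; apply: Or44; split.
- by case: HE => [[_ /mxgroup_isog_finite]|[/mxgroup_isog_finite]].
- by move=> T GT T1; exact: involution_order T1 (invH _ GT).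
case: HE => [[HE isogH]|[isogH [a [b [c [d [e [f [g [h HE]]]]]]]]]]; [left|right].
  split=> //; rewrite HE -[Gamma_Z2Z2 R]/(klein 1 1 (-1)) ricci_klein.
  by apply: mx3P; rewrite !mxE /=; ring.
split=> //; exists a, b, c, d, e, f, g, h.
rewrite HE in uricH *; have [r11 r12 r33] := ricci_Z2 a b c d e f g h.
by split=> //; rewrite -unitfE -unitmxE.
Qed.
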